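(* Let $m\ge 1$ and let $A_0$ and $A_1$ be two real-analytic $\mathbb{R}_m$-valued functions of one real variable $x_0$, defined in an open subset $\Omega_1\subset\mathbb{R}$. Then there exists a unique sequence of analytic $\mathbb{R}_m$-valued functions $\{A_j\}_{j\ge 0}$ on $\Omega_1$, whose first two terms are the given $A_0,A_1$, such that the series $$f(x_0,\underline{x})=\sum_{j=0}^\infty \underline{x}^j A_j(x_0)$$ converges in an axially symmetric $(m+1)$-dimensional neighbourhood $\Omega\subset\mathbb{R}^{m+1}$ of $\Omega_1$ and $f$ is harmonic, i.e. $\Delta_{\mathbb{R}^{m+1}}f(x_0,\underline{x})=0$. Moreover, $$f(x_0,\underline{x})=\Gamma\left(\tfrac m2\right)\left(\frac{|\underline{x}|\partial_{x_0}}{2}\right)^{-\frac m2}\left[\left(\frac{|\underline{x}|\partial_{x_0}}{2}\right)J_{\frac m2-1}(|\underline{x}|\partial_{x_0})[A_0](x_0)+\frac{m\,\underline{x}}{2}J_{\frac m2}(|\underline{x}|\partial_{x_0})[A_1](x_0)\right],$$ and the initial functions are recovered by $$f(x_0,\underline{x})\big|_{\underline{x}=0}=A_0(x_0),\qquad -\frac1m\,\partial_{\underline{x}}[f(x_0,\underline{x})]\big|_{\underline{x}=0}=A_1(x_0).$$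
   Context: $\mathbb{R}_m$ is the real associative Clifford algebra generated by $e_1,\dots,e_m$ with $e_je_\ell+e_\ell e_j=-2\delta_{j\ell}$. Points of $\mathbb{R}^{m+1}$ are identified with paravectors $x=x_0+\underline{x}$, $x_0\in\mathbb{R}$, $\underline{x}=\sum_{j=1}^m x_je_j$, so that $\underline{x}^2=-|\underline{x}|^2$, and $\Omega_1\subset\mathbb{R}$ is regarded as the subset $\{\underline{x}=0,\ x_0\in\Omega_1\}$ of $\mathbb{R}^{m+1}$. $\Delta_{\mathbb{R}^{m+1}}=\sum_{j=0}^m\partial_{x_j}^2$ and $\partial_{\underline{x}}=\sum_{j=1}^m e_j\partial_{x_j}$ (Dirac operator, acting from the left). A set $\Omega\subset\mathbb{R}^{m+1}$ is axially symmetric if $x_0+\underline{x}\in\Omega$ implies $x_0+M\underline{x}\in\Omega$ for all $M\in SO(m)$. $J_\nu$ is the Bessel function of the first kind; the expressions $\left(\frac z2\right)^{-\nu}J_\nu(z)$ at $z=|\underline{x}|\partial_{x_0}$ are understood through the power series $\left(\frac z2\right)^{-\nu}J_\nu(z)=\sum_{j=0}^\infty\frac{(-1)^jz^{2j}}{2^{2j}j!\,\Gamma(\nu+j+1)}$, so that the first term above (with $\nu=\frac m2-1$) is $\Gamma(\frac m2)\sum_{j\ge0}\frac{(-1)^j|\underline{x}|^{2j}A_0^{(2j)}(x_0)}{2^{2j}j!\,\Gamma(\frac m2+j)}$ and the second (with $\nu=\frac m2$) is $\Gamma(\frac m2)\frac m2\,\underline{x}\sum_{j\ge0}\frac{(-1)^j|\underline{x}|^{2j}A_1^{(2j)}(x_0)}{2^{2j}j!\,\Gamma(\frac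 m2+j+1)}$. *)

(* Defs.v *)
From HB Require Import structures.
From mathcomp Require Import all_boot all_order all_algebra.
From mathcomp Require Import all_classical all_reals all_analysis.
From mathcomp Require Import ring.

Set Implicit Arguments.
Unset Strict Implicit.
Unset Printing Implicit Defensive.

Import Order.TTheory GRing.Theory Num.Theory.
Import numFieldNormedType.Exports.

Local Open Scope classical_set_scope.
Local Open Scope ring_scope.

(* An element a of the Clifford algebra R_m is the family of its coordinates
   in the basis (e_S), S a subset of 'I_m, where
   e_S = e_{j_1} * ... * e_{j_k} for S = {j_1 < ... < j_k}. *)
Definition clifford (R : realType) (m : nat) := {ffun {set 'I_m} -> R}.

Section CliffordAlgebra.
Context {R : realType} {m : nat}.
Local Notation Cl := (clifford R m).
Implicit Types (a b c : Cl) (S T U : {set 'I_m}).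

Definition symdiff S T : {set 'I_m} := (S :\: T) :|: (T :\: S).

(* e_S * e_T = clsign S T *: e_(symdiff S T): one sign for each transposition
   of distinct generators, and one for each e_j * e_j = -1. *)
Definition clsign S T : R := \prod_(i in S) \prod_(j in T | (j <= i)%N) -1.

Definition clbase S : Cl := [ffun T => (T == S)%:R].

Definition clmul a b : Cl :=
  [ffun U => \sum_S clsign S (symdiff S U) * (a S * b (symdiff S U))].

Definition clone : Cl := clbase finset.set0.

Lemma in_symdiff S T i : (i \in symdiff S T) = (i \in S) (+) (i \in T).
Proof. by rewrite !inE; case: (i \in S); case: (i \in T). Qed.

Lemma symdiffA S T U : symdiff S (symdiff T U) = symdiff (symdiff S T) U.
Proof. by apply/setP => i; rewrite !in_symdiff addbA. Qed.

Lemma symdiffK S : cancel (symdiff S) (symdiff S).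
Proof. by move=> T; apply/setP => i; rewrite !in_symdiff addKb. Qed.

Lemma symdiff0s S : symdiff finset.set0 S = S.
Proof. by apply/setP => i; rewrite in_symdiff inE. Qed.

Lemma symdiffss S : symdiff S S = finset.set0.
Proof. by apply/setP => i; rewrite in_symdiff inE addbb. Qed.

Lemma symdiffC S T : symdiff S T = symdiff T S.
Proof. by apply/setP => i; rewrite !in_symdiff addbC. Qed.

Lemma prodN1_symdiff (P : pred 'I_m) (F : 'I_m -> R) S T :
  (forall i, F i * F i = 1) ->
  \prod_(i in symdiff S T | P i) F i =
    \prod_(i in S | P i) F i * \prod_(i in T | P i) F i.
Proof.
move=> FF; rewrite (big_mkcond (fun i => (i \in symdiff S T) && P i)).
rewrite (big_mkcond (fun i => (i \in S) && P i)).
rewrite (big_mkcond (fun i => (i \in T) && P i)) -big_split /=.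
apply: eq_bigr => i _; rewrite in_symdiff.
by case: (i \in S); case: (i \in T); case: (P i); rewrite /= ?mulr1 ?mul1r ?FF.
Qed.

Lemma clsign_symdiffr S T U :
  clsign S (symdiff T U) = clsign S T * clsign S U.
Proof.
rewrite /clsign -big_split /=; apply: eq_bigr => i _.
by rewrite prodN1_symdiff // => j; rewrite mulrNN mulr1.
Qed.

Lemma clsign_symdiffl S T U :
  clsign (symdiff S T) U = clsign S U * clsign T U.
Proof.
rewrite /clsign.
have := @prodN1_symdiff predT (fun i => \prod_(j in U | (j <= i)%N) -1) S T.
rewrite /= !(eq_bigl _ _ (fun i => andbT _)); apply => i.
rewrite -big_split /= big1// => j _.
by rewrite mulrNN mulr1.
Qed.

Lemma clsign0s S : clsign finset.set0 S = 1.
Proof. by rewrite /clsign big_set0. Qed.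

Lemma clsigns0 S : clsign S finset.set0 = 1.
Proof. by rewrite /clsign big1 // => i _; rewrite big1 // => j; rewrite inE. Qed.

HB.instance Definition _ := GRing.Lmodule.on Cl.

Lemma clmulA : associative clmul.
Proof.
move=> a b c; apply/ffunP => U; rewrite !ffunE.
transitivity (\sum_S \sum_T clsign S (symdiff S U) *
    clsign T (symdiff T (symdiff S U)) *
    (a S * b T * c (symdiff T (symdiff S U)))).
  apply: eq_bigr => S _; rewrite ffunE !mulr_sumr; apply: eq_bigr => T _.
  ring.
rewrite exchange_big /=.
transitivity (\sum_V \sum_S clsign V (symdiff V U) * clsign S (symdiff S V) *
    (a S * b (symdiff S V) * c (symdiff V U))); last first.
  apply: eq_bigr => V _; rewrite ffunE mulr_suml mulr_sumr.
  by apply: eq_bigr => S _; ring.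
rewrite exchange_big [RHS]exchange_big /=; apply: eq_bigr => S _.
rewrite [RHS](reindex_inj (can_inj (symdiffK S))) /=; apply: eq_bigr => T _.
rewrite symdiffK; have -> : symdiff (symdiff S T) U = symdiff T (symdiff S U).
  by rewrite symdiffA [symdiff T S]symdiffC.
congr (_ * _); rewrite clsign_symdiffl.
rewrite -[X in clsign S X * _ = _](symdiffK T (symdiff S U)) clsign_symdiffr.
ring.
Qed.

Lemma clmul1 : left_id clone clmul.
Proof.
move=> a; apply/ffunP => U; rewrite ffunE (bigD1 finset.set0) //= big1 => [|S S0].
  by rewrite symdiff0s clsign0s ffunE eqxx !mul1r addr0.
by rewrite ffunE (negbTE S0) mul0r mulr0.
Qed.

Lemma cl1mul : right_id clone clmul.
Proof.
move=> a; apply/ffunP => U; rewrite ffunE (bigD1 U) //= big1 => [|S SU].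
  by rewrite symdiffss clsigns0 ffunE eqxx mulr1 mul1r addr0.
rewrite [clone _]ffunE; case: eqP => [E|_]; last by rewrite !mulr0.
by move: SU; rewrite -(symdiffK S U) E symdiffC symdiff0s eqxx.
Qed.

Lemma clmulDl : left_distributive clmul +%R.
Proof.
move=> a b c; apply/ffunP => U; rewrite !ffunE -big_split /=.
by apply: eq_bigr => S _; rewrite ffunE; ring.
Qed.

Lemma clmulDr : right_distributive clmul +%R.
Proof.
move=> a b c; apply/ffunP => U; rewrite !ffunE -big_split /=.
by apply: eq_bigr => S _; rewrite ffunE; ring.
Qed.

Lemma clone_neq0 : clone != 0.
Proof.
apply/eqP => /ffunP /(_ finset.set0); rewrite !ffunE eqxx.
by move/eqP; rewrite oner_eq0.
Qed.

HB.instance Definition _ := GRing.Zmodule_isNzRing.Build Cl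
  clmulA clmul1 cl1mul clmulDl clmulDr clone_neq0.

Lemma clscalerAl (k : R) a b : k *: (a * b) = (k *: a) * b.
Proof.
apply/ffunP => U; rewrite !ffunE scaler_sumr.
by apply: eq_bigr => S _; rewrite ffunE /GRing.scale /=; ring.
Qed.

HB.instance Definition _ := GRing.Lmodule_isLalgebra.Build R Cl clscalerAl.

Lemma clscalerAr (k : R) a b : k *: (a * b) = a * (k *: b).
Proof.
apply/ffunP => U; rewrite !ffunE scaler_sumr.
by apply: eq_bigr => S _; rewrite ffunE /GRing.scale /=; ring.
Qed.

HB.instance Definition _ := GRing.Lalgebra_isAlgebra.Build R Cl clscalerAr.

Definition clnorm a : R := Num.sqrt (\sum_S (a S) ^+ 2).

Lemma sumsq_ge0 a : 0 <= \sum_S (a S) ^+ 2.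
Proof. by apply: sumr_ge0 => S _; rewrite sqr_ge0. Qed.

Lemma cl_cauchy_schwarz a b : \sum_S a S * b S <= clnorm a * clnorm b.
Proof.
rewrite /clnorm -sqrtrM ?sumsq_ge0 //.
apply: le_trans (ler_norm _) _; rewrite -sqrtr_sqr; apply: ler_wsqrtr.
rewrite -subr_ge0.
have -> : (\sum_S a S ^+ 2) * (\sum_S b S ^+ 2) - (\sum_S a S * b S) ^+ 2 =
    2^-1 * \sum_S \sum_T (a S * b T - a T * b S) ^+ 2.
  have -> : \sum_S \sum_T (a S * b T - a T * b S) ^+ 2 =
      \sum_S \sum_T (a S ^+ 2 * b T ^+ 2) +
      \sum_S \sum_T (a T ^+ 2 * b S ^+ 2) -
      2 * \sum_S \sum_T ((a S * b S) * (a T * b T)).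
    rewrite mulr_sumr -big_split -sumrB /=; apply: eq_bigr => S _.
    rewrite mulr_sumr -big_split -sumrB /=; apply: eq_bigr => T _; ring.
  rewrite [X in _ + X - _]exchange_big /= expr2 !mulr_suml.
  under [X in X - _ = _]eq_bigr do rewrite mulr_sumr.
  under [X in _ - X = _]eq_bigr do rewrite mulr_sumr.
  by field.
by rewrite mulr_ge0 ?invr_ge0 // !sumr_ge0 // => S _; rewrite sumr_ge0 // => T _;
  rewrite sqr_ge0.
Qed.

Lemma ler_clnormD a b : clnorm (a + b) <= clnorm a + clnorm b.
Proof.
rewrite -(@ler_pXn2r _ 2%N) // ?nnegrE ?addr_ge0 ?sqrtr_ge0 //.
rewrite sqr_sqrtr ?sumsq_ge0 // sqrrD !sqr_sqrtr ?sumsq_ge0 //.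
have -> : \sum_S (a + b) S ^+ 2 =
    \sum_S a S ^+ 2 + (\sum_S a S * b S) *+ 2 + \sum_S b S ^+ 2.
  rewrite -sumrMnl -!big_split /=; apply: eq_bigr => S _.
  by rewrite ffunE sqrrD.
by rewrite lerD2r lerD2l lerMn2r cl_cauchy_schwarz.
Qed.

Lemma clnormZ (k : R) a : clnorm (k *: a) = `|k| * clnorm a.
Proof.
rewrite /clnorm -sqrtr_sqr -sqrtrM ?sqr_ge0 // mulr_sumr.
by congr (Num.sqrt _); apply: eq_bigr => S _; rewrite ffunE exprMn.
Qed.

Lemma clnorm0_eq0 a : clnorm a = 0 -> a = 0.
Proof.
move/eqP; rewrite sqrtr_eq0 => le0; apply/ffunP => S; rewrite ffunE.
have /eqP := le_anti (introT andP (conj le0 (sumsq_ge0 a))).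
rewrite psumr_eq0 => [/allP/(_ S)|T _]; last exact: sqr_ge0.
by rewrite mem_index_enum => /(_ isT); rewrite /= sqrf_eq0 => /eqP.
Qed.

HB.instance Definition _ := Lmodule_isNormed.Build R Cl
  ler_clnormD clnormZ clnorm0_eq0.

Definition clgen (j : 'I_m) : Cl := clbase [set j]%SET.

End CliffordAlgebra.

Section CliffordRelations.
Context {R : realType} {m : nat}.
Implicit Types (S T : {set 'I_m}).

Lemma clbaseM S T :
  clbase S * clbase T = clsign S T *: clbase (symdiff S T) :> clifford R m.
Proof.
apply/ffunP => U; rewrite !ffunE (bigD1 S) //= big1 => [|S' neqS'].
  rewrite !ffunE eqxx mul1r addr0 /GRing.scale /=.
  have -> : (symdiff S U == T) = (U == symdiff S T).
    by rewrite -(inj_eq (can_inj (symdiffK S))) symdiffK.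
  by case: eqP => [->|_]; rewrite ?symdiffK ?mulr0.
by rewrite ffunE (negbTE neqS') mul0r mulr0.
Qed.

Lemma clsign1 (i j : 'I_m) :
  clsign [set i]%SET [set j]%SET = (if (j <= i)%N then -1 else 1) :> R.
Proof.
rewrite /clsign big_set1; case: ifP => le_ji.
  rewrite (eq_bigl (pred1 j)) ?big_pred1_eq // => k.
  by rewrite !inE; case: eqP => [->|].
by rewrite big1 // => k; rewrite inE => /andP[/eqP ->]; rewrite le_ji.
Qed.

Lemma clgen_rel (i j : 'I_m) :
  clgen i * clgen j + clgen j * clgen i = - 2 * (i == j)%:R :> clifford R m.
Proof.
rewrite /clgen !clbaseM (symdiffC [set j]) -scalerDl !clsign1.
have [->|neq_ij] := eqVneq i j.
  rewrite leqnn symdiffss -[clbase finset.set0]/(1 : clifford R m) mulr1.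
  by rewrite -opprD scaleNr scalerDl !scale1r.
rewrite mulr0; case: ltngtP (neq_ij) => // [||/val_inj ->]; rewrite ?eqxx //.
all: by rewrite ?subrr ?addNr scale0r.
Qed.

Lemma clbase_prod S :
  clbase S = \prod_(j <- enum S) clgen j :> clifford R m.
Proof.
have sorted_enum : sorted (fun i j : 'I_m => (i < j)%N) (enum S).
  have lt_tr : transitive (fun i j : 'I_m => (i < j)%N).
    by move=> j i k; exact: ltn_trans.
  rewrite /enum_mem sorted_filter // -enumT.
  have := iota_ltn_sorted 0 m; rewrite -val_enum_ord sorted_map; exact.
have -> : S = [set:: enum S] by apply/setP => i; rewrite inE mem_enum.
have -> : enum [set:: enum S] = enum S.
  by apply: eq_enum => i; rewrite inE mem_enum.
elim: (enum S) sorted_enum => [|j s IHs] /= s_sorted.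
  by rewrite big_nil; congr clbase; apply/setP => i; rewrite !inE.
have j_lt k : k \in s -> (j < k)%N.
  move: s_sorted; rewrite path_sortedE; last first.
    by move=> b a c; exact: ltn_trans.
  by case/andP => /allP lt_js _ /lt_js.
rewrite big_cons -IHs ?(path_sorted s_sorted) // /clgen clbaseM.
have -> : clsign [set j]%SET [set:: s] = 1 :> R.
  rewrite /clsign big_set1 big1 // => k; rewrite inE => /andP[/j_lt].
  by rewrite ltnNge => /negbTE ->.
rewrite scale1r; congr clbase; apply/setP => k.
rewrite in_symdiff !inE; case: eqP => //= ->.
by case: (boolP (j \in s)) => // /j_lt; rewrite ltnn.
Qed.

Lemma clifford_expand (a : clifford R m) : a = \sum_S a S *: clbase S.
Proof.
apply/ffunP => T; rewrite sum_ffunE (bigD1 T) //= big1 => [|S neqST].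
  by rewrite !ffunE eqxx addr0 [RHS]mulr1.
by rewrite !ffunE eq_sym (negbTE neqST) [LHS]mulr0.
Qed.

End CliffordRelations.

Definition real_analytic_on (R : realType) (V : normedModType R)
    (U : set R) (g : R -> V) : Prop :=
  forall a, U a -> exists (c : nat -> V) (r : R), 0 < r /\
    forall t, `|t - a| < r ->
      series (fun n => (t - a) ^+ n *: c n) @ \oo --> g t.

Definition Gamma (R : realType) (s : R) : R :=
  Rintegral lebesgue_measure `]0, +oo[ (fun t => t `^ (s - 1) * expR (- t)).

(* The operator (z/2)^(-nu) J_nu(z) taken at z = r d/dt and applied to g, read
   as the power series
     \sum_k (-1)^k z^(2k) / (2^(2k) k! Gamma(nu + k + 1)),
   in which z^(2k) becomes r^(2k) d^(2k)/dt^(2k). *)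
Definition bessel_op_term (R : realType) (V : normedModType R)
    (nu r : R) (g : R -> V) (t : R) (k : nat) : V :=
  ((-1) ^+ k * r ^+ (2 * k) / (2 ^+ (2 * k) * k`!%:R * Gamma (nu + k%:R + 1)))
    *: derive1n (2 * k)%N g t.

Definition bessel_op (R : realType) (V : normedModType R)
    (nu r : R) (g : R -> V) (t : R) : V :=
  limn (series (bessel_op_term nu r g t)).

Section EuclideanSpace.
Context {R : realType} {m : nat}.
Local Notation Cl := (clifford R m).
Implicit Types (x : 'rV[R]_m.+1) (f : 'rV[R]_m.+1 -> Cl).

(* A point (x_0, x_1, ..., x_m) of R^{m+1} has real part x_0 and vector part
   (x_1, ..., x_m); the coordinate number j.+1 of the point goes with the
   generator clgen j. *)
Definition paravector (t : R) (u : 'rV[R]_m) : 'rV[R]_m.+1 :=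
  row_mx (t%:M : 'M[R]_1) u.

Definition repart x : R := x ord0 ord0.

Definition vecpart x : 'rV[R]_m := \row_j x ord0 (lift ord0 j).

Definition eucl_norm (u : 'rV[R]_m) : R := Num.sqrt (\sum_j u ord0 j ^+ 2).

Definition clvec (u : 'rV[R]_m) : Cl := \sum_j u ord0 j *: clgen j.

Definition axially_symmetric (Om : set 'rV[R]_m.+1) : Prop :=
  forall x (M : 'M[R]_m), Om x -> M *m M^T = 1%:M -> \det M = 1 ->
    Om (paravector (repart x) (vecpart x *m M^T)).

Definition partial (i : 'I_m.+1) f : 'rV[R]_m.+1 -> Cl := 'D_(delta_mx 0 i) f.

Definition C2_on (Om : set 'rV[R]_m.+1) f : Prop :=
  forall x, Om x -> forall i j : 'I_m.+1,
    [/\ derivable f x (delta_mx 0 i),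
        derivable (partial i f) x (delta_mx 0 j) &
        {for x, continuous (partial j (partial i f))}].

Definition laplacian f x : Cl := \sum_i partial i (partial i f) x.

Definition harmonic_on (Om : set 'rV[R]_m.+1) f : Prop :=
  C2_on Om f /\ forall x, Om x -> laplacian f x = 0.

Definition dirac_op f x : Cl := \sum_j clgen j * partial (lift ord0 j) f x.

(* The A_j live on Om1 only, so f is defined at x only if Om1 (repart x). *)
Definition axial_neighbourhood (Om1 : set R) (Om : set 'rV[R]_m.+1) : Prop :=
  [/\ open Om, axially_symmetric Om,
      forall t, Om1 t -> Om (paravector t 0) &
      forall x, Om x -> Om1 (repart x)].

Definition harmonic_sum (Om1 : set R) (A : nat -> R -> Cl)
    (Om : set 'rV[R]_m.+1) f : Prop :=
  [/\ axial_neighbourhood Om1 Om,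
      forall x, Om x ->
        series (fun j => clvec (vecpart x) ^+ j * A j (repart x)) @ \oo --> f x &
      harmonic_on Om f].

Definition harmonic_sequence (Om1 : set R) (A0 A1 : R -> Cl)
    (A : nat -> R -> Cl) : Prop :=
  [/\ forall t, Om1 t -> A 0%N t = A0 t,
      forall t, Om1 t -> A 1%N t = A1 t,
      forall j, real_analytic_on Om1 (A j) &
      exists Om f, harmonic_sum Om1 A Om f].

Lemma repart_paravector t (u : 'rV[R]_m) : repart (paravector t u) = t.
Proof.
transitivity ((t%:M : 'M[R]_1) ord0 ord0); last by rewrite mxE eqxx mulr1n.
by rewrite -(row_mxEl _ u) /repart /paravector;
  congr (row_mx _ _ _ _); exact: val_inj.
Qed.

Lemma vecpart_paravector t (u : 'rV[R]_m) : vecpart (paravector t u) = u.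
Proof.
apply/rowP => j; rewrite mxE -(row_mxEr (t%:M : 'M[R]_1) u) /paravector.
by congr (row_mx _ _ _ _); exact: val_inj.
Qed.

Lemma clvec_sqr (u : 'rV[R]_m) : clvec u ^+ 2 = (- eucl_norm u ^+ 2)%:A.
Proof.
rewrite /eucl_norm sqr_sqrtr; last by apply: sumr_ge0 => j _; exact: sqr_ge0.
rewrite expr2 /clvec mulr_suml.
under eq_bigr do rewrite mulr_sumr.
set s := (X in X = _).
suff : s + s = (- \sum_j u ord0 j ^+ 2)%:A *+ 2.
  move=> ss; have n2 : (2 : R) != 0 by rewrite pnatr_eq0.
  by apply: (scalerI n2); rewrite !scaler_nat mulr2n.
rewrite {2}/s exchange_big /= -big_split /=.
under eq_bigr do rewrite -big_split /=.
transitivity (\sum_(j < m) (- (2 * u ord0 j ^+ 2))%:A : Cl).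
  apply: eq_bigr => j _; rewrite (bigD1 j) //= big1 => [|k neq_kj]; last first.
    rewrite -!scalerAl -!scalerAr !scalerA [u _ k * _]mulrC -scalerDr clgen_rel.
    by rewrite eq_sym (negbTE neq_kj) mulr0 scaler0.
  rewrite -!scalerAl -!scalerAr !scalerA -scalerDr clgen_rel eqxx mulr1 addr0.
  have -> : (- 2 : Cl) = (- 2)%:A by rewrite scaleNr scaler_nat.
  by rewrite scalerA; congr (_ *: _); rewrite /GRing.scale /=; ring.
rewrite -scaler_suml -scaler_nat scalerA; congr (_ *: _).
by rewrite sumrN -mulr_sumr mulrN.
Qed.

End EuclideanSpace.

(* Main.v *)
Require Import Defs.
From HB Require Import structures.
From mathcomp Require Import all_boot all_order all_algebra.
From mathcomp Require Import all_classical all_reals all_analysis.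
From mathcomp Require Import measurable_realfun zify ring lra.

Set Implicit Arguments.
Unset Strict Implicit.
Unset Printing Implicit Defensive.

Import Order.TTheory GRing.Theory Num.Theory.
Import numFieldNormedType.Exports.

Local Open Scope classical_set_scope.
Local Open Scope ring_scope.

(* As x^2 = - |x|^2 for a vector x, the even and odd parts of
   f = sum_j x^j A_j(x_0) are E(|x|^2, x_0) and x O(|x|^2, x_0) with E and O
   power series in their first variable. The Laplacian in x multiplies
   |x|^(2k+2) by 2(k+1)(m+2k) and x |x|^(2k+2) by 2(k+1)(m+2+2k) while lowering
   k by one, so f is harmonic when A_j'' = kappa_j A_(j+2) with these factors
   kappa_j; the resulting products of factors are
   2^(2k) k! Gamma(p/2+k) / Gamma(p/2) for p = m and p = m+2, which gives the
   Bessel form. Analyticity bounds the n-th derivative of A_0 and A_1 locally by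
   M n! K^n, hence all termwise derivatives of the series converge geometrically.

   Conversely, harmonicity of f only says that for each fixed |x| the sums E and
   O are twice differentiable in x_0, with second derivatives - L E and - L' O.
   Comparing coefficients requires bounds on the A_j which are uniform in x_0;
   pointwise convergence provides them on a dense open set, by Baire's theorem,
   and the recursion extends to all x_0 by continuity. *)

(** * Series of functions and power series *)

(** Uniqueness is the hard half. A competing sum f is C^2 on an open set of R^{m+1}, but its series
    converges only pointwise, so it cannot be differentiated termwise in x_0. The vector directions
    are harmless, since a power series in |x|^2 may be differentiated inside its disc; harmonicity
    then gives the x_0-derivatives of E and O as whole functions, separately for each |x|.
    Coefficients are extracted as |x| tends to 0, where E and O converge to their constant terms. As
    this says nothing about first derivatives, second derivatives are compared through symmetric
    second differences. Subtracting the constant term and dividing by |x|^2 reproduces an equation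
    of the same kind, which allows induction. Clifford values are treated by coordinates: a
    coordinate of x O is a signed sum of products of some x_j with a real radial series, and for
    such a product the radial Laplacian is that of dimension m + 2. Gamma is given by a Lebesgue
    integral, so its positivity and functional equation are derived from the integrand. *)

Section SeriesOfFunctions.
Variable R : realType.
Implicit Types (u M : nat -> R).

Lemma dominated_series_cvg u M :
  (forall n, `|u n| <= M n) -> cvgn (series M) -> cvgn (series u).
Proof.
move=> uM cM; apply: normed_cvg.
apply: series_le_cvg cM => [n|n|n]; [exact: normr_ge0| |exact: uM].
by apply: le_trans (uM n).
Qed.

Lemma dominated_series_tail u M N :
  (forall n, `|u n| <= M n) -> cvgn (series M) ->
  `|limn (series u) - series u N| <= limn (series M) - series M N.
Proof.
move=> uM cM; have cu := dominated_series_cvg uM cM.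
have uN : (fun n => `|series u n - series u N|) @ \oo -->
    `|limn (series u) - series u N|.
  by apply: cvg_norm; apply: cvgB => //; exact: cvg_cst.
have MN : (fun n => series M n - series M N) @ \oo -->
    limn (series M) - series M N.
  by apply: cvgB => //; exact: cvg_cst.
apply: (ler_cvg_to uN MN); near=> n.
have Nn : (N <= n)%N by near: n; exact: nbhs_infty_ge.
rewrite !sub_series_geq //; apply: le_trans (ler_norm_sum _ _ _) _.
by apply: ler_sum => i _; exact: uM.
Unshelve. all: by end_near. Qed.

(** Weierstrass test by an e/3 argument: the domination by [M] makes the tails small uniformly near
    [x]. *)
Lemma series_continuous (T : topologicalType) (F : nat -> T -> R) M (x : T) :
  (\forall y \near x, forall n, `|F n y| <= M n) -> cvgn (series M) ->
  (forall n, {for x, continuous (F n)}) ->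
  {for x, continuous (fun y => limn (series (F^~ y)))}.
Proof.
move=> FM cM cF; apply/cvgrPdist_lt => /= e e0.
have [N MN] : exists N, limn (series M) - series M N < e / 3.
  have /cvgrPdist_lt /(_ (e / 3)) : series M @ \oo --> limn (series M) by [].
  rewrite divr_gt0 // => /(_ isT) [N _ /(_ N (leqnn N)) /= h].
  by exists N; apply: le_lt_trans h; exact: ler_norm.
have FMx : forall n, `|F n x| <= M n by exact: (nbhs_singleton FM).
have cS : {for x, continuous (fun y => series (F^~ y) N)}.
  have -> : (fun y => series (F^~ y) N) = \sum_(0 <= i < N) F i.
    by apply/funext => y; rewrite /series /= fct_sumE.
  by apply: (big_ind (fun f => {for x, continuous f})) => [|f g|i _];
    [exact: cvg_cst|exact: continuousD|exact: cF].
have /cvgrPdist_lt /(_ (e / 3)) := cS; rewrite divr_gt0 // => /(_ isT) S3.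
near=> y.
have FMy : forall n, `|F n y| <= M n by near: y.
have S3y : `|series (F^~ x) N - series (F^~ y) N| < e / 3 by near: y.
have tx := le_lt_trans (dominated_series_tail N FMx cM) MN.
have ty := le_lt_trans (dominated_series_tail N FMy cM) MN.
rewrite distrC in ty.
have -> : limn (series (F^~ x)) - limn (series (F^~ y)) =
  (limn (series (F^~ x)) - series (F^~ x) N) +
  (series (F^~ x) N - series (F^~ y) N) +
  (series (F^~ y) N - limn (series (F^~ y))) by ring.
apply: le_lt_trans (ler_normD _ _) _.
have := ler_normD (limn (series (F^~ x)) - series (F^~ x) N)
  (series (F^~ x) N - series (F^~ y) N); lra.
Unshelve. all: by end_near. Qed.

Lemma mvt_lipschitz (f df : R -> R) (a b : R) (B : R) :
  (forall z, `|z - a| <= `|b - a| -> is_derive z 1 f (df z)) ->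
  (forall z, `|z - a| <= `|b - a| -> `|df z| <= B) ->
  `|f b - f a| <= B * `|b - a|.
Proof.
move=> fd dfB.
have key x y : x <= y -> (forall z, z \in `[x, y] -> `|z - a| <= `|b - a|) ->
    `|f y - f x| <= B * `|y - x|.
  move=> xy inab.
  have fd' z : z \in `]x, y[ -> is_derive z 1 f (df z).
    by move=> zxy; apply/fd/inab; exact: subset_itv_oo_cc zxy.
  have cf : {within `[x, y], continuous f}.
    by apply: derivable_within_continuous => z /inab /fd.
  have [c cxy ->] := MVT_segment xy fd' cf.
  by rewrite normrM ler_wpM2r // dfB // inab.
have [ab|ba] := leP a b.
  apply: key => // z; rewrite in_itv /= => /andP[az zb].
  by rewrite !ger0_norm ?subr_ge0 // lerD2r.
rewrite distrC [X in B * X]distrC; apply: key => [|z]; first exact: ltW.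
rewrite in_itv /= => /andP[bz za].
by rewrite distrC (distrC b) !ger0_norm ?subr_ge0 ?(ltW ba) // lerD2l lerN2.
Qed.

(* The difference quotients of the terms extend continuously to [a] and are
   bounded by [M], so their series is continuous at [a]. *)
Lemma is_derive_series (F dF : nat -> R -> R) M (a r : R) :
  0 < r ->
  (forall n t, `|t - a| < r -> is_derive t 1 (F n) (dF n t)) ->
  (forall n t, `|t - a| < r -> `|dF n t| <= M n) -> cvgn (series M) ->
  cvgn (series (F^~ a)) ->
  is_derive a 1 (fun t => limn (series (F^~ t))) (limn (series (dF^~ a))).
Proof.
move=> r0 dFF dFM cM cFa.
have aa : `|a - a| < r by rewrite subrr normr0.
have quot n : exists g, [/\ forall z, F n z - F n a = g z * (z - a),
    {for a, continuous g} & g a = dF n a].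
  by apply/is_derive1_caratheodory; exact: dFF.
have [g gP] := choice quot.
have gM t : `|t - a| < r -> forall n, `|g n t| <= M n.
  move=> ta n; have [gE _ ga] := gP n.
  have [->|neq_ta] := eqVneq t a; first by rewrite ga dFM.
  have lip : `|F n t - F n a| <= M n * `|t - a|.
    by apply: (mvt_lipschitz (df := dF n)) => z zt;
      [apply: dFF|apply: dFM]; exact: le_lt_trans zt ta.
  by move: lip; rewrite gE normrM ler_pM2r // normr_gt0 subr_eq0.
have cF t : `|t - a| < r -> series (F^~ t) @ \oo -->
    limn (series (F^~ a)) + limn (series (g^~ t)) * (t - a).
  move=> ta.
  have -> : series (F^~ t) = fun n => series (F^~ a) n + series (g^~ t) n * (t - a).
    apply/funext => n; rewrite /series /= mulr_suml -big_split /=.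
    apply: eq_bigr => i _; have [gE _ _] := gP i.
    by rewrite -gE addrC subrK.
  apply: cvgD => //; apply: cvgMl.
  exact: dominated_series_cvg (gM t ta) cM.
(* Caratheodory's criterion asks for the factorisation at every point; away from the ball, where
   nothing is known about the series, the plain difference quotient supplies it. *)
pose h t := if `|t - a| < r then limn (series (g^~ t))
  else (limn (series (F^~ t)) - limn (series (F^~ a))) / (t - a).
apply/is_derive1_caratheodory; exists h; split.
- move=> z; rewrite /h; case: ifP => [za|za].
    by rewrite (cvg_lim _ (cF z za)) // addrC addKr.
  rewrite divfK // subr_eq0; apply/eqP => zE.
  by rewrite zE subrr normr0 r0 in za.
- have nr : \forall t \near a, `|t - a| < r.
    by near=> t; rewrite distrC; near: t; exact: nbhsx_ballx.
  have ch : {for a, continuous (fun t => limn (series (g^~ t)))}.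
    apply: (series_continuous (M := M)) => //; last by move=> n; have [] := gP n.
    by apply: filterS nr => t /gM.
  rewrite /prop_for /continuous_at /h aa; apply: cvg_trans ch.
  by apply: near_eq_cvg; apply: filterS nr => t ->.
- rewrite /h aa; congr (limn (series _)); apply/funext => n.
  by have [] := gP n.
Unshelve. all: by end_near. Qed.

End SeriesOfFunctions.

(** * Power series with geometrically bounded coefficients *)

Definition psum (R : realType) (c : nat -> R) (s : R) : R := limn (pseries c s).

(** A quantitative substitute for a radius of convergence of at least [q]: it yields a geometric
    majorant for |s| < q, and the constant [M] can be required uniformly in a parameter. *)
Definition coef_bounded (R : realType) (c : nat -> R) (q M : R) : Prop :=
  forall k, `|c k| * q ^+ k <= M.

Section PowerSeries.
Variable R : realType.
Implicit Types (c : nat -> R) (q s M : R).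

Lemma coef_bounded_ge0 c q M : coef_bounded c q M -> 0 <= M.
Proof. by move=> /(_ 0%N); rewrite expr0 mulr1; exact: le_trans. Qed.

Lemma coef_bounded_radius_le c p q M :
  0 <= p -> p <= q -> coef_bounded c q M -> coef_bounded c p M.
Proof.
move=> p0 pq cM k; apply: le_trans (cM k).
by rewrite ler_wpM2l // lerXn2r ?nnegrE // (le_trans p0).
Qed.

Lemma pseries_term_le c q s M n : 0 < q -> coef_bounded c q M ->
  `|c n * s ^+ n| <= geometric M (`|s| / q) n.
Proof.
move=> q0 cM; rewrite /geometric /= normrM normrX expr_div_n mulrA mulrAC.
by rewrite ler_wpM2r // ?exprn_ge0 // ler_pdivlMr ?exprn_gt0.
Qed.

Lemma geometric_ratio_lt1 q s : `|s| < q -> `|(`|s| / q)%R| < 1.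
Proof.
move=> sq; have q0 : 0 < q := le_lt_trans (normr_ge0 _) sq.
by rewrite ger0_norm ?divr_ge0 // ?ltW // ltr_pdivrMr // mul1r.
Qed.

Lemma is_cvg_pseries c q s M : coef_bounded c q M -> `|s| < q ->
  cvgn (pseries c s).
Proof.
move=> cM sq; have q0 : 0 < q := le_lt_trans (normr_ge0 _) sq.
apply: (dominated_series_cvg (fun n => pseries_term_le s n q0 cM)).
exact/is_cvg_geometric_series/geometric_ratio_lt1.
Qed.

Lemma psum_split c q s M : coef_bounded c q M -> `|s| < q ->
  psum c s = c 0%N + s * psum (fun k => c k.+1) s.
Proof.
move=> cM sq; have q0 : 0 < q := le_lt_trans (normr_ge0 _) sq.
have cS : coef_bounded (fun k => c k.+1) q (M / q).
  by move=> k; rewrite ler_pdivlMr // -mulrA -exprSr; exact: cM.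
have cvS := is_cvg_pseries cS sq.
apply/cvg_lim => //; rewrite -cvg_shiftS /=.
have -> : (fun n => pseries c s n.+1) =
    fun n => c 0%N + s * pseries (fun k => c k.+1) s n.
  apply/funext => n; rewrite /pseries /series /= big_nat_recl // expr0 mulr1.
  by rewrite mulr_sumr; congr (_ + _); apply: eq_bigr => i _; rewrite exprS; ring.
by apply: cvgD; [exact: cvg_cst|exact: cvgMr].
Qed.

(** With x = |s|/q at most 1/2, the geometric tail M x / (1 - x) is at most 2 M x. *)
Lemma psum_near0 c q s M : coef_bounded c q M -> 0 < q -> `|s| <= q / 2 ->
  `|psum c s - c 0%N| <= 2 * M / q * `|s|.
Proof.
move=> cM q0 sq; set x := `|s| / q.
have x0 : 0 <= x by rewrite divr_ge0 // ltW.
have xh : x <= 2^-1 by rewrite ler_pdivrMr // mulrC.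
have x1 : `|x| < 1 by rewrite ger0_norm //; lra.
have M0 := coef_bounded_ge0 cM.
have tail := dominated_series_tail 1 (fun n => pseries_term_le s n q0 cM)
  (is_cvg_geometric_series x1).
have limE : limn (series (geometric M x)) = M / (1 - x).
  by apply/cvg_lim => //; exact: cvg_geometric_series.
move: tail; rewrite -/x limE /series /= !big_nat1 !expr0 !mulr1 => /le_trans; apply.
have -> : M / (1 - x) - M = M * x / (1 - x) by field; lra.
rewrite ler_pdivrMr ?subr_gt0; last lra.
have -> : 2 * M / q * `|s| = 2 * M * x by rewrite /x; ring.
have Mx := mulr_ge0 M0 x0; nra.
Qed.

(** Each of the k + 1 terms of the geometric sum up to x^k is at least x^k. *)
Lemma natr_expr_bounded (x : R) k : 0 <= x < 1 -> k.+1%:R * x ^+ k <= (1 - x)^-1.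
Proof.
move=> /andP[x0 x1]; have x1' : x != 1 by rewrite lt_eqF.
apply: (@le_trans _ _ (series (geometric 1 x) k.+1)); last first.
  rewrite geometric_seriesE // /= mul1r -[leRHS]mul1r ler_wpM2r //.
    by rewrite invr_ge0 subr_ge0 ltW.
  by rewrite gerBl exprn_ge0.
rewrite /series /= mulr_natl -[X in _ *+ X](card_ord k.+1) -sumr_const big_mkord.
apply: ler_sum => i _; rewrite mul1r ler_wiXn2l //; [exact: ltW|].
by rewrite -ltnS.
Qed.

(** The factor k + 1 produced by differentiation is absorbed by (p/q)^k, at the price of a strictly
    smaller radius. *)
Lemma coef_bounded_diffs c p q M : 0 < p < q -> coef_bounded c q M ->
  coef_bounded (pseries_diffs c) p (M / q / (1 - p / q)).
Proof.
move=> /andP[p0 pq] cM k; have q0 : 0 < q := lt_trans p0 pq.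
have x01 : 0 <= p / q < 1.
  by rewrite divr_ge0 ?ltW //= ltr_pdivrMr // mul1r.
have := natr_expr_bounded k x01; rewrite /pseries_diffs normrM normr_nat => h.
apply: (@le_trans _ _ (M / q * (k.+1%:R * (p / q) ^+ k))); last first.
  by rewrite ler_wpM2l // divr_ge0 ?(coef_bounded_ge0 cM) ?ltW.
rewrite expr_div_n.
have -> : M / q * (k.+1%:R * (p ^+ k / q ^+ k)) =
    (k.+1%:R * p ^+ k) * (M / q ^+ k.+1).
  by rewrite exprSr; field; rewrite ?expf_neq0 gt_eqF.
rewrite mulrAC ler_wpM2l ?mulr_ge0 ?exprn_ge0 ?(ltW p0) //.
by rewrite ler_pdivlMr ?exprn_gt0.
Qed.

Lemma psum_is_derive c q s M : coef_bounded c q M -> `|s| < q ->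
  is_derive s 1 (psum c) (psum (pseries_diffs c) s).
Proof.
move=> cM sq.
(* [pseries_snd_diffs] wants the series and its first two formal derivatives to converge at one
   point beyond |s|. Each differentiation shrinks the radius, from q to [p 3] to [p 2], and the
   common point is [p 1]. *)
pose p i := `|s| + (q - `|s|) * (i%:R / 4).
have q0 : 0 < q := le_lt_trans (normr_ge0 _) sq.
have s0 := normr_ge0 s.
have p1 : p 1%N = `|s| + (q - `|s|) / 4 by rewrite /p; ring.
have p2 : p 2%N = `|s| + (q - `|s|) / 2 by rewrite /p; field.
have p3 : p 3%N = `|s| + (q - `|s|) * 3 / 4 by rewrite /p; field.
have p3q : 0 < p 3%N < q by rewrite p3; apply/andP; split; lra.
have p23 : 0 < p 2%N < p 3%N by rewrite p2 p3; apply/andP; split; lra.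
have d1 := coef_bounded_diffs p3q cM.
have d2 := coef_bounded_diffs p23 d1.
have np : `|p 1%N| = p 1%N by rewrite ger0_norm // p1; lra.
apply: (@pseries_snd_diffs R c (p 1%N)).
- by apply: (is_cvg_pseries cM); rewrite np p1; lra.
- by apply: (is_cvg_pseries d1); rewrite np p1 p3; lra.
- by apply: (is_cvg_pseries d2); rewrite np p1 p2; lra.
- by rewrite np p1; lra.
Qed.

(** Coefficients and argument move together; a radius p strictly between |f x| and q gives one
    geometric majorant near [x]. *)
Lemma psum_continuous (T : topologicalType) (C : T -> nat -> R) (f : T -> R) q M
    (x : T) :
  (\forall y \near x, coef_bounded (C y) q M) ->
  (forall k, {for x, continuous (C^~ k)}) ->
  {for x, continuous f} -> `|f x| < q ->
  {for x, continuous (fun y => psum (C y) (f y))}.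
Proof.
move=> CM cC cf fq; pose p := (`|f x| + q) / 2.
have fp : `|f x| < p by rewrite /p; lra.
have pq : p < q by rewrite /p; lra.
have p0 : 0 < p := le_lt_trans (normr_ge0 _) fp.
have q0 := lt_trans p0 pq.
have fpn : \forall y \near x, `|f y| < p.
  have : (fun y => `|f y|) @ x --> `|f x| by exact: cvg_norm.
  by move=> /cvgr_lt; apply.
apply: (series_continuous (M := geometric M (p / q))).
- near=> y => n; have fyp : `|f y| < p by near: y.
  have CyM : coef_bounded (C y) q M by near: y.
  apply: le_trans (pseries_term_le (f y) n q0 CyM) _.
  rewrite /geometric /= ler_wpM2l ?(coef_bounded_ge0 CyM) //.
  apply: lerXn2r; rewrite ?nnegrE; try by rewrite divr_ge0 // ltW.
  by rewrite ler_wpM2r ?invr_ge0 // ltW.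
- apply: is_cvg_geometric_series.
  by rewrite -[p](ger0_norm (ltW p0)); apply: geometric_ratio_lt1; rewrite ger0_norm ?ltW.
- move=> n; apply: continuousM; first exact: cC.
  exact: continuous_comp cf (@exprn_continuous _ n _).
Unshelve. all: by end_near. Qed.

(** Differentiation under the sum in a parameter of the coefficients. Uniform bounds concern the
    differentiated coefficients; for [C] itself a bound at [a] gives the convergence there. *)
Lemma psum_is_derive_coef (C dC : R -> nat -> R) q s r M M0 (a : R) :
  0 < r ->
  (forall k t, `|t - a| < r -> is_derive t 1 (C^~ k) (dC t k)) ->
  (forall t, `|t - a| < r -> coef_bounded (dC t) q M) ->
  coef_bounded (C a) q M0 -> `|s| < q ->
  is_derive a 1 (fun t => psum (C t) s) (psum (dC a) s).
Proof.
move=> r0 dCC dCM CM sq; have q0 : 0 < q := le_lt_trans (normr_ge0 _) sq.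
apply: (@is_derive_series R (fun n t => C t n * s ^+ n)
  (fun n t => dC t n * s ^+ n) (geometric M (`|s| / q)) a r r0).
- move=> n t ta; have := dCC n t ta => dCt.
  have := @is_deriveZ _ _ _ (C^~ n) (s ^+ n) t 1 (dC t n) dCt.
  have -> : s ^+ n \*: C^~ n = fun y => C y n * s ^+ n.
    by apply/funext => y; rewrite /= [LHS]mulrC.
  by move/is_derive_eq; apply; rewrite [LHS]mulrC.
- by move=> n t ta; exact/pseries_term_le/dCM.
- exact/is_cvg_geometric_series/geometric_ratio_lt1.
- exact: is_cvg_pseries CM sq.
Qed.

End PowerSeries.

(** * Analytic functions of one variable *)

Section AnalyticFunctions.
Variable R : realType.
Implicit Types (c : nat -> R) (g : R -> R).

Lemma psum_norm_le c q s M : coef_bounded c q M -> 0 < q -> `|s| <= q / 2 ->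
  `|psum c s| <= 2 * M.
Proof.
move=> cM q0 sq; have c0M : `|c 0%N| <= M by have := cM 0%N; rewrite expr0 mulr1.
have h : 2 * M / q * `|s| <= M.
  apply: le_trans (ler_wpM2l _ sq) _.
    by rewrite divr_ge0 ?mulr_ge0 ?(coef_bounded_ge0 cM) // ltW.
  by rewrite le_eqVlt; apply/orP; left; apply/eqP; field; rewrite gt_eqF.
have := psum_near0 cM q0 sq; have := ler_normD (psum c s - c 0%N) (c 0%N).
rewrite subrK; lra.
Qed.

Lemma iter_pseries_diffs c n k :
  iter n (@pseries_diffs R) c k = ((n + k) ^_ n)%:R * c (n + k)%N.
Proof.
elim: n k => [|n IHn] k; first by rewrite ffactn0 mul1r.
rewrite iterS /pseries_diffs IHn mulrA -natrM addnS addSn; congr (_%:R * _).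
by rewrite ffactnSr mulnC; congr (_ * _)%N; rewrite subSn ?leq_addr // addKn.
Qed.

(** The binomial coefficient is one of the terms of (1 + 1)^(n+k). *)
Lemma ffact_le_exp2 n k : ((n + k) ^_ n <= 2 ^ (n + k) * n`!)%N.
Proof.
rewrite -bin_ffact leq_mul2r; apply/orP; right.
rewrite -[2%N]/(1 + 1)%N expnDn (bigD1 (inord n)) //= inordK ?ltnS ?leq_addr //.
by rewrite !exp1n !muln1 leq_addr.
Qed.

(** All orders share the radius q/2, whereas iterating [coef_bounded_diffs] would shrink it each
    time. Of the factor 2^(n+k), the part 2^k is absorbed by halving the radius and 2^n goes into
    the constant. *)
Lemma coef_bounded_iter_diffs c q M n : 0 < q -> coef_bounded c q M ->
  coef_bounded (iter n (@pseries_diffs R) c) (q / 2) (M * n`!%:R * (2 / q) ^+ n).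
Proof.
move=> q0 cM k; rewrite iter_pseries_diffs normrM normr_nat.
have ck : `|c (n + k)%N| <= M / q ^+ (n + k) by rewrite ler_pdivlMr ?exprn_gt0.
apply: (@le_trans _ _ ((2 ^+ (n + k) * n`!%:R) * (M / q ^+ (n + k)) * (q / 2) ^+ k)).
  rewrite ler_wpM2r ?exprn_ge0 ?divr_ge0 ?(ltW q0) // ler_pM //.
  by rewrite -natrX -natrM ler_nat ffact_le_exp2.
rewrite le_eqVlt; apply/orP; left; apply/eqP.
by rewrite !exprD !expr_div_n; field; rewrite !expf_neq0 // gt_eqF.
Qed.

Lemma cvg_pseries_coef_bounded c r :
  0 <= r -> cvgn (pseries c r) -> exists M, coef_bounded c r M.
Proof.
move=> r0 /cvg_series_bounded [M [_ hM]]; exists (M + 1) => k.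
have := hM (M + 1) (ltr_pwDr ltr01 (lexx _)) k I.
by rewrite /= normrM normrX (ger0_norm r0).
Qed.

Lemma near_dist_lt (a t q : R) : `|t - a| < q -> \forall z \near t, `|z - a| < q.
Proof.
move=> ta; have : (fun z => `|z - a|) @ t --> `|t - a|.
  by apply: cvg_norm; apply: cvgB; [exact: cvg_id|exact: cvg_cst].
by move=> /cvgr_lt; apply.
Qed.

(** Cauchy estimates by real means: one radius [q] and one constant [M] serve the Taylor series of
    all derivatives. *)
Lemma analytic_jet g c a r : 0 < r ->
  (forall t, `|t - a| < r -> pseries c (t - a) @ \oo --> g t) ->
  exists q M, [/\ 0 < q, 0 <= M & forall n,
    coef_bounded (iter n (@pseries_diffs R) c) q (M * n`!%:R * q^-1 ^+ n) /\
    forall t, `|t - a| < q ->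
      derive1n n g t = psum (iter n (@pseries_diffs R) c) (t - a) /\
      is_derive t 1 (derive1n n g) (derive1n n.+1 g t)].
Proof.
move=> r0 cg.
have [M cM] : exists M, coef_bounded c (r / 2) M.
  apply: cvg_pseries_coef_bounded; first by rewrite divr_ge0 // ltW.
  apply/cvg_ex; exists (g (a + r / 2)).
  have := cg (a + r / 2); rewrite (addrC a) addrK; apply.
  by rewrite ger0_norm ?divr_ge0 ?ltW //; lra.
have q0 : 0 < r / 2 by rewrite divr_gt0.
(* The first halving reaches a point of convergence inside the ball, the second is that of
   [coef_bounded_iter_diffs]. *)
exists (r / 2 / 2), M; split; [by rewrite divr_gt0|exact: coef_bounded_ge0 cM|].
move=> n.
have cB k := coef_bounded_iter_diffs k q0 cM.
have -> : (r / 2 / 2)^-1 = 2 / (r / 2) by field; rewrite gt_eqF.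
split; first exact: cB.
have dpsum k t : `|t - a| < r / 2 / 2 ->
    is_derive t 1 (fun t => psum (iter k (@pseries_diffs R) c) (t - a))
      (psum (iter k.+1 (@pseries_diffs R) c) (t - a)).
  move=> ta; have d := psum_is_derive (cB k) ta.
  have := @is_derive1_comp R _ (shift (- a)) t _ 1 d (is_derive_shift _ _ _).
  by rewrite mulr1.
have gE k t : `|t - a| < r / 2 / 2 ->
    derive1n k g t = psum (iter k (@pseries_diffs R) c) (t - a).
  elim: k t => [|k IHk] t ta.
    by apply/esym/cvg_lim => //; apply: cg; lra.
  rewrite derive1nS derive1E (near_eq_derive _ (filterS IHk (near_dist_lt ta))).
  by have := dpsum k t ta => d; rewrite derive_val.
move=> t ta; split; first exact: gE.
rewrite gE //; apply: near_eq_is_derive (dpsum n t ta).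
by apply: filterS (near_dist_lt ta) => z za; rewrite gE.
Qed.

End AnalyticFunctions.

(** * The Gamma function *)

Section GammaFunction.
Variable R : realType.
Notation mu := (@lebesgue_measure R).
Implicit Types (f F : R -> R) (a b l s t x : R).

(* [f] may be unbounded at 0, as the Gamma integrand is for exponents below 1. *)
Lemma ge0_FTC2_oc f F b l : 0 < b ->
  (forall x, 0 < x <= b -> 0 <= f x) ->
  (forall x, 0 < x -> {for x, continuous f}) ->
  (forall x, 0 < x -> is_derive x 1 F (f x)) ->
  F @ 0^'+ --> l ->
  (\int[mu]_(x in `]0%R, b]) (f x)%:E = (F b - l)%:E)%E.
Proof.
move=> b0 f0 cf dF Fl.
(* Closed intervals exhausting the half-open one, so that monotone convergence applies; [n.+2] keeps
   the left end strictly below [b] already for n = 0. *)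
pose D n := `[b / n.+2%:R, b]%classic : set R.
have an0 n : 0 < b / n.+2%:R by rewrite divr_gt0.
have ab n : b / n.+2%:R < b by rewrite ltr_pdivrMr // ltr_pMr // ltr1n.
have UD : `]0, b]%classic = \bigcup_n D n.
  apply/seteqP; split => x /=.
    rewrite in_itv /= => /andP[x0 xb].
    exists (Num.truncn (b / x)) => //=; rewrite /D /= in_itv /= xb andbT.
    rewrite ler_pdivrMr // mulrC -ler_pdivrMr //.
    apply: le_trans (ltW (truncnS_gt _)) _; rewrite ler_nat.
    exact: leqnSn.
  move=> [n _]; rewrite /D /= !in_itv /= => /andP[nx ->].
  by rewrite (lt_le_trans (an0 n) nx).
have mf : measurable_fun (`]0, +oo[%classic : set R) f.
  apply: open_continuous_measurable_fun; first exact: interval_open.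
  by move=> x; rewrite inE /= in_itv /= andbT => /cf.
have subD x : (`]0, b]%classic : set R) x -> (`]0, +oo[%classic : set R) x.
  by rewrite /= !in_itv /= => /andP[->].
have DI n : (\int[mu]_(x in D n) (f x)%:E = (F b - F (b / n.+2%:R))%:E)%E.
  rewrite EFinB; apply: continuous_FTC2 => //.
  - apply: continuous_in_subspaceT => x.
    rewrite inE /= in_itv /= => /andP[nx _]; exact/cf/(lt_le_trans (an0 n) nx).
  - split => [x||].
    + by rewrite in_itv /= => /andP[nx _]; have := dF _ (lt_trans (an0 n) nx).
    + have := dF _ (an0 n) => d; apply: cvg_at_right_filter.
      by apply: differentiable_continuous; exact/derivable1_diffP.
    + have := dF _ b0 => d; apply: cvg_at_left_filter.
      by apply: differentiable_continuous; exact/derivable1_diffP.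
  - move=> x; rewrite in_itv /= => /andP[nx _].
    by have := dF _ (lt_trans (an0 n) nx) => d; rewrite derive1E derive_val.
have c1 : (fun n => \int[mu]_(x in D n) (f x)%:E)%E @ \oo -->
    (\int[mu]_(x in `]0%R, b]) (f x)%:E)%E.
  rewrite UD; apply: ge0_nondecreasing_set_cvg_integral.
  - move=> m n mn; rewrite /D; apply/subsetPset => x /=.
    rewrite !in_itv /= => /andP[mx ->]; rewrite andbT; apply: le_trans mx.
    by rewrite ler_pM2l // lef_pV2 ?posrE // ler_nat !ltnS.
  - by move=> n; exact: measurable_itv.
  - move=> n; apply/measurable_EFinP; apply: measurable_funS mf => // x Dx.
    by apply: subD; rewrite UD; exists n.
  - move=> n x Dx; rewrite lee_fin; apply: f0.
    have : (`]0, b]%classic : set R) x by rewrite UD; exists n.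
    by rewrite /= in_itv.
have c2 : (fun n => \int[mu]_(x in D n) (f x)%:E)%E @ \oo --> (F b - l)%:E.
  under eq_fun do rewrite DI.
  apply: cvg_EFin; first exact: nearW.
  apply: cvgB; first exact: cvg_cst.
  apply: (proj1 (cvg_at_rightP F 0 l) Fl); split => [n|]; first exact: an0.
  rewrite -[0](mulr0 b); apply: cvgMr.
  exact: (cvg_comp _ _ (@cvg_addnl 1%N) cvg_harmonic).
by rewrite -(cvg_lim _ c1) // (cvg_lim _ c2).
Qed.

(** Half of the exponential absorbs the power: for t >= b, t^a is at most a constant times t^(n+1)
    with n + 1 > |a|, and (t/2)^(n+1) / (n+1)! is at most e^(t/2). *)
Lemma powR_expR_le a b : 0 < b -> exists2 C, 0 <= C &
  forall t, b <= t -> t `^ a * expR (- t) <= C * expR (- (t / 2)).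
Proof.
move=> b0; pose n := Num.truncn `|a|.
have bn0 : b ^+ n.+1 != 0 by rewrite expf_neq0 // gt_eqF.
exists (b `^ a / b ^+ n.+1 * (2 ^+ n.+1 * n.+1`!%:R)).
  by rewrite !mulr_ge0 ?powR_ge0 ?invr_ge0 ?exprn_ge0 // ltW.
move=> t bt; have t0 : 0 < t := lt_le_trans b0 bt.
have -> : expR (- t) = expR (- (t / 2)) * expR (- (t / 2)).
  by rewrite -expRD; congr expR; field.
rewrite mulrA ler_wpM2r ?expR_ge0 //.
rewrite expRN ler_pdivrMr ?expR_gt0 //.
have h1 : t `^ a <= b `^ a / b ^+ n.+1 * t ^+ n.+1.
  have tb : 1 <= t / b by rewrite ler_pdivlMr // mul1r.
  have tE : t `^ a = b `^ a * (t / b) `^ a.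
    by rewrite -powRM ?divr_ge0 ?(ltW t0) ?(ltW b0) // mulrC divfK // gt_eqF.
  rewrite tE -mulrA ler_wpM2l ?powR_ge0 // [leRHS]mulrC -expr_div_n.
  rewrite -powR_mulrn ?(le_trans _ tb) //; apply: (ler_powR tb).
  by apply: le_trans (ler_norm _) (ltW (truncnS_gt _)).
apply: (le_trans h1); rewrite -!mulrA !ler_wpM2l ?powR_ge0 ?invr_ge0 //.
  by rewrite exprn_ge0 // ltW.
have := @expR_ge1Dxn R (t / 2) n; rewrite divr_ge0 ?(ltW t0) // => /(_ isT) h.
have {h} : (t / 2) ^+ n.+1 / n.+1`!%:R <= expR (t / 2) by lra.
rewrite ler_pdivrMr ?ltr0n ?fact_gt0 // expr_div_n ler_pdivrMr ?exprn_gt0 //.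
by move=> /le_trans; apply; rewrite le_eqVlt; apply/orP; left; apply/eqP; ring.
Qed.

Definition gamma_kernel a t := t `^ a * expR (- t).

Local Notation K := gamma_kernel.

Lemma gamma_kernel_ge0 a t : 0 <= K a t.
Proof. by rewrite mulr_ge0 ?powR_ge0 ?expR_ge0. Qed.

Lemma gamma_kernelS s t : 0 < s -> 0 < t -> K s t = t * K (s - 1) t.
Proof. by move=> s0 t0; rewrite /K mulrA mulr_powRB1 // ltW. Qed.

Lemma is_derive_gamma_kernel s t : 0 < s -> 0 < t ->
  is_derive t 1 (K s) ((s - t) * K (s - 1) t).
Proof.
move=> s0 t0; have dp := is_derive1_powR s t0.
have de : is_derive t 1 (fun x : R => expR (- x)) (- expR (- t)).
  have := @is_derive1_comp R (@expR R) -%R t (expR (- t)) (-1) (is_derive_expR _) _.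
  by rewrite mulrN1; apply; exact: is_deriveNid.
apply: is_derive_eq (is_deriveM dp de) _.
rewrite mulrBl -gamma_kernelS // /K ![_ *: _]mulrC; ring.
Qed.

Lemma continuous_gamma_kernel a t : 0 < t -> {for t, continuous (K a)}.
Proof.
move=> t0; apply: continuousM; last first.
  by apply: continuous_comp; [exact: opp_continuous|exact: continuous_expR].
by have dp := is_derive1_powR a t0; apply: differentiable_continuous;
  exact/derivable1_diffP.
Qed.

Lemma measurable_gamma_kernel a (A : set R) : measurable A ->
  A `<=` `]0, +oo[%classic -> measurable_fun A (EFin \o K a).
Proof.
move=> mA A0; apply/measurable_EFinP.
apply: (measurable_funS _ A0) => //.
apply: open_continuous_measurable_fun; first exact: interval_open.
by move=> t; rewrite inE /= in_itv /= andbT; exact: continuous_gamma_kernel.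
Qed.

Lemma gamma_kernel_cvg0 s : 0 < s -> K s @ 0^'+ --> 0.
Proof.
move=> s0; rewrite -[0 in X in _ --> X](mul0r (expR (- 0))); apply: cvgM.
  exact: powR_cvg0.
apply: cvg_at_right_filter.
by apply: continuous_comp; [exact: opp_continuous|exact: continuous_expR].
Qed.

Lemma cvg_expRN_half (C : R) : (C * expR (- (x / 2))) @[x --> +oo] --> 0.
Proof.
rewrite -(mulr0 C); apply: cvgMr.
apply: (@cvg_comp _ _ _ (fun x : R => x / 2) (fun x => expR (- x)) _ _ _ _ (@cvgr_expR R)).
by apply: gt0_cvgMly; [rewrite invr_gt0|exact: cvg_id].
Qed.

Lemma gamma_kernel_cvgy s : 0 < s -> K s @ +oo --> 0.
Proof.
move=> s0; have [C C0 hC] := powR_expR_le s ltr01.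
apply: (squeeze_cvgr _ (cvg_cst 0) (cvg_expRN_half C)).
near=> t; rewrite gamma_kernel_ge0 /=; apply: hC.
by near: t; exact: nbhs_pinfty_ge.
Unshelve. all: by end_near. Qed.

(* Integration by parts without integrability conditions: the derivative
   (s - t) t^(s-1) e^(-t) of t^s e^(-t) changes sign only at [t = s], so all
   integrands over ]0, s] and ]s, +oo[ can be arranged to be nonnegative. *)
Lemma gamma_integral_left s : 0 < s ->
  (s%:E * \int[mu]_(t in `]0%R, s]) (K (s - 1) t)%:E =
   (K s s)%:E + \int[mu]_(t in `]0%R, s]) (K s t)%:E)%E.
Proof.
move=> s0; have sub : `]0, s]%classic `<=` (`]0, +oo[%classic : set R).
  by move=> t /=; rewrite !in_itv /= => /andP[->].
have md : measurable (`]0, s]%classic : set R) by exact: measurable_itv.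
have mK := measurable_gamma_kernel.
have <- : (\int[mu]_(t in `]0%R, s]) ((s - t) * K (s - 1) t)%:E = (K s s)%:E)%E.
  have := @ge0_FTC2_oc (fun t => (s - t) * K (s - 1) t) (K s) s 0 s0.
  rewrite subr0; apply.
  - by move=> t /andP[t0 ts]; rewrite mulr_ge0 ?gamma_kernel_ge0 ?subr_ge0.
  - move=> t t0; apply: continuousM; last exact: continuous_gamma_kernel.
    by apply: continuousB; [exact: cvg_cst|exact: cvg_id].
  - by move=> t; exact: is_derive_gamma_kernel.
  - exact: gamma_kernel_cvg0.
have pos (t : R) : (`]0, s]%classic : set R) t -> 0 < t <= s.
  by rewrite /= in_itv.
rewrite -ge0_integralD //.
- rewrite -ge0_integralZl_EFin //.
  + apply: eq_integral => t; rewrite inE => /pos /andP[t0 ts].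
    by rewrite -EFinM -EFinD (gamma_kernelS s0 t0) -mulrDl subrK.
  + by move=> t _; rewrite lee_fin gamma_kernel_ge0.
  + exact: mK.
  + exact: ltW.
- move=> t /pos /andP[t0 ts].
  by rewrite lee_fin mulr_ge0 ?gamma_kernel_ge0 ?subr_ge0.
- apply/measurable_EFinP; apply: measurable_funM.
    by apply: measurable_funB.
  by apply/measurable_EFinP; exact: mK.
- by move=> t _; rewrite lee_fin gamma_kernel_ge0.
- exact: mK.
Qed.

Lemma gamma_integral_right s : 0 < s ->
  (\int[mu]_(t in `]s, +oo[) (K s t)%:E =
   s%:E * \int[mu]_(t in `]s, +oo[) (K (s - 1) t)%:E + (K s s)%:E)%E.
Proof.
move=> s0; have sub : `]s, +oo[%classic `<=` (`]0, +oo[%classic : set R).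
  by move=> t /=; rewrite !in_itv /= !andbT; exact: lt_trans.
have md : measurable (`]s, +oo[%classic : set R) by exact: measurable_itv.
have mK := measurable_gamma_kernel.
have pos (t : R) : (`]s, +oo[%classic : set R) t -> s < t.
  by rewrite /= in_itv /= andbT.
have mf : measurable_fun (`]s, +oo[%classic : set R)
    (EFin \o (fun t => (t - s) * K (s - 1) t)).
  apply/measurable_EFinP; apply: measurable_funM; first exact: measurable_funB.
  by apply/measurable_EFinP; exact: mK.
have <- : (\int[mu]_(t in `]s, +oo[) ((t - s) * K (s - 1) t)%:E = (K s s)%:E)%E.
  rewrite integral_itv_obnd_cbnd //.
  have := @ge0_continuous_FTC2y R (fun t => (t - s) * K (s - 1) t) (- K s) s 0.
  rewrite -EFinB sub0r -[(- K s) s]/(- K s s) opprK; apply.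
  - by move=> t st; rewrite mulr_ge0 ?gamma_kernel_ge0 ?subr_ge0.
  - apply: continuous_in_subspaceT => t; rewrite inE /= in_itv /= andbT => st.
    apply: cvgM; last exact/continuous_gamma_kernel/(lt_le_trans s0).
    by apply: cvgB; [exact: cvg_id|exact: cvg_cst].
  - by rewrite -[0]oppr0; apply: cvgN; exact: gamma_kernel_cvgy.
  - move=> t st; have d := is_derive_gamma_kernel s0 (lt_trans s0 st).
    exact: derivableN.
  - by apply: cvgN; apply: cvg_at_right_filter; exact: continuous_gamma_kernel.
  - move=> t; rewrite in_itv /= andbT => st.
    have d := is_derive_gamma_kernel s0 (lt_trans s0 st).
    by rewrite derive1E derive_val -mulNr opprB.
rewrite -ge0_integralZl_EFin //; last 3 first.
- by move=> t _; rewrite lee_fin gamma_kernel_ge0.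
- exact: mK.
- exact: ltW.
rewrite -ge0_integralD //.
- apply: eq_integral => t; rewrite inE => /pos st.
  rewrite -EFinM -EFinD (gamma_kernelS s0 (lt_trans s0 st)) -mulrDl; congr ((_ * _)%:E); ring.
- by move=> t _; rewrite mule_ge0 // lee_fin ?gamma_kernel_ge0 ?ltW.
- by apply: emeasurable_funM; [exact: measurable_cst|exact: mK].
- by move=> t /pos st; rewrite lee_fin mulr_ge0 ?gamma_kernel_ge0 ?subr_ge0 ?ltW.
Qed.

(** Domination by C e^(-t/2), whose antiderivative - 2 C e^(-t/2) vanishes at infinity. *)
Lemma gamma_integral_right_lty a s : 0 < s ->
  (\int[mu]_(t in `]s, +oo[) (K a t)%:E < +oo)%E.
Proof.
move=> s0; have [C C0 hC] := powR_expR_le a s0.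
have sub : `]s, +oo[%classic `<=` (`]0, +oo[%classic : set R).
  by move=> t /=; rewrite !in_itv /= !andbT; exact: lt_trans.
have md : measurable (`]s, +oo[%classic : set R) by exact: measurable_itv.
have de (t : R) : is_derive t 1 (fun x : R => - (2 * C) * expR (- (x / 2)))
    (C * expR (- (t / 2))).
  have dl : is_derive t 1 (fun x : R => - (x / 2)) (- 2^-1).
    have -> : (fun x : R => - (x / 2)) = (- 2^-1) \*: id.
      by apply/funext => x /=; rewrite /GRing.scale /=; ring.
    by apply: is_derive_eq; rewrite /GRing.scale /= mulr1.
  have dc := @is_derive1_comp R (@expR R) _ t _ _ (is_derive_expR _) dl.
  apply: is_derive_eq (is_deriveZ (- (2 * C)) dc) _.
  by rewrite /GRing.scale /=; field.
have ce c : continuous (fun t : R => c * expR (- (t / 2))).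
  move=> t; apply: cvgMr; apply: (@continuous_comp _ _ _ (fun t : R => - (t / 2))).
    by apply: cvgN; apply: cvgMl; exact: cvg_id.
  exact: continuous_expR.
apply: (@le_lt_trans _ _ (\int[mu]_(t in `]s, +oo[) (C * expR (- (t / 2)))%:E)%E).
  apply: ge0_le_integral => //.
  - by move=> t _; rewrite lee_fin gamma_kernel_ge0.
  - exact: measurable_gamma_kernel.
  - by apply/measurable_EFinP; apply: measurable_funTS; exact: continuous_measurable_fun.
  - by move=> t; rewrite /= in_itv /= andbT => st; rewrite lee_fin hC // ltW.
rewrite integral_itv_obnd_cbnd; last first.
  by apply/measurable_EFinP; apply: measurable_funTS; exact: continuous_measurable_fun.
rewrite (@ge0_continuous_FTC2y R _ (fun x => - (2 * C) * expR (- (x / 2))) s 0).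
- by rewrite -EFinB ltry.
- by move=> t _; rewrite mulr_ge0 ?expR_ge0.
- exact: continuous_subspaceT.
- exact: cvg_expRN_half.
- by move=> t _; have := de t.
- by apply: cvg_at_right_filter; exact: (ce _ s).
- by move=> t _; have := de t => d; rewrite derive1E derive_val.
Qed.

Lemma gamma_integral_split a s : 0 < s ->
  (\int[mu]_(t in `]0%R, +oo[) (K a t)%:E = \int[mu]_(t in `]0%R, s]) (K a t)%:E +
    \int[mu]_(t in `]s, +oo[) (K a t)%:E)%E.
Proof.
move=> s0; have -> : `]0, +oo[%classic = `]0, s] `|` `]s, +oo[ :> set R.
  apply/seteqP; split => t /=; rewrite !in_itv /= !andbT.
    by move=> t0; have [ts|st] := leP t s; [left; rewrite t0|right].
  by move=> [/andP[]//|]; exact: lt_trans.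
rewrite ge0_integral_setU //.
- apply: measurable_gamma_kernel; first exact: measurableU.
  move=> t /=; rewrite !in_itv /= !andbT.
  by move=> [/andP[]//|]; exact: lt_trans.
- by move=> t _; rewrite lee_fin gamma_kernel_ge0.
- apply/disj_setPS => t [] /=; rewrite !in_itv /= andbT => /andP[_ ts] st.
  by move: (lt_le_trans st ts); rewrite ltxx.
Qed.

(** The integrand may be singular at 0, but integration by parts trades it for t^s e^(-t), which is
    bounded by s^s on the interval. *)
Lemma gamma_integral_left_lty s : 0 < s ->
  (\int[mu]_(t in `]0%R, s]) (K (s - 1) t)%:E < +oo)%E.
Proof.
move=> s0; have sub : `]0, s]%classic `<=` (`]0, +oo[%classic : set R).
  by move=> t /=; rewrite !in_itv /= => /andP[->].
have fin : (\int[mu]_(t in `]0%R, s]) (K s t)%:E < +oo)%E.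
  apply: (@le_lt_trans _ _ (\int[mu]_(t in `]0%R, s]) (s `^ s)%:E)%E).
    apply: ge0_le_integral => //.
    - by move=> t _; rewrite lee_fin gamma_kernel_ge0.
    - exact: measurable_gamma_kernel.
    - move=> t; rewrite /= in_itv /= => /andP[t0 ts]; rewrite lee_fin /K.
      apply: (@le_trans _ _ (t `^ s)).
        by rewrite ler_piMr ?powR_ge0 // -expR0 ler_expR oppr_le0 ltW.
      by apply: ge0_ler_powR; rewrite ?nnegrE // ltW.
  rewrite integral_cst //= lebesgue_measure_itv /= lte_fin s0.
  by rewrite -EFinB -EFinM ltry.
rewrite -(@lte_pmul2l _ s%:E) //.
  by rewrite gt0_muley ?lte_fin // gamma_integral_left // lte_add_pinfty ?ltry.
Qed.

Lemma GammaE s : Gamma s = fine (\int[mu]_(t in `]0%R, +oo[) (K (s - 1) t)%:E)%E.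
Proof. by []. Qed.

Lemma gamma_integral_fin s : 0 < s ->
  (\int[mu]_(t in `]0%R, +oo[) (K (s - 1) t)%:E)%E \is a fin_num.
Proof.
move=> s0; rewrite ge0_fin_numE.
  rewrite (gamma_integral_split _ s0) lte_add_pinfty //.
    exact: gamma_integral_left_lty.
  exact: gamma_integral_right_lty.
by apply: integral_ge0 => t _; rewrite lee_fin gamma_kernel_ge0.
Qed.

(** The boundary term s^s e^(-s) of the integration by parts is a positive lower bound for s times
    the integral over ]0, s]. *)
Lemma Gamma_gt0 s : 0 < s -> 0 < Gamma s.
Proof.
move=> s0; rewrite GammaE fine_gt0 //; apply/andP; split; last first.
  by rewrite -ge0_fin_numE ?gamma_integral_fin // integral_ge0 // => t _;
    rewrite lee_fin gamma_kernel_ge0.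
have nn a (D : set R) : (0 <= \int[mu]_(t in D) (K a t)%:E)%E.
  by apply: integral_ge0 => t _; rewrite lee_fin gamma_kernel_ge0.
rewrite (gamma_integral_split _ s0); apply: (@lt_le_trans _ _
  (\int[mu]_(t in `]0%R, s]) (K (s - 1) t)%:E)%E); last by rewrite leeDl.
rewrite -(@pmule_rgt0 _ s%:E) ?lte_fin // gamma_integral_left //.
apply: (@lt_le_trans _ _ (K s s)%:E); last by rewrite leeDl.
by rewrite lte_fin mulr_gt0 ?powR_gt0 ?expR_gt0.
Qed.

(** The boundary terms at t = s from the two sides coincide, so adding the two halves yields the
    functional equation. *)
Lemma GammaS s : 0 < s -> Gamma (s + 1) = s * Gamma s.
Proof.
move=> s0; rewrite !GammaE addrK.
rewrite -[s in RHS]/(fine s%:E) -fineM ?gamma_integral_fin //; congr fine.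
rewrite !(gamma_integral_split _ s0) ge0_muleDr; last 2 first.
- by apply: integral_ge0 => t _; rewrite lee_fin gamma_kernel_ge0.
- by apply: integral_ge0 => t _; rewrite lee_fin gamma_kernel_ge0.
rewrite gamma_integral_left // gamma_integral_right //.
by rewrite addeC [RHS]addeAC; congr (_ + _)%E; rewrite addeC.
Qed.

End GammaFunction.

(** * Coefficients of solutions of u_tt = - L u *)

Section SecondDerivatives.
Variable R : realType.
Implicit Types (f df ddf : R -> R).

Lemma is_derive_comp_addl f (a t df : R) :
  is_derive (a + t) 1 f df -> is_derive t 1 (fun x => f (a + x)) df.
Proof.
move=> d; have s : is_derive t 1 (fun x : R => a + x) 1.
  by apply: is_derive_eq (is_deriveD (is_derive_cst a t 1) (is_derive_id t 1)) _;
    rewrite add0r.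
by have := @is_derive1_comp R f _ t df _ d s; rewrite mulr1; exact.
Qed.

Lemma is_derive_comp_subl f (a t df : R) :
  is_derive (a - t) 1 f df -> is_derive t 1 (fun x => f (a - x)) (- df).
Proof.
move=> d; have s : is_derive t 1 (fun x : R => a - x) (-1).
  by apply: is_derive_eq (is_deriveB (is_derive_cst a t 1) (is_derive_id t 1)) _;
    rewrite sub0r.
by have := @is_derive1_comp R f _ t df _ d s; rewrite mulrN1; exact.
Qed.

(** The function [k] is even in x, so its derivative vanishes at 0, and its second derivative is
    bounded by 2 e; two mean value inequalities bound k(h) - k(0). *)
Lemma second_difference f df ddf (t h c e : R) : 0 <= h ->
  (forall z, `|z - t| <= h -> is_derive z 1 f (df z)) ->
  (forall z, `|z - t| <= h -> is_derive z 1 df (ddf z)) ->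
  (forall z, `|z - t| <= h -> `|ddf z - c| <= e) ->
  `|f (t + h) + f (t - h) - 2 * f t - c * h ^+ 2| <= 2 * e * h ^+ 2.
Proof.
move=> h0 fd dfd ddfc.
pose k x := f (t + x) + f (t - x) - c * x ^+ 2.
pose dk x := df (t + x) - df (t - x) - 2 * c * x.
pose ddk x := ddf (t + x) + ddf (t - x) - 2 * c.
have inp x : `|x - 0| <= `|h - 0| -> `|(t + x) - t| <= h.
  by rewrite !subr0 (ger0_norm h0) addrAC subrr add0r.
have inm x : `|x - 0| <= `|h - 0| -> `|(t - x) - t| <= h.
  by rewrite !subr0 (ger0_norm h0) addrAC subrr add0r normrN.
have dkE (x : R) : `|x - 0| <= `|h - 0| -> is_derive x 1 k (dk x).
  move=> xh; have d1 := is_derive_comp_addl (fd _ (inp _ xh)).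
  have d2 := is_derive_comp_subl (fd _ (inm _ xh)).
  have d3 : is_derive x 1 (fun x : R => c * x ^+ 2) (2 * c * x).
    apply: is_derive_eq (is_deriveZ c (is_deriveM (is_derive_id x 1) (is_derive_id x 1))) _.
    by rewrite /GRing.scale /=; ring.
  exact: is_deriveB (is_deriveD d1 d2) d3.
have ddkE (x : R) : `|x - 0| <= `|h - 0| -> is_derive x 1 dk (ddk x).
  move=> xh; have d1 := is_derive_comp_addl (dfd _ (inp _ xh)).
  have d2 := is_derive_comp_subl (dfd _ (inm _ xh)).
  have d3 : is_derive x 1 (fun x : R => 2 * c * x) (2 * c).
    apply: is_derive_eq (is_deriveZ (2 * c) (is_derive_id x 1)) _.
    by rewrite /GRing.scale /= mulr1.
  by have := is_deriveB (is_deriveB d1 d2) d3; rewrite opprK.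
have ddkB x : `|x - 0| <= `|h - 0| -> `|ddk x| <= 2 * e.
  move=> xh; have h1 := ddfc _ (inp _ xh); have h2 := ddfc _ (inm _ xh).
  have -> : ddk x = (ddf (t + x) - c) + (ddf (t - x) - c) by rewrite /ddk; ring.
  by apply: le_trans (ler_normD _ _) _; lra.
have dkB x : `|x - 0| <= `|h - 0| -> `|dk x| <= 2 * e * h.
  move=> xh; have dk0 : dk 0 = 0 by rewrite /dk addr0 subr0 subrr mulr0 subrr.
  have e0 : 0 <= 2 * e := le_trans (normr_ge0 _) (ddkB _ xh).
  have := @mvt_lipschitz R dk ddk 0 x (2 * e).
  rewrite dk0 !subr0 => /(_ _ _) /le_trans; apply.
  - by move=> z; rewrite subr0 => zx; apply: ddkE; rewrite !subr0 in xh *;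
      exact: le_trans xh.
  - by move=> z; rewrite subr0 => zx; apply: ddkB; rewrite !subr0 in xh *;
      exact: le_trans xh.
  - by rewrite ler_wpM2l //; move: xh; rewrite !subr0 (ger0_norm h0).
have := mvt_lipschitz dkE dkB; rewrite subr0 (ger0_norm h0) -mulrA -expr2.
suff -> : k h - k 0 = f (t + h) + f (t - h) - 2 * f t - c * h ^+ 2 by [].
by rewrite /k addr0 subr0; ring.
Qed.

(** First derivatives of the approximants are not controlled, so the second derivatives are compared
    through second differences: the step h is fixed by continuity of [ddf] and [g], and only then is
    [p] chosen with an error small against h^2. *)
Lemma derive2_uniform_limit f df ddf g (t r : R) : 0 < r ->
  (forall z, `|z - t| < r -> is_derive z 1 f (df z)) ->
  (forall z, `|z - t| < r -> is_derive z 1 df (ddf z)) ->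
  {for t, continuous ddf} -> {for t, continuous g} ->
  (forall e, 0 < e -> exists p dp ddp : R -> R, forall z, `|z - t| < r ->
    [/\ is_derive z 1 p (dp z), is_derive z 1 dp (ddp z),
        `|p z - f z| <= e & `|ddp z - g z| <= e]) ->
  ddf t = g t.
Proof.
move=> r0 fd dfd cddf cg approx; apply/eqP; rewrite -subr_eq0 -normr_eq0.
apply/negPn/negP => neq0.
(* The errors add up to (4 + 2 + 4) e h^2: second difference of p, second difference of f, and p - f
   at three points with weights 1, 1, 2. With 20 in the denominator this is half of what it has to
   exceed. *)
pose e := `|ddf t - g t| / 20.
have e0 : 0 < e by rewrite divr_gt0 // lt_neqAle eq_sym neq0 normr_ge0.
have [h [h0 hr hP]] : exists h, [/\ 0 < h, h < r & forall z, `|z - t| <= h ->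
    `|ddf z - ddf t| <= e /\ `|g z - g t| <= e].
  have : \forall z \near t, `|ddf z - ddf t| <= e /\ `|g z - g t| <= e.
    near=> z; split; rewrite distrC; near: z.
      by move/cvgrPdist_le: cddf; apply.
    by move/cvgrPdist_le: cg; apply.
  move=> /nbhs_ballP [d /= d0 dP].
  pose m := Num.min d r.
  have m0 : 0 < m by rewrite lt_min d0.
  have md : m <= d by rewrite ge_min lexx.
  have mr : m <= r by rewrite ge_min lexx orbT.
  exists (m / 2); split; [lra|lra|move=> z zt].
  by apply: dP; rewrite /ball /= distrC; apply: le_lt_trans zt _; lra.
have h20 : 0 < h ^+ 2 by rewrite exprn_gt0.
have eh : 0 < Num.min e (e * h ^+ 2) by rewrite lt_min e0 mulr_gt0.
have [p [dp [ddp pP]]] := approx _ eh.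
have zr z : `|z - t| <= h -> `|z - t| < r by move=> /le_lt_trans; exact.
have tt : `|t - t| <= h by rewrite subrr normr0 ltW.
have tp : `|(t + h) - t| <= h by rewrite addrAC subrr add0r ger0_norm // ltW.
have tm : `|(t - h) - t| <= h.
  by rewrite addrAC subrr add0r normrN ger0_norm // ltW.
have pe z : `|z - t| <= h -> `|p z - f z| <= e * h ^+ 2.
  by move=> /zr /pP[_ _ + _]; rewrite le_min => /andP[].
have D1 : `|p (t + h) + p (t - h) - 2 * p t - g t * h ^+ 2| <= 2 * (2 * e) * h ^+ 2.
  apply: (second_difference (df := dp) (ddf := ddp)) => [|z /zr /pP[]//|z /zr /pP[]//|z zt].
    exact: ltW.
  have [_ _ _] := pP z (zr z zt); rewrite le_min => /andP[h1 _].
  have [_ h2] := hP z zt.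
  have -> : ddp z - g t = (ddp z - g z) + (g z - g t) by ring.
  by apply: le_trans (ler_normD _ _) _; lra.
have D2 : `|f (t + h) + f (t - h) - 2 * f t - ddf t * h ^+ 2| <= 2 * e * h ^+ 2.
  apply: (second_difference (df := df) (ddf := ddf)) => [|z /zr /fd//|z /zr /dfd//|z zt].
    exact: ltW.
  by have [] := hP z zt.
have h1 := pe _ tt; have h2 := pe _ tp; have h3 := pe _ tm.
have : `|(ddf t - g t) * h ^+ 2| <= 10 * e * h ^+ 2.
  move: D1 D2 h1 h2 h3; rewrite mulrBl -!mulrA; move: (e * h ^+ 2) => E.
  move: (ddf t * _) (g t * _) => x y; rewrite !ler_norml.
  by do 5 (move=> /andP[? ?]); apply/andP; split; lra.
rewrite normrM (ger0_norm (ltW h20)) ler_pM2r //.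
rewrite /e; have : 0 < `|ddf t - g t| by rewrite lt_neqAle eq_sym neq0 normr_ge0.
by lra.
Unshelve. all: by end_near. Qed.

End SecondDerivatives.

Section CoefficientRecursion.
Variable R : realType.
Implicit Types (kap : nat -> R) (t s q M : R) (b : nat -> R -> R).

(** The equation u_tt = - L u for u(t, s) = sum_k b_k(t) s^k, where L sends the coefficients b_k to
    kap_k b_(k+1). The derivative [dphi] is chosen for each s separately, without any control of its
    dependence on s. *)
Definition psum_ode kap b (t0 r sig : R) : Prop :=
  forall s, 0 < s < sig -> exists dphi : R -> R, forall t, `|t - t0| < r ->
    is_derive t 1 (fun t => psum (b^~ t) s) (dphi t) /\
    is_derive t 1 dphi (- psum (fun k => kap k * b k.+1 t) s).

Lemma coef_bounded_weight kap (c : nat -> R) q M (C : R) : 0 < q ->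
  (forall k, `|kap k| <= C * 4 ^+ k) -> coef_bounded c q M ->
  coef_bounded (fun k => kap k * c k.+1) (q / 4) (C * (M / q)).
Proof.
move=> q0 kapC cM k; rewrite normrM expr_div_n.
have C0 : 0 <= C by have := kapC 0%N; rewrite mulr1; exact: le_trans.
apply: (@le_trans _ _ ((C * 4 ^+ k) * `|c k.+1| * (q ^+ k / 4 ^+ k))).
  by rewrite !ler_wpM2r ?divr_ge0 ?exprn_ge0 // ltW.
have -> : C * 4 ^+ k * `|c k.+1| * (q ^+ k / 4 ^+ k) = C * (`|c k.+1| * q ^+ k.+1 / q).
  by rewrite exprS; field; rewrite expf_neq0 // gt_eqF.
by rewrite ler_wpM2l // ler_wpM2r ?invr_ge0 ?(ltW q0).
Qed.

(* Let [s] tend to 0. *)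
Lemma psum_ode_head kap b b1 b2 t0 r sig q M (C : R) t : 0 < q -> 0 < sig ->
  (forall k, `|kap k| <= C * 4 ^+ k) ->
  (forall t, `|t - t0| < r -> coef_bounded (b^~ t) q M) ->
  (forall k t, `|t - t0| < r -> is_derive t 1 (b k) (b1 k t)) ->
  (forall k t, `|t - t0| < r -> is_derive t 1 (b1 k) (b2 k t)) ->
  (forall k t, `|t - t0| < r -> {for t, continuous (b2 k)}) ->
  psum_ode kap b t0 r sig ->
  `|t - t0| < r -> b2 0%N t = - (kap 0%N * b 1%N t).
Proof.
move=> q0 sig0 kapC bM db ddb cb2 ode tr.
pose rho := r - `|t - t0|.
have rho0 : 0 < rho by rewrite subr_gt0.
have inr z : `|z - t| < rho -> `|z - t0| < r.
  move=> zt; have -> : z - t0 = (z - t) + (t - t0) by ring.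
  by apply: le_lt_trans (ler_normD _ _) _; rewrite -ltrBrDr.
have M0 : 0 <= M := coef_bounded_ge0 (bM t tr).
have C0 : 0 <= C by have := kapC 0%N; rewrite mulr1; exact: le_trans.
pose M' := C * (M / q).
have q40 : 0 < q / 4 by rewrite divr_gt0.
have kM z : `|z - t| < rho -> coef_bounded (fun k => kap k * b k.+1 z) (q / 4) M'.
  by move=> /inr /bM; exact: coef_bounded_weight.
apply: (@derive2_uniform_limit _ (b 0%N) (b1 0%N) (b2 0%N)
  (fun z => - (kap 0%N * b 1%N z)) t rho rho0).
- by move=> z /inr /db.
- by move=> z /inr /ddb.
- exact: cb2.
- apply: cvgN; apply: cvgMr.
  have := db 1%N t tr => d; apply: differentiable_continuous.
  exact/derivable1_diffP.
move=> e e0.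
(* The sum of the two error constants of [psum_near0], for the series and for its image under L;
   adding 1 makes it positive. *)
pose B := 2 * M / q + 2 * M' / (q / 4) + 1.
have B0 : 0 < B.
  rewrite ltr_pwDr // addr_ge0 // !mulr_ge0 ?invr_ge0 ?divr_ge0 ?(ltW q0) ?(ltW q40) //.
(* Here sig/2 keeps the equation valid, q/8 is half the radius of the weighted series, and e/B
   brings both errors below e. *)
pose s := Num.min (Num.min (sig / 2) (q / 8)) (e / B).
have s0 : 0 < s by rewrite !lt_min !divr_gt0.
have s1 : s <= sig / 2 by rewrite !ge_min lexx.
have s2 : s <= q / 8 by rewrite !ge_min lexx orbT.
have s3 : s <= e / B by rewrite ge_min lexx orbT.
have ns : `|s| = s by rewrite gtr0_norm.
have ssig : 0 < s < sig by rewrite s0 /=; lra.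
have [dphi dP] := ode s ssig.
exists (fun t => psum (b^~ t) s), dphi,
  (fun t => - psum (fun k => kap k * b k.+1 t) s) => z zt.
have [d1 d2] := dP z (inr z zt); split => //.
- have := @psum_near0 R _ q s M (bM z (inr z zt)) q0.
  rewrite ns => /(_ _) /le_trans; apply; first lra.
  apply: (@le_trans _ _ (B * s)); last by rewrite mulrC -ler_pdivlMr.
  rewrite ler_wpM2r ?(ltW s0) // /B -addrA lerDl addr_ge0 //.
  by rewrite !mulr_ge0 ?invr_ge0 ?divr_ge0 ?(ltW q0) ?(ltW q40).
- rewrite -opprD normrN.
  have := @psum_near0 R _ (q / 4) s M' (kM z zt) q40.
  rewrite ns => /(_ _) /le_trans; apply; first lra.
  apply: (@le_trans _ _ (B * s)); last by rewrite mulrC -ler_pdivlMr.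
  rewrite ler_wpM2r ?(ltW s0) // /B addrAC lerDr addr_ge0 //.
  by rewrite !mulr_ge0 ?invr_ge0 ?divr_ge0 ?(ltW q0) ?(ltW q40).
Qed.

(** The function (u - b_0)/s has the shifted coefficients, and by [psum_ode_head] subtracting b_0''
    removes exactly the constant term of - L u. The bound q/4 keeps s where the weighted series can
    be split. *)
Lemma psum_ode_shift kap b b1 b2 t0 r sig q M (C : R) : 0 < q -> 0 < sig ->
  (forall k, `|kap k| <= C * 4 ^+ k) ->
  (forall t, `|t - t0| < r -> coef_bounded (b^~ t) q M) ->
  (forall k t, `|t - t0| < r -> is_derive t 1 (b k) (b1 k t)) ->
  (forall k t, `|t - t0| < r -> is_derive t 1 (b1 k) (b2 k t)) ->
  (forall k t, `|t - t0| < r -> {for t, continuous (b2 k)}) ->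
  psum_ode kap b t0 r sig ->
  psum_ode (fun k => kap k.+1) (fun k => b k.+1) t0 r (Num.min sig (q / 4)).
Proof.
move=> q0 sig0 kapC bM db ddb cb2 ode s /andP[s0]; rewrite lt_min => /andP[ssig sq].
have head t := @psum_ode_head kap b b1 b2 t0 r sig q M C t q0 sig0 kapC bM db ddb cb2 ode.
have [|dphi dP] := ode s; first by rewrite s0.
have sn0 : s != 0 by rewrite gt_eqF.
have ns : `|s| = s by rewrite gtr0_norm.
have kM z : `|z - t0| < r -> coef_bounded (fun k => kap k * b k.+1 z) (q / 4) (C * (M / q)).
  by move=> /bM; exact: coef_bounded_weight.
exists (fun t => s^-1 * (dphi t - b1 0%N t)) => t tr.
have [d1 d2] := dP t tr; split.
- have d := is_deriveZ s^-1 (is_deriveB d1 (db 0%N t tr)).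
  apply: near_eq_is_derive d; apply: filterS (near_dist_lt tr) => z zr.
  have zs : `|s| < q by rewrite ns; lra.
  rewrite -[LHS]/(s^-1 * (psum (b^~ z) s - b 0%N z)).
  by rewrite (psum_split (bM z zr) zs) addrAC subrr add0r mulKf.
- apply: is_derive_eq (is_deriveZ s^-1 (is_deriveB d2 (ddb 0%N t tr))) _.
  have zs : `|s| < q / 4 by rewrite ns.
  rewrite (psum_split (kM t tr) zs) head // /GRing.scale /=.
  by field.
Qed.

Lemma psum_ode_recursion kap b b1 b2 t0 r sig q M (C : R) N t : 0 < q -> 0 < sig ->
  (forall k, `|kap k| <= C * 4 ^+ k) ->
  (forall t, `|t - t0| < r -> coef_bounded (b^~ t) q M) ->
  (forall k t, `|t - t0| < r -> is_derive t 1 (b k) (b1 k t)) ->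
  (forall k t, `|t - t0| < r -> is_derive t 1 (b1 k) (b2 k t)) ->
  (forall k t, `|t - t0| < r -> {for t, continuous (b2 k)}) ->
  psum_ode kap b t0 r sig ->
  `|t - t0| < r -> b2 N t = - (kap N * b N.+1 t).
Proof.
elim: N kap b b1 b2 sig M C => [|N IHN] kap b b1 b2 sig M C q0 sig0 kapC bM db ddb cb2 ode tr.
  exact: psum_ode_head q0 sig0 kapC bM db ddb cb2 ode tr.
(* The shift preserves the radius [q]; only the constants change, M to M/q and C to 4 C. *)
apply: (IHN (fun k => kap k.+1) (fun k => b k.+1) (fun k => b1 k.+1)
  (fun k => b2 k.+1) (Num.min sig (q / 4)) (M / q) (4 * C)) => //.
- by rewrite lt_min sig0 divr_gt0.
- by move=> k; apply: le_trans (kapC _) _; rewrite exprS; lra.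
- by move=> z /bM bz k; rewrite ler_pdivlMr // -mulrA -exprSr; exact: bz.
- by move=> k; exact: cb2.
- exact: psum_ode_shift q0 sig0 kapC bM db ddb cb2 ode.
Qed.

(** If no subinterval had a uniform bound, the points where some |b_k| q^k exceeds n would be open
    and dense for every n, and a point common to all n would contradict the pointwise bound. *)
Lemma baire_coef_bounded b t0 r q : 0 < r -> 0 <= q ->
  (forall k t, `|t - t0| < r -> {for t, continuous (b k)}) ->
  (forall t, `|t - t0| < r -> exists M, coef_bounded (b^~ t) q M) ->
  exists t1 r1 M, [/\ 0 < r1,
    forall t, `|t - t1| < r1 -> `|t - t0| < r &
    forall t, `|t - t1| < r1 -> coef_bounded (b^~ t) q M].
Proof.
move=> r0 q0 cb bM; apply: contrapT => H.
(* Baire's theorem concerns the whole line, so a set away from the centre is added for density; it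
   is avoided at the end by looking for a common point within r/2 of [t0]. *)
pose O (n : nat) : set R := [set t | `|t - t0| < r /\
   exists k, n%:R < `|b k t| * q ^+ k] `|` [set t | r / 2 < `|t - t0|].
have cdist : continuous (fun t : R => `|t - t0|).
  by move=> t; apply: cvg_norm; apply: cvgB; [exact: cvg_id|exact: cvg_cst].
have OP n : open (O n) /\ dense (O n).
  split.
    apply: openU; last first.
      exact: (open_comp (D := [set y | r / 2 < y]) (fun x _ => cdist x) (@open_gt _ _)).
    rewrite openE => t [tr [k nk]]; rewrite /interior.
    have nk' : \forall z \near t, n%:R < `|b k z| * q ^+ k.
      have : (fun z => `|b k z| * q ^+ k) @ t --> `|b k t| * q ^+ k.
        by apply: cvgMl; apply: cvg_norm; exact: cb.
      by move=> /cvgr_gt; apply.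
    by near=> z; split; [near: z; exact: near_dist_lt|exists k; near: z].
  move=> D [y Dy] oD; have [yr|yr] := leP `|y - t0| (r / 2); last first.
    by exists y; split => //; right.
  have /nbhs_ballP [d /= d0 dD] : nbhs y D by exact: open_nbhs_nbhs.
  apply: contrapT => noD; apply: H.
  exists y, (Num.min d (r / 2)), n%:R.
  have sub t : `|t - y| < Num.min d (r / 2) -> D t /\ `|t - t0| < r.
    rewrite lt_min => /andP[td tr]; split.
      by apply: dD; rewrite /ball /= distrC.
    have -> : t - t0 = (t - y) + (y - t0) by ring.
    by apply: le_lt_trans (ler_normD _ _) _; lra.
  split; [by rewrite lt_min d0 divr_gt0|by move=> t /sub[]|].
  move=> t /sub[Dt tr] k; rewrite leNgt; apply/negP => nk.
  by apply: noD; exists t; split => //; left; split => //; exists k.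
have dI := @Baire R (R : completeNormedModType R) O OP.
have ne : [set t | `|t - t0| < r / 2] !=set0.
  by exists t0; rewrite /= subrr normr0 divr_gt0.
have oI : open [set t | `|t - t0| < r / 2].
  exact: (open_comp (D := [set y | y < r / 2]) (fun x _ => cdist x) (@open_lt _ _)).
have [t [+ tO]] := dI _ ne oI.
move=> /= tr; have tr' : `|t - t0| < r by lra.
have [M tM] := bM t tr'.
have [[_ [k]]|/=] := tO (Num.truncn M).+1 I; last by lra.
by have := tM k; have := truncnS_gt M; lra.
Unshelve. all: by end_near. Qed.

(* The coefficients of a solution satisfy the recursion on a dense set, where
   Baire's theorem makes the bounds on them locally uniform; continuity does
   the rest. *)
Lemma psum_ode_coef kap b b1 b2 t0 r sig q (C : R) N : 0 < r -> 0 < q -> 0 < sig ->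
  (forall k, `|kap k| <= C * 4 ^+ k) ->
  (forall t, `|t - t0| < r -> exists M, coef_bounded (b^~ t) q M) ->
  (forall k t, `|t - t0| < r -> is_derive t 1 (b k) (b1 k t)) ->
  (forall k t, `|t - t0| < r -> is_derive t 1 (b1 k) (b2 k t)) ->
  (forall k t, `|t - t0| < r -> {for t, continuous (b2 k)}) ->
  psum_ode kap b t0 r sig ->
  b2 N t0 = - (kap N * b N.+1 t0).
Proof.
move=> r0 q0 sig0 kapC bM db ddb cb2 ode; apply: contrapT => neq.
have cb k t : `|t - t0| < r -> {for t, continuous (b k)}.
  move=> tr; have := db k t tr => d; apply: differentiable_continuous.
  exact/derivable1_diffP.
pose D z := b2 N z + kap N * b N.+1 z.
have t00 : `|t0 - t0| < r by rewrite subrr normr0.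
have cD : {for t0, continuous D}.
  by apply: cvgD; [exact: cb2|apply: cvgMr; exact: cb].
have Dn0 : 0 < `|D t0|.
  by rewrite normr_gt0; apply/eqP => /eqP; rewrite addr_eq0 => /eqP.
have : \forall z \near t0, 0 < `|D z|.
  have : (fun z => `|D z|) @ t0 --> `|D t0| by apply: cvg_norm.
  by move=> /cvgr_gt; apply.
move=> /nbhs_ballP [d /= d0 dP].
(* On this ball the defect [D] of the recursion has no zero; the subinterval from Baire's theorem is
   taken inside it, and there [D] vanishes. *)
pose rho := Num.min d r.
have rho0 : 0 < rho by rewrite lt_min d0.
have inr z : `|z - t0| < rho -> `|z - t0| < r by rewrite lt_min => /andP[].
have ind z : `|z - t0| < rho -> 0 < `|D z|.
  by rewrite lt_min => /andP[zd _]; apply: dP; rewrite /ball /= distrC.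
have [t1 [r1 [M [r10 sub uM]]]] := baire_coef_bounded rho0 (ltW q0)
  (fun k t tr => cb k t (inr t tr)) (fun t tr => bM t (inr t tr)).
have sub' t : `|t - t1| < r1 -> `|t - t0| < r by move=> /sub /inr.
have t11 : `|t1 - t1| < r1 by rewrite subrr normr0.
have ode' : psum_ode kap b t1 r1 sig.
  by move=> s /ode [dphi dphiP]; exists dphi => t /sub' /dphiP.
have E := @psum_ode_recursion kap b b1 b2 t1 r1 sig q M C N t1 q0 sig0 kapC uM
  (fun k t tr => db k t (sub' t tr)) (fun k t tr => ddb k t (sub' t tr))
  (fun k t tr => cb2 k t (sub' t tr)) ode' t11.
by have := ind t1 (sub t1 t11); rewrite /D E addNr normr0 ltxx.
Qed.

End CoefficientRecursion.

(** * Coordinates in the Clifford algebra *)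

Lemma cvg_bigsum (K : numFieldType) (V : normedModType K) (T I : Type)
    (F : set_system T) {FF : Filter F} (r : seq I) (f : I -> T -> V) (l : I -> V) :
  (forall i, f i @ F --> l i) ->
  (fun x => \sum_(i <- r) f i x) @ F --> \sum_(i <- r) l i.
Proof.
move=> fl; elim: r => [|i r IHr].
  by under eq_fun do rewrite big_nil; rewrite big_nil; exact: cvg_cst.
by under eq_fun do rewrite big_cons; rewrite big_cons; exact: cvgD.
Qed.

Section CliffordCoordinates.
Context {R : realType} {m : nat}.
Local Notation Cl := (clifford R m).
Implicit Types (a b : Cl) (S T : {set 'I_m}) (u : 'rV[R]_m).

Lemma cl_coord_le a S : `|a S| <= `|a|.
Proof.
rewrite -[leRHS]/(clnorm a) /clnorm -sqrtr_sqr ler_wsqrtr //.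
rewrite (bigD1 S) //= lerDl; apply: sumr_ge0 => T _; exact: sqr_ge0.
Qed.

Lemma cvg_cliffordP (T : Type) (F : set_system T) {FF : Filter F} (f : T -> Cl)
    (l : Cl) :
  f @ F --> l <-> forall S, (fun x => f x S) @ F --> l S.
Proof.
split => [fl S|fl].
  apply/cvgrPdist_lt => e e0; move/cvgrPdist_lt: fl => /(_ e e0).
  apply: filterS => x; apply: le_lt_trans.
  by have := cl_coord_le (l - f x) S; rewrite !ffunE.
have -> : f = fun x => \sum_S f x S *: clbase S :> Cl.
  by apply/funext => x; exact: clifford_expand.
rewrite [l]clifford_expand; apply: cvg_bigsum => S.
by apply: cvgZl; exact: fl.
Qed.

Lemma cvg_cl_coord (T : Type) (F : set_system T) {FF : Filter F} (f : T -> Cl)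
    (l : Cl) S :
  f @ F --> l -> (fun x => f x S) @ F --> l S.
Proof. by move=> /cvg_cliffordP; apply. Qed.

Lemma continuous_cliffordP (T : topologicalType) (f : T -> Cl) (x : T) :
  {for x, continuous f} <-> forall S, {for x, continuous (fun y => f y S)}.
Proof. exact: cvg_cliffordP. Qed.

Lemma is_derive_cliffordP (V : normedModType R) (f : V -> Cl) (x v : V) (df : Cl) :
  is_derive x v f df <-> forall S, is_derive x v (fun y => f y S) (df S).
Proof.
have quotE S : (fun h => (h^-1 *: ((f \o shift x) (h *: v) - f x)) S) =
    (fun h => h^-1 *: (((fun y => f y S) \o shift x) (h *: v) - f x S)).
  by apply/funext => h; rewrite !ffunE.
split => [[cf fE] S|dS].
  have c : (fun h => h^-1 *: ((f \o shift x) (h *: v) - f x)) @ 0^' --> df.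
    by rewrite -fE; exact: cf.
  have cS : (fun h => h^-1 *: (((fun y => f y S) \o shift x) (h *: v) - f x S)) @ 0^'
      --> df S by rewrite -quotE; exact: cvg_cl_coord c.
  split; first by apply/cvg_ex; exists (df S).
  by apply/cvg_lim => //; exact: cS.
have c : (fun h => h^-1 *: ((f \o shift x) (h *: v) - f x)) @ 0^' --> df.
  apply/cvg_cliffordP => S; rewrite quotE.
  by have [cS <-] := dS S; exact: cS.
split; [by apply/cvg_ex; exists df|rewrite /derive].
by apply/cvg_lim => //; exact: c.
Qed.

Lemma series_coord (v : nat -> Cl) S :
  (fun n => series v n S) = series (fun k => v k S).
Proof. by apply/funext => n; rewrite /series /= sum_ffunE. Qed.

Lemma cvg_series_cliffordP (v : nat -> Cl) (l : Cl) :
  series v @ \oo --> l <-> forall S, series (fun k => v k S) @ \oo --> l S.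
Proof.
rewrite cvg_cliffordP; split => h S; have := h S; by rewrite series_coord.
Qed.

(** The sign with which left multiplication by e_j carries the basis element of {j} + S (symmetric
    difference) to that of S. *)
Definition gensign (j : 'I_m) S : R := clsign [set j]%SET (symdiff [set j]%SET S).

Lemma gensign_sqr j S : gensign j S * gensign j S = 1.
Proof.
rewrite /gensign /clsign big_set1 -big_split /= big1 // => i _.
by rewrite mulrNN mulr1.
Qed.

Lemma clgen_coord (j : 'I_m) a S :
  (clgen j * a) S = gensign j S * a (symdiff [set j]%SET S).
Proof.
rewrite -[clgen j * a]/(clmul (clgen j) a) ffunE (bigD1 [set j]%SET) //=.
rewrite big1 => [|T neqT]; last by rewrite ffunE (negbTE neqT) mul0r mulr0.
by rewrite ffunE eqxx mul1r addr0.
Qed.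

Lemma clvec_coord u a S :
  (clvec u * a) S = \sum_j u ord0 j * (gensign j S * a (symdiff [set j]%SET S)).
Proof.
rewrite /clvec mulr_suml sum_ffunE; apply: eq_bigr => j _.
by rewrite -scalerAl ffunE clgen_coord.
Qed.

Definition sqnorm u : R := \sum_j u ord0 j ^+ 2.

Lemma sqnorm_ge0 u : 0 <= sqnorm u.
Proof. by apply: sumr_ge0 => j _; exact: sqr_ge0. Qed.

Lemma eucl_norm_sqr u : eucl_norm u ^+ 2 = sqnorm u.
Proof. by rewrite sqr_sqrtr // sqnorm_ge0. Qed.

Lemma clvec_even u k : clvec u ^+ (2 * k) = ((- 1) ^+ k * sqnorm u ^+ k)%:A.
Proof.
rewrite exprM clvec_sqr eucl_norm_sqr -exprMn mulN1r.
elim: k => [|k IHk]; first by rewrite !expr0 scale1r.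
by rewrite !exprS IHk -scalerAl mul1r scalerA.
Qed.

Lemma clvec_even_mul u k a :
  clvec u ^+ (2 * k) * a = ((- 1) ^+ k * sqnorm u ^+ k) *: a.
Proof. by rewrite clvec_even -scalerAl mul1r. Qed.

Lemma clvec_odd_mul u k a :
  clvec u ^+ (2 * k).+1 * a = ((- 1) ^+ k * sqnorm u ^+ k) *: (clvec u * a).
Proof. by rewrite exprSr -mulrA clvec_even_mul. Qed.

Lemma cvg_clvec_mul (T : Type) (F : set_system T) {FF : Filter F} u
    (f : T -> Cl) (l : Cl) :
  f @ F --> l -> (fun x => clvec u * f x) @ F --> clvec u * l.
Proof.
move=> fl; apply/cvg_cliffordP => S; rewrite clvec_coord.
under eq_fun do rewrite clvec_coord.
apply: cvg_bigsum => j; apply: cvgMr; apply: cvgMr; exact: cvg_cl_coord.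
Qed.

(** The coordinates are differentiable on all of the open set, so the induction hypothesis holds
    near [t] and can itself be differentiated. *)
Lemma derive1n_coord (U : set R) (g : R -> Cl) :
  open U ->
  (forall S n t, U t -> derivable (derive1n n (fun t => g t S)) t 1) ->
  forall n t S, U t -> derive1n n g t S = derive1n n (fun t => g t S) t.
Proof.
move=> oU dU; elim=> [//|n IHn] t S Ut.
rewrite !derive1nS !derive1E.
pose h t : Cl := [ffun S => derive1n n (fun t => g t S) t].
have gh : \forall z \near t, derive1n n g z = h z.
  apply: filterS (open_nbhs_nbhs (conj oU Ut)) => z Uz.
  by apply/ffunP => T; rewrite ffunE IHn.
rewrite (near_eq_derive _ gh).
have dh : is_derive t 1 h [ffun S => 'D_1 (derive1n n (fun t => g t S)) t].
  apply/is_derive_cliffordP => T; rewrite ffunE.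
  rewrite (_ : (fun y => h y T) = derive1n n (fun t => g t T)).
    by apply: derivableP; exact: dU.
  by apply/funext => z; rewrite ffunE.
by rewrite derive_val ffunE.
Qed.

End CliffordCoordinates.

(** * Partial derivatives and axial power series *)

Section DirectionalDerivatives.
Variable R : realType.

Lemma is_derive_lineP (V W : normedModType R) (f : V -> W) (x v : V) (df : W) :
  is_derive x v f df <-> is_derive (0 : R) 1 (fun h => f (h *: v + x)) df.
Proof.
have E : (fun h : R => h^-1 *: ((f \o shift x) (h *: v) - f x)) =
    (fun h : R => h^-1 *: (((fun h => f (h *: v + x)) \o shift 0) (h *: (1 : R)) -
      f (0 *: v + x))).
  apply/funext => h /=; rewrite scale0r add0r addr0.
  by rewrite [h *: (1 : R)]mulr1.
by split => -[cf fE]; split; rewrite /derivable /derive ?E // -?E.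
Qed.

Variable m : nat.
Local Notation X := 'rV[R]_m.+1.
Implicit Types (x : X) (i : 'I_m.+1) (j : 'I_m) (Om : set X) (f : X -> R).

Lemma is_derive_coord (k i : 'I_m.+1) x :
  is_derive x (delta_mx 0 i) (fun y : X => y ord0 k) (k == i)%:R.
Proof.
apply/is_derive_lineP.
have -> : (fun h : R => (h *: delta_mx 0 i + x) ord0 k) =
    (fun h => (k == i)%:R * h + x ord0 k).
  by apply/funext => h; rewrite !mxE eqxx /= mulrC.
have d : is_derive (0 : R) 1 (fun h : R => (k == i)%:R * h) (k == i)%:R.
  apply: is_derive_eq (is_deriveZ (k == i)%:R (is_derive_id (0 : R) 1)) _.
  by rewrite /GRing.scale /= mulr1.
by have := is_deriveD d (is_derive_cst (x ord0 k) (0 : R) (1 : R)); rewrite addr0.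
Qed.

Definition sqvec x : R := \sum_j x ord0 (lift ord0 j) ^+ 2.

Lemma sqvec_ge0 x : 0 <= sqvec x.
Proof. by apply: sumr_ge0 => j _; exact: sqr_ge0. Qed.

Lemma norm_sqvec x : `|sqvec x| = sqvec x.
Proof. by rewrite ger0_norm ?sqvec_ge0. Qed.

Lemma continuous_coord k : continuous (fun y : X => y ord0 k).
Proof. by move=> x; exact: coord_continuous. Qed.

Lemma continuous_sqvec : continuous sqvec.
Proof.
move=> x; apply: (@cvg_bigsum _ _ _ _ (nbhs x)) => j.
exact: (cvg_comp _ _ (@continuous_coord (lift ord0 j) x) (@exprn_continuous _ 2 _)).
Qed.

Lemma sqvec_line0 x (h : R) : sqvec (h *: delta_mx 0 ord0 + x) = sqvec x.
Proof.
by apply: eq_bigr => j _; rewrite !mxE /= mulr0 add0r.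
Qed.

Lemma sqvec_line x j (h : R) : sqvec (h *: delta_mx 0 (lift ord0 j) + x) =
  sqvec x + (2 * x ord0 (lift ord0 j) * h + h ^+ 2).
Proof.
rewrite /sqvec (bigD1 j) //= [in RHS](bigD1 j) //= !mxE !eqxx /= mulr1.
rewrite (eq_bigr (fun k => x ord0 (lift ord0 k) ^+ 2)) => [|k kj]; first ring.
by rewrite !mxE (inj_eq lift_inj) (negbTE kj) mulr0 add0r.
Qed.

Lemma repart_line0 x (h : R) :
  (h *: delta_mx 0 ord0 + x) ord0 ord0 = x ord0 ord0 + h.
Proof. by rewrite !mxE /= mulr1 addrC. Qed.

Lemma repart_line x j (h : R) :
  (h *: delta_mx 0 (lift ord0 j) + x) ord0 ord0 = x ord0 ord0.
Proof. by rewrite !mxE /= mulr0 add0r. Qed.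

Definition pderiv Om i f (f' : X -> R) : Prop :=
  forall x, Om x -> is_derive x (delta_mx 0 i) f (f' x).

(** C^n with explicit partial derivatives, constrained only on [Om]; exhibiting them makes closure
    under sums and products a plain induction. *)
Fixpoint smooth (n : nat) Om f : Prop :=
  (forall x, Om x -> {for x, continuous f}) /\
  (if n is n'.+1 then
    exists f' : 'I_m.+1 -> X -> R, forall i, pderiv Om i f (f' i) /\ smooth n' Om (f' i)
  else True).

Lemma smooth_continuous n Om f x : smooth n Om f -> Om x -> {for x, continuous f}.
Proof. by case: n => [|n] [cf _]; exact: cf. Qed.

Lemma smoothW n Om f : smooth n.+1 Om f -> smooth n Om f.
Proof.
elim: n f => [|n IHn] f [cf [f' f'P]]; first by [].
by split => //; exists f' => i; have [df sf] := f'P i; split => //; exact: IHn.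
Qed.

Lemma smooth_cst n Om (c : R) : smooth n Om (fun=> c).
Proof.
have cc (d : R) x : Om x -> {for x, continuous (fun _ : X => d)}.
  by move=> _; exact: cst_continuous.
elim: n c => [|n IHn] c; split => //; try exact: cc.
exists (fun i => fun=> 0) => i; split => // x _; exact: is_derive_cst.
Qed.

Lemma smooth_coord n Om k : smooth n Om (fun x => x ord0 k).
Proof.
have cc x : Om x -> {for x, continuous (fun y : X => y ord0 k)}.
  by move=> _; exact: continuous_coord.
case: n => [|n]; split => //.
exists (fun i => fun=> (k == i)%:R) => i; split; last exact: smooth_cst.
by move=> x _; exact: is_derive_coord.
Qed.

Lemma smoothD n Om f g :
  smooth n Om f -> smooth n Om g -> smooth n Om (fun x => f x + g x).
Proof.
elim: n f g => [|n IHn] f g [cf df] [cg dg].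
  by split => // x Ox; exact: continuousD (cf x Ox) (cg x Ox).
split; first by move=> x Ox; exact: continuousD (cf x Ox) (cg x Ox).
have [f' f'P] := df; have [g' g'P] := dg.
exists (fun i x => f' i x + g' i x) => i.
have [df' sf'] := f'P i; have [dg' sg'] := g'P i; split; last exact: IHn.
by move=> x Ox; exact: is_deriveD (df' x Ox) (dg' x Ox).
Qed.

Lemma smoothM n Om f g :
  smooth n Om f -> smooth n Om g -> smooth n Om (fun x => f x * g x).
Proof.
have cM k (u v : X -> R) x : smooth k Om u -> smooth k Om v -> Om x ->
    {for x, continuous (fun x => u x * v x)}.
  move=> sf sg Ox.
  exact: continuousM (smooth_continuous sf Ox) (smooth_continuous sg Ox).
elim: n f g => [|n IHn] f g sf sg; first by split => // x; exact: cM sf sg.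
split; first by move=> x; exact: cM sf sg.
have [_ [f' f'P]] := sf; have [_ [g' g'P]] := sg.
exists (fun i x => f x * g' i x + g x * f' i x) => i.
have [df' sf'] := f'P i; have [dg' sg'] := g'P i; split.
  by move=> x Ox; exact: is_deriveM (df' x Ox) (dg' x Ox).
by apply: smoothD; apply: IHn => //; exact: smoothW.
Qed.

Lemma smooth_sum n Om (I : Type) (r : seq I) (f : I -> X -> R) :
  (forall k, smooth n Om (f k)) -> smooth n Om (fun x => \sum_(k <- r) f k x).
Proof.
move=> sf; elim: r => [|k r IHr].
  by under eq_fun do rewrite big_nil; exact: smooth_cst.
by under eq_fun do rewrite big_cons; exact: smoothD.
Qed.

Lemma smooth_eq n Om f g : open Om -> (forall x, Om x -> f x = g x) ->
  smooth n Om f -> smooth n Om g.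
Proof.
move=> oO fg sf.
have nfg x : Om x -> \forall y \near x, f y = g y.
  by move=> Ox; apply: filterS (open_nbhs_nbhs (conj oO Ox)).
have cg x : Om x -> {for x, continuous g}.
  move=> Ox; rewrite /prop_for /continuous_at -fg //.
  apply: cvg_trans (smooth_continuous sf Ox).
  by apply: (@near_eq_cvg _ _ (nbhs x)); apply: filterS (nfg x Ox) => y ->.
case: n sf => [|n] sf; split => //; have [_ [f' f'P]] := sf.
exists f' => i; have [df' sf'] := f'P i; split => // x Ox.
exact: near_eq_is_derive (nfg x Ox) (df' x Ox).
Qed.

End DirectionalDerivatives.

(** * Radial Laplacian and axial power series *)

Section RadialSeries.
Variable R : realType.

Lemma psum_lin (c d : nat -> R) (a b s q M N : R) :
  coef_bounded c q M -> coef_bounded d q N -> `|s| < q ->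
  psum (fun k => a * c k + b * d k) s = a * psum c s + b * psum d s.
Proof.
move=> cM dN sq; apply/cvg_lim => //.
have -> : pseries (fun k => a * c k + b * d k) s =
    fun n => a * pseries c s n + b * pseries d s n.
  apply/funext => n; rewrite /pseries /series /= !mulr_sumr -big_split /=.
  by apply: eq_bigr => i _; ring.
by apply: cvgD; apply: cvgMr; [exact: is_cvg_pseries cM sq|exact: is_cvg_pseries dN sq].
Qed.

(* The Laplacian in [p] variables of [|u|^(2k+2)] is [2(k+1)(p+2k) |u|^(2k)]. *)
Definition radial_diffs (p : nat) (c : nat -> R) (k : nat) : R :=
  2 * k.+1%:R * (p + 2 * k)%:R * c k.+1.

(** The identity Delta phi(|u|^2) = 2 p phi' + 4 |u|^2 phi'' in p variables, read on
    coefficients. *)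
Lemma psum_radial_diffs p (c : nat -> R) (s q M : R) :
  coef_bounded c q M -> `|s| < q ->
  psum (radial_diffs p c) s = 2 * p%:R * psum (pseries_diffs c) s +
    4 * (s * psum (pseries_diffs (pseries_diffs c)) s).
Proof.
move=> cM sq.
pose q1 := (`|s| + q) / 2; pose q2 := (`|s| + q1) / 2.
have s0 := normr_ge0 s.
have q1q : 0 < q1 < q by rewrite /q1; apply/andP; split; lra.
have q2q1 : 0 < q2 < q1 by rewrite /q2 /q1; apply/andP; split; lra.
have sq2 : `|s| < q2 by rewrite /q2 /q1; lra.
have sq1 : `|s| < q1 by rewrite /q1; lra.
have d1 := coef_bounded_diffs q1q cM.
have d2 := coef_bounded_diffs q2q1 d1.
(* The coefficients of s phi''(s): multiplication by s shifts the index by one and leaves a zero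
   constant term. *)
pose e k := k%:R * pseries_diffs c k.
set M2 := (X in coef_bounded _ q2 X) in d2.
have d1' : coef_bounded (pseries_diffs c) q2 (M / q / (1 - q1 / q)).
  by case/andP: q2q1 => *; apply: coef_bounded_radius_le d1; exact: ltW.
have eM : coef_bounded e q2 (M2 * q2).
  have /andP[q20 _] := q2q1.
  have M20 : 0 <= M2 := coef_bounded_ge0 d2.
  case=> [|k]; first by rewrite /e mul0r normr0 mul0r mulr_ge0 // ltW.
  by rewrite exprSr mulrA ler_wpM2r ?(ltW q20) //; exact: d2.
have -> : s * psum (pseries_diffs (pseries_diffs c)) s = psum e s.
  by rewrite (psum_split eM sq2) /e mul0r add0r.
rewrite -(psum_lin _ _ d1' eM sq2); congr psum; apply/funext => k.
by rewrite /radial_diffs /e /pseries_diffs natrD natrM; ring.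
Qed.

End RadialSeries.

Lemma is_derive_congr (R : realType) (V W : normedModType R) (f g : V -> W)
    (x v : V) (df dg : W) :
  is_derive x v f df -> f =1 g -> df = dg -> is_derive x v g dg.
Proof. by move=> d /funext <- <-. Qed.

Section AxialSeries.
Variables (R : realType) (m : nat).
Local Notation X := 'rV[R]_m.+1.
Implicit Types (x : X) (i : 'I_m.+1) (j : 'I_m) (Om : set X) (f g : X -> R).
Implicit Type C : R -> nat -> R.

Definition axial_sum C x : R := psum (C (x ord0 ord0)) (sqvec x).

Definition axial_bounded Om C : Prop := forall x, Om x ->
  exists q M : R, sqvec x < q /\ coef_bounded (C (x ord0 ord0)) q M.

Lemma axial_bounded_diffs Om C :
  axial_bounded Om C -> axial_bounded Om (fun t => pseries_diffs (C t)).
Proof.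
move=> CM x Ox; have [q [M [xq cM]]] := CM x Ox.
have s0 := sqvec_ge0 x; pose p := (sqvec x + q) / 2.
have pq : 0 < p < q by rewrite /p; apply/andP; split; lra.
exists p, (M / q / (1 - p / q)); split; first by rewrite /p; lra.
exact: coef_bounded_diffs.
Qed.

Lemma pderiv_axial_sum_vec Om C j : axial_bounded Om C ->
  pderiv Om (lift ord0 j) (axial_sum C)
    (fun x => 2 * x ord0 (lift ord0 j) * axial_sum (fun t => pseries_diffs (C t)) x).
Proof.
move=> CM x Ox; apply/is_derive_lineP.
rewrite /axial_sum; under eq_fun do rewrite repart_line sqvec_line.
have [q [M [xq cM]]] := CM x Ox.
pose s (h : R) := sqvec x + (2 * x ord0 (lift ord0 j) * h + h ^+ 2).
have s0 : s 0 = sqvec x by rewrite /s mulr0 expr0n /= !addr0.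
have ds : is_derive (0 : R) 1 s (2 * x ord0 (lift ord0 j)).
  have d1 : is_derive (0 : R) 1 (fun h : R => 2 * x ord0 (lift ord0 j) * h)
      (2 * x ord0 (lift ord0 j)).
    apply: is_derive_eq (is_deriveZ _ (is_derive_id (0 : R) 1)) _.
    by rewrite /GRing.scale /= mulr1.
  have d2 : is_derive (0 : R) 1 (fun h : R => h ^+ 2) 0.
    apply: is_derive_eq (is_deriveM (is_derive_id (0 : R) 1) (is_derive_id (0 : R) 1)) _.
    by rewrite scale0r addr0.
  have := is_deriveD (is_derive_cst (sqvec x) (0 : R) 1) (is_deriveD d1 d2).
  by rewrite add0r addr0.
have dp : is_derive (s 0) 1 (psum (C (x ord0 ord0)))
    (psum (pseries_diffs (C (x ord0 ord0))) (sqvec x)).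
  by rewrite s0; apply: (psum_is_derive cM); rewrite norm_sqvec.
by apply: is_derive_eq (is_derive1_comp dp ds) _; rewrite mulrC.
Qed.

(** [C l] stands for the l-th x_0-derivative of the coefficients. Each order has its own radius
    beyond |x|^2, with a bound uniform in nearby t, which is what termwise differentiation in x_0
    requires. *)
Definition axial_jet Om (C : nat -> R -> nat -> R) : Prop :=
  forall l x, Om x -> exists q M r : R, [/\ 0 < r, sqvec x < q &
    forall t, `|t - x ord0 ord0| < r -> coef_bounded (C l t) q M /\
      forall k, is_derive t 1 (fun t => C l t k) (C l.+1 t k)].

Lemma axial_jet_bounded Om (C : nat -> R -> nat -> R) l :
  axial_jet Om C -> axial_bounded Om (C l).
Proof.
move=> jC x Ox; have [q [M [r [r0 xq h]]]] := jC l x Ox.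
by exists q, M; split => //; apply: (proj1 (h _ _)); rewrite subrr normr0.
Qed.

Lemma axial_jet_diffs Om (C : nat -> R -> nat -> R) :
  axial_jet Om C -> axial_jet Om (fun l t => pseries_diffs (C l t)).
Proof.
move=> jC l x Ox; have [q [M [r [r0 xq h]]]] := jC l x Ox.
have s0 := sqvec_ge0 x; pose p := (sqvec x + q) / 2.
have pq : 0 < p < q by rewrite /p; apply/andP; split; lra.
exists p, (M / q / (1 - p / q)), r; split => //; first by rewrite /p; lra.
move=> t tr; have [tM dt] := h t tr; split; first exact: coef_bounded_diffs.
by move=> k; exact: is_deriveZ.
Qed.

Lemma pderiv_axial_sum_re Om (C : nat -> R -> nat -> R) l : axial_jet Om C ->
  pderiv Om ord0 (axial_sum (C l)) (axial_sum (C l.+1)).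
Proof.
move=> jC x Ox; apply/is_derive_lineP.
rewrite /axial_sum; under eq_fun do rewrite repart_line0 sqvec_line0.
have [q [M [r [r0 xq h]]]] := jC l x Ox.
have [q' [M' [r' [r'0 xq' h']]]] := jC l.+1 x Ox.
apply: (@is_derive_comp_addl R (fun t => psum (C l t) (sqvec x)) (x ord0 ord0)).
rewrite addr0.
have x0r : `|x ord0 ord0 - x ord0 ord0| < r by rewrite subrr normr0.
have qq : 0 < Num.min q q'.
  by rewrite lt_min !(le_lt_trans (sqvec_ge0 x)).
apply: (@psum_is_derive_coef R (C l) (C l.+1) (Num.min q q') (sqvec x) (Num.min r r')
  M' M (x ord0 ord0)).
- by rewrite lt_min r0.
- by move=> k t; rewrite lt_min => /andP[tr _]; have [_] := h t tr; apply.
- move=> t; rewrite lt_min => /andP[_ tr]; have [tM _] := h' t tr.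
  by apply: coef_bounded_radius_le tM; [exact: ltW|rewrite ge_min lexx orbT].
- have [tM _] := h _ x0r.
  by apply: coef_bounded_radius_le tM; [exact: ltW|rewrite ge_min lexx].
- by rewrite norm_sqvec lt_min xq.
Qed.

(** The class of axial jets is stable under both kinds of partial derivative: x_0 raises [l], and
    x_j differentiates in |x|^2 with an extra factor 2 x_j. Hence the induction runs over all jets
    at once. *)
Lemma smooth_axial_sum n Om (C : nat -> R -> nat -> R) l :
  axial_jet Om C -> smooth n Om (axial_sum (C l)).
Proof.
have cC (D : nat -> R -> nat -> R) k x : axial_jet Om D -> Om x ->
    {for x, continuous (axial_sum (D k))}.
  move=> jD Ox; have [q [M [r [r0 xq h]]]] := jD k x Ox.
  have x0r : `|x ord0 ord0 - x ord0 ord0| < r by rewrite subrr normr0.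
  have -> : axial_sum (D k) = fun y => psum (D k (y ord0 ord0)) (sqvec y) by [].
  refine (@psum_continuous R X (fun y : X => D k (y ord0 ord0)) (@sqvec R m) q M x _ _ _ _).
  - have nb : nbhs x [set y : X | `|y ord0 ord0 - x ord0 ord0| < r].
      exact: (@continuous_coord R m ord0 x _ (near_dist_lt x0r)).
    by apply: filterS nb => y /h[].
  - move=> i; apply: (@continuous_comp _ _ _ (fun y : X => y ord0 ord0) (fun t => D k t i)).
      exact: continuous_coord.
    have [_ /(_ i) d] := h _ x0r.
    by apply: differentiable_continuous; exact/derivable1_diffP.
  - exact: continuous_sqvec.
  - by rewrite norm_sqvec.
elim: n C l => [|n IHn] C l jC; split => //; try by move=> x; exact: cC.
have dj j := pderiv_axial_sum_vec j (axial_jet_bounded l jC).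
exists (fun i => if unlift ord0 i is Some j then
  fun x => 2 * x ord0 (lift ord0 j) * axial_sum (fun t => pseries_diffs (C l t)) x
  else axial_sum (C l.+1)) => i.
case: unliftP => [j ->|->]; last first.
  by split; [exact: pderiv_axial_sum_re|exact: IHn].
split; first exact: dj.
apply: smoothM; first by apply: smoothM; [exact: smooth_cst|exact: smooth_coord].
exact: (IHn (fun l t => pseries_diffs (C l t))) (axial_jet_diffs jC).
Qed.

Definition u_laplacian Om f g : Prop :=
  exists f1 f2 : 'I_m -> X -> R,
    (forall j, pderiv Om (lift ord0 j) f (f1 j) /\
               pderiv Om (lift ord0 j) (f1 j) (f2 j)) /\
    forall x, Om x -> g x = \sum_j f2 j x.

Lemma u_laplacianD Om f1 f2 g1 g2 : u_laplacian Om f1 g1 -> u_laplacian Om f2 g2 ->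
  u_laplacian Om (fun x => f1 x + f2 x) (fun x => g1 x + g2 x).
Proof.
move=> [a1 [b1 [d1 e1]]] [a2 [b2 [d2 e2]]].
exists (fun j x => a1 j x + a2 j x), (fun j x => b1 j x + b2 j x); split.
  move=> j; have [p1 q1] := d1 j; have [p2 q2] := d2 j.
  by split => x Ox; [exact: is_deriveD (p1 x Ox) (p2 x Ox)
                    |exact: is_deriveD (q1 x Ox) (q2 x Ox)].
by move=> x Ox; rewrite e1 // e2 // big_split.
Qed.

Lemma u_laplacianZ Om f g (a : R) : u_laplacian Om f g ->
  u_laplacian Om (fun x => a * f x) (fun x => a * g x).
Proof.
move=> [f1 [f2 [d e]]].
exists (fun j x => a * f1 j x), (fun j x => a * f2 j x); split.
  move=> j; have [p q] := d j.
  by split => x Ox; [have := is_deriveZ a (p x Ox)|have := is_deriveZ a (q x Ox)]; exact.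
by move=> x Ox; rewrite e // mulr_sumr.
Qed.

Lemma u_laplacian_sum Om (I : Type) (r : seq I) (f g : I -> X -> R) :
  (forall k, u_laplacian Om (f k) (g k)) ->
  u_laplacian Om (fun x => \sum_(k <- r) f k x) (fun x => \sum_(k <- r) g k x).
Proof.
move=> fg; elim: r => [|k r IHr].
  under eq_fun do rewrite big_nil.
  under [X in u_laplacian _ _ X]eq_fun do rewrite big_nil.
  exists (fun _ _ => 0), (fun _ _ => 0); split.
    by move=> j; split => x _; exact: is_derive_cst.
  by move=> x _; rewrite big1.
under eq_fun do rewrite big_cons.
under [X in u_laplacian _ _ X]eq_fun do rewrite big_cons.
exact: u_laplacianD.
Qed.

Lemma u_laplacian_axial_sum Om C : axial_bounded Om C ->
  u_laplacian Om (axial_sum C) (axial_sum (fun t => radial_diffs m (C t))).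
Proof.
move=> CM; have dM := axial_bounded_diffs CM.
pose dC t := pseries_diffs (C t); pose ddC t := pseries_diffs (dC t).
exists (fun j x => 2 * x ord0 (lift ord0 j) * axial_sum dC x),
  (fun j x => 2 * axial_sum dC x +
     4 * (x ord0 (lift ord0 j) ^+ 2 * axial_sum ddC x)); split.
  move=> j; split; first exact: pderiv_axial_sum_vec.
  move=> x Ox.
  have d1 := is_deriveZ (2 : R) (is_derive_coord (lift ord0 j) (lift ord0 j) x).
  apply: (is_derive_congr (is_deriveM d1 (pderiv_axial_sum_vec j dM Ox))) => //.
  by rewrite eqxx /= /ddC /dC /GRing.scale /=; ring.
move=> x Ox; have [q [M [xq cM]]] := CM x Ox.
rewrite /axial_sum (psum_radial_diffs _ cM) ?norm_sqvec // big_split /=.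
rewrite sumr_const card_ord -mulr_sumr -mulr_suml -/(sqvec x).
by rewrite -mulr_natr /dC; ring.
Qed.

(** Besides x_i times the radial Laplacian, the product rule leaves twice the cross term 2 x_i phi',
    which raises the dimension from m to m + 2. *)
Lemma u_laplacian_coord_axial_sum Om C (i : 'I_m) : axial_bounded Om C ->
  u_laplacian Om (fun x => x ord0 (lift ord0 i) * axial_sum C x)
    (fun x => x ord0 (lift ord0 i) * axial_sum (fun t => radial_diffs m.+2 (C t)) x).
Proof.
move=> CM; have dM := axial_bounded_diffs CM.
pose dC t := pseries_diffs (C t); pose ddC t := pseries_diffs (dC t).
pose y j x : R := x ord0 (lift ord0 j).
pose dl j : R := (i == j)%:R.
exists (fun j x => y i x * (2 * y j x * axial_sum dC x) + axial_sum C x * dl j),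
  (fun j x => (y i x * (2 * axial_sum dC x + 4 * (y j x ^+ 2 * axial_sum ddC x)) +
      dl j * (2 * y j x * axial_sum dC x)) + dl j * (2 * y j x * axial_sum dC x)); split.
  move=> j.
  have dy x : is_derive x (delta_mx 0 (lift ord0 j)) (y i) (dl j).
    have := is_derive_coord (lift ord0 i) (lift ord0 j) x.
    by rewrite (inj_eq lift_inj).
  split=> x Ox.
    exact: is_deriveM (dy x) (pderiv_axial_sum_vec j CM Ox).
  have d1 := is_deriveZ (2 : R) (is_derive_coord (lift ord0 j) (lift ord0 j) x).
  have d2 : is_derive x (delta_mx 0 (lift ord0 j))
      (fun x => 2 * y j x * axial_sum dC x)
      (2 * axial_sum dC x + 4 * (y j x ^+ 2 * axial_sum ddC x)).
    apply: (is_derive_congr (is_deriveM d1 (pderiv_axial_sum_vec j dM Ox))) => //.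
    by rewrite eqxx /= /ddC /dC /GRing.scale /= -/(y j x); ring.
  have d3 := is_deriveM (dy x) d2.
  have d4 := is_deriveZ (dl j) (pderiv_axial_sum_vec j CM Ox).
  have d4' : is_derive x (delta_mx 0 (lift ord0 j)) (fun x => axial_sum C x * dl j)
      (dl j * (2 * y j x * axial_sum dC x)).
    by under eq_fun do rewrite mulrC.
  apply: (is_derive_congr (is_deriveD d3 d4')) => //.
  by rewrite /ddC /dC /GRing.scale /=; ring.
move=> x Ox; have [q [M [xq cM]]] := CM x Ox.
have sdl : \sum_j dl j * (2 * y j x * axial_sum dC x) = 2 * y i x * axial_sum dC x.
  rewrite (bigD1 i) //= /dl eqxx mul1r big1 ?addr0 // => j ji.
  by rewrite eq_sym (negbTE ji) mul0r.
rewrite !big_split /= sdl -mulr_sumr big_split /= sumr_const card_ord -mulr_sumr.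
rewrite -mulr_suml -/(sqvec x) -mulr_natr.
rewrite /axial_sum (psum_radial_diffs _ cM) ?norm_sqvec //.
by rewrite -addn2 natrD /dC /axial_sum -/(y i x); ring.
Qed.

End AxialSeries.

(** * Harmonic series in the Clifford algebra *)

Lemma cvg_series_parity (R : realType) (V : normedModType R) (v : nat -> V) (a b : V) :
  series (fun k => v (2 * k)%N) @ \oo --> a ->
  series (fun k => v (2 * k).+1) @ \oo --> b ->
  series v @ \oo --> a + b.
Proof.
move=> va vb.
have E n : series v n = series (fun k => v (2 * k)%N) (uphalf n) +
    series (fun k => v (2 * k).+1) n./2.
  elim: n => [|n IHn]; first by rewrite /series /= !big_geq // addr0.
  rewrite seriesSr IHn -[uphalf n.+1]/(n./2.+1) -[n.+1./2]/(uphalf n) uphalf_half.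
  have := odd_double_half n; case: (odd n) => nE.
    rewrite add1n -addrA; congr (_ + _); rewrite seriesSr; congr (_ + v _).
    by rewrite mul2n -add1n.
  rewrite add0n [in RHS]seriesSr addrAC; congr (_ + v _ + _).
  by rewrite mul2n -[LHS]nE.
rewrite (funext E); apply: cvgD.
  apply: (cvg_comp uphalf _ _ va).
  apply/cvgnyPge => N; near=> n.
  have : (N.*2 <= n)%N by near: n; exact: nbhs_infty_ge.
  by rewrite geq_uphalf_double; exact: leqW.
apply: (cvg_comp half _ _ vb).
apply/cvgnyPge => N; near=> n.
have : (N.*2 <= n)%N by near: n; exact: nbhs_infty_ge.
by rewrite geq_half_double.
Unshelve. all: by end_near. Qed.

Section AxialCliffordSeries.
Variables (R : realType) (m : nat).
Local Notation X := 'rV[R]_m.+1.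
Local Notation Cl := (clifford R m).
Implicit Types (B : nat -> R -> Cl) (S : {set 'I_m}) (x : X) (Om : set X) (t : R).

(** The sign is that of x^(2k) = (-1)^k |x|^(2k), so that the series variable is |x|^2. *)
Definition even_coef B S t (k : nat) : R := (- 1) ^+ k * B (2 * k)%N t S.
Definition odd_coef B S t (k : nat) : R := (- 1) ^+ k * B (2 * k).+1 t S.

Definition even_sum B x : Cl := [ffun S => axial_sum (even_coef B S) x].
Definition odd_sum B x : Cl := [ffun S => axial_sum (odd_coef B S) x].
Definition clifford_sum B x : Cl := even_sum B x + clvec (vecpart x) * odd_sum B x.

Lemma sqnorm_vecpart x : sqnorm (vecpart x) = sqvec x.
Proof. by apply: eq_bigr => j _; rewrite mxE. Qed.

Lemma clifford_sum_coord B x S : clifford_sum B x S = axial_sum (even_coef B S) x +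
  \sum_j gensign j S * (x ord0 (lift ord0 j) *
    axial_sum (odd_coef B (symdiff [set j]%SET S)) x).
Proof.
rewrite /clifford_sum ffunE [X in X + _]ffunE clvec_coord; congr (_ + _).
by apply: eq_bigr => j _; rewrite !ffunE mxE mulrCA.
Qed.

Definition axial_sequence_bounded B Om : Prop := forall S,
  axial_bounded Om (even_coef B S) /\ axial_bounded Om (odd_coef B S).

Lemma cvg_even_sum B Om x : axial_sequence_bounded B Om -> Om x ->
  series (fun k => clvec (vecpart x) ^+ (2 * k) * B (2 * k)%N (repart x)) @ \oo -->
    even_sum B x.
Proof.
move=> bB Ox; apply/cvg_series_cliffordP => S.
have [/(_ x Ox) [q [M [xq bM]]] _] := bB S.
rewrite ffunE -norm_sqvec in xq *; have := is_cvg_pseries bM xq.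
rewrite norm_sqvec in xq *; move=> c; apply: cvg_trans c; apply: near_eq_cvg.
apply: nearW => n; rewrite /pseries /series /=; apply: eq_bigr => k _.
by rewrite clvec_even_mul sqnorm_vecpart ffunE /even_coef /GRing.scale /=; ring.
Qed.

Lemma cvg_odd_sum B Om x : axial_sequence_bounded B Om -> Om x ->
  series (fun k => ((- 1) ^+ k * sqvec x ^+ k) *: B (2 * k).+1 (repart x)) @ \oo -->
    odd_sum B x.
Proof.
move=> bB Ox; apply/cvg_series_cliffordP => S.
have [_ /(_ x Ox) [q [M [xq bM]]]] := bB S.
rewrite ffunE; have := @is_cvg_pseries _ _ _ (sqvec x) _ bM.
rewrite norm_sqvec => /(_ xq) c; apply: cvg_trans c; apply: near_eq_cvg.
apply: nearW => n; rewrite /pseries /series /=; apply: eq_bigr => k _.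
by rewrite ffunE /odd_coef /GRing.scale /=; ring.
Qed.

Lemma cvg_clifford_sum B Om x : axial_sequence_bounded B Om -> Om x ->
  series (fun j => clvec (vecpart x) ^+ j * B j (repart x)) @ \oo --> clifford_sum B x.
Proof.
move=> bB Ox; apply: cvg_series_parity; first exact: cvg_even_sum bB Ox.
suff -> : series (fun k => clvec (vecpart x) ^+ (2 * k).+1 * B (2 * k).+1 (repart x)) =
    fun n => clvec (vecpart x) *
      series (fun k => ((- 1) ^+ k * sqvec x ^+ k) *: B (2 * k).+1 (repart x)) n.
  exact: cvg_clvec_mul (cvg_odd_sum bB Ox).
apply/funext => n; rewrite /series /= mulr_sumr; apply: eq_bigr => k _.
by rewrite clvec_odd_mul sqnorm_vecpart scalerAr.
Qed.

(* An odd term is multiplied by the vector once more, which turns it into an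
   even one up to the factor [- |u|^2]. *)
Lemma cvg_clifford_bounded B x : 0 < sqvec x ->
  cvgn (series (fun j => clvec (vecpart x) ^+ j * B j (repart x))) ->
  exists M, forall S, coef_bounded (even_coef B S (repart x)) (sqvec x) M /\
    coef_bounded (odd_coef B S (repart x)) (sqvec x) M.
Proof.
move=> x0 /cvg_ex [l cl].
set v := (fun j => _) in cl.
have vS S : exists M, forall j, `|v j S| <= M.
  have /cvg_series_cliffordP /(_ S) c := cl.
  have /cvg_series_bounded [M [_ hM]] : cvgn (series (fun k => v k S)).
    by apply/cvg_ex; exists (l S).
  by exists (M + 1) => j; exact: (hM (M + 1) (ltr_pwDr ltr01 (lexx _)) j I).
have [MS hMS] := choice vS.
pose M := \sum_S MS S.
have MS0 S : 0 <= MS S := le_trans (normr_ge0 _) (hMS S 0%N).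
have vM j S : `|v j S| <= M.
  apply: le_trans (hMS S j) _; rewrite /M (bigD1 S) //= lerDl.
  by apply: sumr_ge0 => T _.
have M0 : 0 <= M by apply: sumr_ge0.
have sgn (k : nat) : `|(- 1) ^+ k : R| = 1 by rewrite normrX normrN1 expr1n.
pose N := \sum_j `|vecpart x ord0 j|.
have N0 : 0 <= N by apply: sumr_ge0.
(* [M] serves the even coefficients. For the odd ones, [N] bounds the multiplication by the vector,
   and the division removes the surplus factor |x|^2. *)
exists (M + N * M / sqvec x) => S; split => k.
  have := vM (2 * k)%N S; rewrite /v clvec_even_mul sqnorm_vecpart ffunE => h.
  have {h} : `|even_coef B S (repart x) k| * sqvec x ^+ k <= M.
    apply: le_trans h; rewrite /even_coef /GRing.scale /= !normrM sgn !mul1r mulrC.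
    by rewrite normrX norm_sqvec.
  by move=> /le_trans; apply; rewrite lerDl !mulr_ge0 ?invr_ge0 // ltW.
have h : `|(clvec (vecpart x) * v (2 * k).+1) S| <= N * M.
  rewrite clvec_coord; apply: le_trans (ler_norm_sum _ _ _) _.
  rewrite /N mulr_suml; apply: ler_sum => j _; rewrite normrM ler_wpM2l //.
  rewrite normrM /gensign /clsign big_set1 normr_prod big1; last first.
    by move=> i _; rewrite normrN1.
  by rewrite mul1r.
have {h} : `|odd_coef B S (repart x) k| * sqvec x ^+ k.+1 <= N * M.
  apply: le_trans h; rewrite /v mulrA -exprS.
  have -> : (2 * k).+2 = (2 * k.+1)%N by rewrite mulnS.
  rewrite clvec_even_mul sqnorm_vecpart ffunE /odd_coef /GRing.scale /=.
  by rewrite !normrM !sgn !mul1r mulrC normrX norm_sqvec.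
rewrite exprSr mulrA -ler_pdivlMr // => /le_trans; apply.
by rewrite lerDr.
Qed.

(* Convergence at a point says nothing about the even and odd subseries there,
   but bounded terms at a point with a larger vector part make both of them
   converge absolutely. *)
Lemma exists_larger_vecpart Om x : (1 <= m)%N -> open Om -> Om x ->
  exists y, [/\ Om y, repart y = repart x & sqvec x < sqvec y].
Proof.
case: m x Om => [//|n] x Om _ oO Ox.
pose e := delta_mx 0 (lift ord0 ord0) : 'rV[R]_n.+2.
have c : (fun h : R => h *: e + x) @ (0 : R) --> 0 *: e + x.
  by apply: cvgD; [apply: cvgZl; exact: cvg_id|exact: cvg_cst].
have Ox' : nbhs (0 *: e + x) Om.
  by rewrite scale0r add0r; exact: open_nbhs_nbhs.
have /nbhs_ballP [d /= d0 dO] := c _ Ox'.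
(* The sign moves the first vector coordinate away from 0, so |x|^2 grows. *)
pose h := if 0 <= x ord0 (lift ord0 ord0) then d / 2 else - (d / 2).
exists (h *: e + x); split.
- apply: dO; rewrite /ball /= sub0r normrN /h.
  by case: ifP => _; rewrite ?normrN ger0_norm ?divr_ge0 ?(ltW d0) //; lra.
- by rewrite /repart repart_line.
- rewrite sqvec_line ltrDl /h; case: ifPn => [p|]; last rewrite -ltNge => p.
    by rewrite ltr_wpDl ?mulr_ge0 ?divr_ge0 ?(ltW d0) // exprn_gt0 // divr_gt0.
  rewrite ltr_wpDl //; last by rewrite sqrrN exprn_gt0 // divr_gt0.
  by rewrite mulr_le0 ?mulr_ge0_le0 ?oppr_le0 ?divr_ge0 ?(ltW d0) ?(ltW p).
Qed.

Lemma cvg_axial_sequence_bounded B Om : (1 <= m)%N -> open Om ->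
  (forall x, Om x -> cvgn (series (fun j => clvec (vecpart x) ^+ j * B j (repart x)))) ->
  axial_sequence_bounded B Om.
Proof.
move=> m1 oO cB S.
have key x : Om x -> exists q M : R, sqvec x < q /\
    (coef_bounded (even_coef B S (repart x)) q M /\
     coef_bounded (odd_coef B S (repart x)) q M).
  move=> Ox; have [y [Oy yx xy]] := exists_larger_vecpart m1 oO Ox.
  have [M /(_ S) h] := cvg_clifford_bounded (le_lt_trans (sqvec_ge0 x) xy) (cB y Oy).
  by exists (sqvec y), M; rewrite -yx.
by split => x Ox; have [q [M [xq [h1 h2]]]] := key x Ox; exists q, M.
Qed.

End AxialCliffordSeries.

(** * Laplacian of Clifford-valued functions by coordinates *)

Section CliffordPartials.
Variables (R : realType) (m : nat).
Local Notation X := 'rV[R]_m.+1.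
Local Notation Cl := (clifford R m).
Implicit Types (S : {set 'I_m}) (x : X) (Om : set X) (f : X -> Cl).

Lemma is_derive_unique (V W : normedModType R) (f : V -> W) (x v : V) (d1 d2 : W) :
  is_derive x v f d1 -> is_derive x v f d2 -> d1 = d2.
Proof. by move=> [_ <-] [_ <-]. Qed.

Lemma near_open (T : topologicalType) (U : set T) (P : T -> Prop) (x : T) :
  open U -> U x -> (forall y, U y -> P y) -> \forall y \near x, P y.
Proof. by move=> oU Ux UP; apply: filterS (open_nbhs_nbhs (conj oU Ux)). Qed.

Lemma smooth_C2 Om f : open Om -> (forall S, smooth 2 Om (fun x => f x S)) ->
  C2_on Om f.
Proof.
move=> oO sf x Ox i j.
have ex S : exists f1 f2 : 'I_m.+1 -> 'I_m.+1 -> X -> R, forall i j,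
    [/\ pderiv Om i (fun x => f x S) (f1 i i), pderiv Om j (f1 i i) (f2 i j) &
      forall x, Om x -> {for x, continuous (f2 i j)}].
  have [_ [g1 g1P]] := sf S.
  have [g2 g2P] : exists g2 : 'I_m.+1 -> 'I_m.+1 -> X -> R, forall i j,
      pderiv Om j (g1 i) (g2 i j) /\ smooth 0 Om (g2 i j).
    have : forall i, exists g2 : 'I_m.+1 -> X -> R, forall j,
        pderiv Om j (g1 i) (g2 j) /\ smooth 0 Om (g2 j).
      by move=> k; have [_ [_ h]] := g1P k.
    by move=> /choice [g2 g2P]; exists g2.
  exists (fun i _ => g1 i), g2 => k l; have [d1 _] := g1P k; have [d2 [c2 _]] := g2P k l.
  by split.
have [f1 /choice [f2 fP]] := choice ex.
pose F1 i x : Cl := [ffun S => f1 S i i x].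
pose F2 i j x : Cl := [ffun S => f2 S i j x].
have dF1 k y : Om y -> is_derive y (delta_mx 0 k) f (F1 k y).
  move=> Oy; apply/is_derive_cliffordP => S; rewrite ffunE.
  by have [d _ _] := fP S k k; exact: d.
have dF2 k l y : Om y -> is_derive y (delta_mx 0 l) (F1 k) (F2 k l y).
  move=> Oy; apply/is_derive_cliffordP => S; rewrite ffunE.
  have [_ d _] := fP S k l; apply: (is_derive_congr (d y Oy)) => // z.
  by rewrite ffunE.
have p1 k y : Om y -> F1 k y = partial k f y.
  by move=> Oy; have [_ <-] := dF1 k y Oy.
have dp1 k l y : Om y -> is_derive y (delta_mx 0 l) (partial k f) (F2 k l y).
  move=> Oy; apply: near_eq_is_derive (dF2 k l y Oy).
  by apply: near_open oO Oy _ => z Oz; exact: p1.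
have p2 k l y : Om y -> F2 k l y = partial l (partial k f) y.
  by move=> Oy; have [_ <-] := dp1 k l y Oy.
split; first by have := dF1 i x Ox.
  by have := dp1 i j x Ox.
have cF2 : {for x, continuous (F2 i j)}.
  apply/continuous_cliffordP => S; have [_ _ c] := fP S i j.
  have -> : (fun y => F2 i j y S) = f2 S i j by apply/funext => y; rewrite ffunE.
  exact: c.
rewrite /prop_for /continuous_at -p2 //; apply: cvg_trans cF2.
apply: (@near_eq_cvg _ _ (nbhs x)).
by apply: near_open oO Ox _ => y Oy; exact: p2.
Qed.

(** Derivatives exhibited on [Om] are matched with the total operator [partial] by uniqueness;
    openness carries the match to the second order. *)
Lemma partial2_coord Om f S i (f1 f2 : X -> R) x : open Om -> C2_on Om f ->
  pderiv Om i (fun x => f x S) f1 -> pderiv Om i f1 f2 -> Om x ->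
  partial i (partial i f) x S = f2 x.
Proof.
move=> oO C2 d1 d2 Ox.
have e1 y : Om y -> f1 y = partial i f y S.
  move=> Oy; have [c _ _] := C2 y Oy i i.
  have /is_derive_cliffordP /(_ S) h := derivableP c.
  exact: is_derive_unique (d1 y Oy) h.
have [_ c _] := C2 x Ox i i.
have /is_derive_cliffordP /(_ S) h := derivableP c.
apply: (is_derive_unique h).
by apply: near_eq_is_derive (d2 x Ox); apply: near_open oO Ox _.
Qed.

Lemma laplacian_coord Om f S (g : X -> R) x : open Om -> C2_on Om f ->
  u_laplacian Om (fun x => f x S) g -> Om x ->
  laplacian f x S = partial ord0 (partial ord0 f) x S + g x.
Proof.
move=> oO C2 [f1 [f2 [fd gE]]] Ox.
rewrite /laplacian big_ord_recl ffunE sum_ffunE gE //; congr (_ + _).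
apply: eq_bigr => j _; have [d1 d2] := fd j.
exact: partial2_coord oO C2 d1 d2 Ox.
Qed.

Lemma u_laplacian_eq Om (f g h : X -> R) : open Om ->
  (forall x, Om x -> f x = h x) -> u_laplacian Om f g -> u_laplacian Om h g.
Proof.
move=> oO fh [f1 [f2 [fd gE]]]; exists f1, f2; split => // j.
have [d1 d2] := fd j; split => // x Ox.
by apply: near_eq_is_derive (d1 x Ox); apply: near_open oO Ox _.
Qed.

Definition clifford_sum_lap (B : nat -> R -> Cl) S x : R :=
  axial_sum (fun t => radial_diffs m (even_coef B S t)) x +
  \sum_j gensign j S * (x ord0 (lift ord0 j) *
    axial_sum (fun t => radial_diffs m.+2 (odd_coef B (symdiff [set j]%SET S) t)) x).

Lemma u_laplacian_clifford_sum (B : nat -> R -> Cl) Om S :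
  axial_sequence_bounded B Om ->
  u_laplacian Om (fun x => clifford_sum B x S) (clifford_sum_lap B S).
Proof.
move=> bB; rewrite (funext (fun x => clifford_sum_coord B x S)).
apply: u_laplacianD; first by apply: u_laplacian_axial_sum; exact: (bB S).1.
apply: u_laplacian_sum => j; apply: u_laplacianZ.
by apply: u_laplacian_coord_axial_sum; exact: (bB _).2.
Qed.

Lemma harmonic_sum_clifford_sum (B : nat -> R -> Cl) (Om1 : set R) Om f : (1 <= m)%N ->
  harmonic_sum Om1 B Om f ->
  axial_sequence_bounded B Om /\ forall x, Om x -> f x = clifford_sum B x.
Proof.
move=> m1 [[oO _ _ _] cf _].
have bB : axial_sequence_bounded B Om.
  by apply: cvg_axial_sequence_bounded => // x Ox; apply/cvg_ex; exists (f x); exact: cf.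
split => // x Ox; have := cvg_clifford_sum bB Ox => c.
have hd := @norm_hausdorff R Cl.
by rewrite -(cvg_lim hd (cf x Ox)) -(cvg_lim hd c).
Qed.

(** Harmonicity becomes an evolution equation in x_0: the vector Laplacian is computed from the
    series, and the second x_0-derivative comes from the regularity of f. *)
Lemma harmonic_sum_partial0 (B : nat -> R -> Cl) (Om1 : set R) Om f S x : (1 <= m)%N ->
  harmonic_sum Om1 B Om f -> Om x ->
  partial ord0 (partial ord0 f) x S = - clifford_sum_lap B S x.
Proof.
move=> m1 hf Ox; have [bB fE] := harmonic_sum_clifford_sum m1 hf.
have [[oO _ _ _] _ [C2 lap0]] := hf.
have ul : u_laplacian Om (fun x => f x S) (clifford_sum_lap B S).
  apply: u_laplacian_eq oO _ (u_laplacian_clifford_sum S bB) => y Oy.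
  by rewrite fE.
have := laplacian_coord oO C2 ul Ox; rewrite lap0 // ffunE => /esym/eqP.
by rewrite addr_eq0 => /eqP.
Qed.

End CliffordPartials.

(** * Cauchy estimates for real-analytic functions *)

Section RealAnalyticFunctions.
Variable R : realType.
Implicit Types (U : set R) (g : R -> R).

Lemma series_pseries (c : nat -> R) (a t : R) :
  series (fun n => (t - a) ^+ n *: c n) = pseries c (t - a).
Proof.
by rewrite /pseries; congr series; apply/funext => n; rewrite /GRing.scale /= mulrC.
Qed.

Lemma real_analytic_jet U g a : real_analytic_on U g -> U a ->
  exists (c : nat -> nat -> R) (q M : R), [/\ 0 < q, 0 <= M & forall n,
    coef_bounded (c n) q (M * n`!%:R * q^-1 ^+ n) /\
    forall t, `|t - a| < q -> derive1n n g t = psum (c n) (t - a) /\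
      is_derive t 1 (derive1n n g) (derive1n n.+1 g t)].
Proof.
move=> ag Ua; have [c [r [r0 cg]]] := ag a Ua.
have cg' t : `|t - a| < r -> pseries c (t - a) @ \oo --> g t.
  by move=> /cg; rewrite series_pseries.
have [q [M [q0 M0 h]]] := analytic_jet r0 cg'.
by exists (fun n => iter n (@pseries_diffs R) c), q, M.
Qed.

Lemma real_analytic_is_derive U g n t : real_analytic_on U g -> U t ->
  is_derive t 1 (derive1n n g) (derive1n n.+1 g t).
Proof.
move=> ag Ut; have [c [q [M [q0 _ /(_ n) [_ h]]]]] := real_analytic_jet ag Ut.
by have [|] := h t; rewrite // subrr normr0.
Qed.

Lemma real_analytic_derive1n U g n : real_analytic_on U g ->
  real_analytic_on U (derive1n n g).
Proof.
move=> ag a Ua; have [c [q [M [q0 _ /(_ n) [cM h]]]]] := real_analytic_jet ag Ua.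
exists (c n), q; split => // t tq; rewrite series_pseries.
have [-> _] := h t tq; exact: is_cvg_pseries cM tq.
Qed.

Lemma near_dist_lt_center (a q : R) : 0 < q -> \forall t \near a, `|t - a| < q.
Proof. by move=> q0; apply: near_dist_lt; rewrite subrr normr0. Qed.

Lemma real_analytic_derive1n_le U g a : real_analytic_on U g -> U a ->
  exists K M : R, 0 < K /\ \forall t \near a, forall n,
    `|derive1n n g t| <= M * n`!%:R * K ^+ n.
Proof.
move=> ag Ua; have [c [q [M [q0 M0 h]]]] := real_analytic_jet ag Ua.
exists q^-1, (2 * M); split; first by rewrite invr_gt0.
have q20 : 0 < q / 2 by rewrite divr_gt0.
apply: filterS (near_dist_lt_center a q20) => t ta n.
have [cM /(_ t) [|-> _]] := h n; first by lra.
by have := psum_norm_le cM q0 (ltW ta); rewrite !mulrA.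
Qed.

Lemma real_analytic_near (V : normedModType R) U (g : R -> V) :
  (forall a, U a -> exists c : nat -> V, \forall t \near a,
    series (fun n => (t - a) ^+ n *: c n) @ \oo --> g t) -> real_analytic_on U g.
Proof.
move=> h a Ua; have [c /nbhs_ballP [r /= r0 rP]] := h a Ua.
by exists c, r; split => // t tr; apply: rP; rewrite /ball /= distrC.
Qed.

Lemma real_analytic_coord m U (g : R -> clifford R m) (S : {set 'I_m}) :
  real_analytic_on U g -> real_analytic_on U (fun t => g t S).
Proof.
move=> ag a Ua; have [c [r [r0 cg]]] := ag a Ua.
exists (fun n => c n S), r; split => // t tr.
have /cvg_series_cliffordP /(_ S) := cg t tr.
have -> // : (fun k => ((t - a) ^+ k *: c k) S) = fun n => (t - a) ^+ n *: c n S.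
by apply/funext => n; rewrite ffunE.
Qed.

Lemma real_analytic_of_coord m U (g : R -> clifford R m) :
  (forall S : {set 'I_m}, real_analytic_on U (fun t => g t S)) -> real_analytic_on U g.
Proof.
move=> ag; apply: real_analytic_near => a Ua.
have ex S : exists c : nat -> R, \forall t \near a,
    series (fun n => (t - a) ^+ n *: c n) @ \oo --> g t S.
  have [c [r [r0 cg]]] := ag S a Ua; exists c.
  by apply: filterS (near_dist_lt_center a r0) => t; exact: cg.
have [c cP] := choice ex.
exists (fun n => [ffun S => c S n]).
have : \forall t \near a, forall S, series (fun n => (t - a) ^+ n *: c S n) @ \oo --> g t S.
  exact: (@filter_forall _ _
    (fun S t => series (fun n => (t - a) ^+ n *: c S n) @ \oo --> g t S) _ _ cP).
apply: filterS => t h; apply/cvg_series_cliffordP => S.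
have -> // : (fun k => ((t - a) ^+ k *: [ffun S => c S k] : clifford R m) S) =
    fun n => (t - a) ^+ n *: c S n.
by apply/funext => n; rewrite !ffunE.
Qed.

Lemma derive1n_clifford m U (g : R -> clifford R m) n t (S : {set 'I_m}) :
  open U -> real_analytic_on U g -> U t ->
  derive1n n g t S = derive1n n (fun t => g t S) t.
Proof.
move=> oU ag; apply: derive1n_coord => // T k s Us.
by have := real_analytic_is_derive k (real_analytic_coord T ag) Us.
Qed.

End RealAnalyticFunctions.

(** * Coefficients of the harmonic series and its domain *)

Section RadialJets.
Variables (R : realType) (m : nat).
Local Notation X := 'rV[R]_m.+1.
Implicit Types (x : X) (g : R -> R) (U : set R) (p k l : nat).

(** The constant obtained by applying the Laplacian in p variables k times to |u|^(2k). *)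
Definition radial_weight p k : nat := \prod_(i < k) ((2 * i + 2) * (2 * i + p)).

Lemma radial_weightS p k :
  radial_weight p k.+1 = (radial_weight p k * ((2 * k + 2) * (2 * k + p)))%N.
Proof. by rewrite /radial_weight big_ord_recr. Qed.

(** The factor (2i+2)(2i+p) is at least (2i+2)(2i+1). This lets the weight offset the (2k)! in the
    Cauchy estimate of the derivative of order 2k. *)
Lemma fact_le_radial_weight p k : (0 < p)%N -> ((2 * k)`! <= radial_weight p k)%N.
Proof.
move=> p0; elim: k => [|k IHk]; first by rewrite muln0 /radial_weight big_ord0.
rewrite radial_weightS mulnS add2n !factS mulnA mulnC leq_mul //.
by rewrite leq_mul ?addn2 // -[(2 * k).+1]addn1 leq_add2l.
Qed.

Lemma radial_weight_gt0 p k : (0 < p)%N -> (0 < radial_weight p k)%N.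
Proof. by move=> p0; apply: leq_trans (fact_le_radial_weight k p0); exact: fact_gt0. Qed.

Definition radial_jet p g l (t : R) k : R :=
  (- 1) ^+ k * ((radial_weight p k)%:R^-1 * derive1n (2 * k + l) g t).

(* The factor 2 leaves room for the derivatives of every order [l], through
   (2k + l)! <= 2^(2k+l) l! (2k)!. *)
Definition radial_reach g : set X := [set x | exists K M : R,
  [/\ 0 < K, sqvec x * (2 * K) ^+ 2 < 1 & \forall t \near x ord0 ord0,
    forall n, `|derive1n n g t| <= M * n`!%:R * K ^+ n]].

Lemma open_radial_reach g : open (radial_reach g).
Proof.
rewrite openE => x [K [M [K0 xK nM]]]; rewrite /interior.
have n1 : nbhs x [set y : X | sqvec y * (2 * K) ^+ 2 < 1].
  have c : (fun y : X => sqvec y * (2 * K) ^+ 2) @ x --> sqvec x * (2 * K) ^+ 2.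
    by apply: (@cvgMl _ _ (nbhs x)); exact: (@continuous_sqvec R m x).
  by move/cvgr_lt: c; apply.
have n2 : nbhs x [set y : X | \forall t \near y ord0 ord0,
    forall n, `|derive1n n g t| <= M * n`!%:R * K ^+ n].
  have n3 := nbhs_interior nM.
  exact: (@continuous_coord R m ord0 x _ n3).
by apply: filterS2 n1 n2 => y h1 h2; exists K, M.
Qed.

Lemma axial_jet_radial p g U (Om : set X) : (0 < p)%N -> open U ->
  real_analytic_on U g ->
  (forall x, Om x -> U (x ord0 ord0) /\ radial_reach g x) ->
  axial_jet Om (radial_jet p g).
Proof.
move=> p0 oU ag OmP l x /OmP [Ux [K [M [K0 xK nM]]]].
have nU := open_nbhs_nbhs (conj oU Ux).
have /nbhs_ballP [r /= r0 rP] : nbhs (x ord0 ord0) (U `&` [set t | forall n,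
    `|derive1n n g t| <= M * n`!%:R * K ^+ n]) by exact: filterI.
have K20 : 0 < (2 * K) ^+ 2 by rewrite exprn_gt0 // mulr_gt0.
(* After (2k)! cancels, M l! (2K)^(2k+l) remains: the factor (2K)^(2k) sets the radius in |x|^2, the
   rest the constant. *)
exists ((2 * K) ^+ 2)^-1, (M * l`!%:R * (2 * K) ^+ l), r; split => //.
  by rewrite -[_^-1]mul1r ltr_pdivlMr.
move=> t tr; have [Ut tM] : (U `&` [set t | forall n, `|derive1n n g t| <=
    M * n`!%:R * K ^+ n]) t by apply: rP; rewrite /ball /= distrC.
have M0 : 0 <= M.
  by have := tM 0%N; rewrite fact0 expr0 !mulr1; exact: le_trans.
split; last first.
  move=> k; have d := real_analytic_is_derive (2 * k + l) ag Ut.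
  have d1 := is_deriveZ ((- 1) ^+ k * (radial_weight p k)%:R^-1 : R) d.
  apply: (is_derive_congr d1) => [s|]; first by rewrite /radial_jet mulrA.
  by rewrite /radial_jet addnS mulrA.
move=> k; rewrite /radial_jet normrM normrX normrN1 expr1n mul1r normrM.
rewrite ger0_norm ?invr_ge0 //.
have w0 : (0 : R) < (radial_weight p k)%:R by rewrite ltr0n radial_weight_gt0.
have f0 : (0 : R) < (2 * k)`!%:R by rewrite ltr0n fact_gt0.
apply: (@le_trans _ _ ((2 * k)`!%:R^-1 * (M * (2 * k + l)`!%:R * K ^+ (2 * k + l)) *
   ((2 * K) ^+ 2)^-1 ^+ k)).
  rewrite ler_wpM2r ?exprn_ge0 ?invr_ge0 ?(ltW K20) // ler_pM ?invr_ge0 //.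
  by rewrite lef_pV2 ?posrE // ler_nat fact_le_radial_weight.
have facE : (2 * k + l)`!%:R = ((l + 2 * k) ^_ l)%:R * (2 * k)`!%:R :> R.
  by rewrite -natrM -{3}(addKn l (2 * k)%N) ffact_fact ?leq_addr // addnC.
rewrite facE.
apply: (@le_trans _ _ ((2 * k)`!%:R^-1 * (M * ((2 ^+ (l + 2 * k) * l`!%:R) *
   (2 * k)`!%:R) * K ^+ (2 * k + l)) * ((2 * K) ^+ 2)^-1 ^+ k)).
  rewrite ler_wpM2r ?exprn_ge0 ?invr_ge0 ?(ltW K20) // ler_wpM2l ?invr_ge0 //.
  rewrite ler_wpM2r ?exprn_ge0 ?(ltW K0) // ler_wpM2l // ler_wpM2r //.
  by rewrite -natrX -natrM ler_nat ffact_le_exp2.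
rewrite le_eqVlt; apply/orP; left; apply/eqP.
rewrite exprVn -exprM !exprD !exprMn (mulnC 2%N k).
field; rewrite ?expf_neq0 ?(gt_eqF K0) ?pnatr_eq0 //=.
by rewrite -lt0n fact_gt0.
Qed.

(** Coefficient form of L u = - u_tt: the new factor of the weight cancels that of the radial
    Laplacian, and the alternating sign gives the minus. *)
Lemma radial_diffs_jet p g (t : R) : (0 < p)%N ->
  radial_diffs p (radial_jet p g 0 t) = fun k => - radial_jet p g 2 t k.
Proof.
move=> p0; apply/funext => k; rewrite /radial_diffs /radial_jet radial_weightS.
rewrite (_ : (2 * k.+1 + 0 = 2 * k + 2)%N); last by rewrite addn0 mulnS addnC.
have w0 : (radial_weight p k)%:R != 0 :> R by rewrite pnatr_eq0 -lt0n radial_weight_gt0.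
have h1 : (2 * k + 2)%:R = 2 * k.+1%:R :> R by rewrite -natrM; congr _%:R; rewrite mulnS addnC.
have k0 : k.+1%:R != 0 :> R by rewrite pnatr_eq0.
have pk0 : (p + 2 * k)%:R != 0 :> R by rewrite pnatr_eq0 -lt0n addn_gt0 p0.
rewrite !natrM h1 (addnC (2 * k)%N p) exprS; move: k0 pk0 w0.
move: (k.+1%:R : R) ((p + 2 * k)%:R : R) ((radial_weight p k)%:R : R).
by move=> a b w a0 b0 w0; field; rewrite w0 a0 b0.
Qed.

End RadialJets.

(** * Existence *)

Section Existence.
Variables (R : realType) (m : nat).
Local Notation X := 'rV[R]_m.+1.
Local Notation Cl := (clifford R m).
Implicit Types (x : X) (S : {set 'I_m}) (A : R -> Cl) (t : R).

(** The recursion solved in closed form, with dimension m for even and m + 2 for odd indices. *)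
Definition harmonic_seq A0 A1 (j : nat) t : Cl :=
  (radial_weight (if odd j then m.+2 else m) j./2)%:R^-1 *:
    derive1n (2 * j./2) (if odd j then A1 else A0) t.

Lemma harmonic_seq_even A0 A1 k t : harmonic_seq A0 A1 (2 * k)%N t =
  (radial_weight m k)%:R^-1 *: derive1n (2 * k) A0 t.
Proof. by rewrite /harmonic_seq (mul2n k) odd_double doubleK mul2n. Qed.

Lemma harmonic_seq_odd A0 A1 k t : harmonic_seq A0 A1 (2 * k).+1 t =
  (radial_weight m.+2 k)%:R^-1 *: derive1n (2 * k) A1 t.
Proof.
by rewrite /harmonic_seq (mul2n k) -[k.*2.+1]/(true + k.*2)%N half_bit_double oddD
  odd_double /= mul2n.
Qed.

Lemma sqvec_paravector t (u : 'rV[R]_m) : sqvec (paravector t u) = sqnorm u.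
Proof. by rewrite -sqnorm_vecpart vecpart_paravector. Qed.

Lemma sqnormE (u : 'rV[R]_m) : sqnorm u = (u *m u^T) ord0 ord0.
Proof. by rewrite mxE; apply: eq_bigr => j _; rewrite !mxE expr2. Qed.

Lemma sqnorm_orthogonal (u : 'rV[R]_m) (M : 'M[R]_m) :
  M *m M^T = 1%:M -> sqnorm (u *m M^T) = sqnorm u.
Proof.
move=> MM; rewrite !sqnormE trmx_mul trmxK mulmxA -(mulmxA u).
by rewrite (mulmx1C MM) mulmx1.
Qed.

Variables (Om1 : set R) (A0 A1 : R -> Cl).
Hypotheses (m1 : (1 <= m)%N) (oOm1 : open Om1).
Hypotheses (an0 : real_analytic_on Om1 A0) (an1 : real_analytic_on Om1 A1).

Definition harmonic_domain : set X := [set x : X | Om1 (x ord0 ord0) /\ forall S,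
  radial_reach (fun t => A0 t S) x /\ radial_reach (fun t => A1 t S) x].

Lemma open_harmonic_domain : open harmonic_domain.
Proof.
rewrite openE => x [Ox xS]; rewrite /interior.
have n1 : nbhs x [set y : X | Om1 (y ord0 ord0)].
  exact: (@continuous_coord R m ord0 x _ (open_nbhs_nbhs (conj oOm1 Ox))).
have n2 S : nbhs x [set y : X | radial_reach (fun t => A0 t S) y /\
    radial_reach (fun t => A1 t S) y].
  have [h0 h1] := xS S.
  have o (g : R -> R) : radial_reach g x -> nbhs x (radial_reach g).
    by move=> h; apply: open_nbhs_nbhs; split => //; exact: open_radial_reach.
  exact: filterI (o _ h0) (o _ h1).
have n3 := @filter_forall _ _ (fun S => [set y : X | radial_reach (fun t => A0 t S) y /\
    radial_reach (fun t => A1 t S) y]) (nbhs x) (nbhs_filter x) n2.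
exact: filterI n1 n3.
Qed.

Lemma radial_reach_axis (g : R -> R) t : real_analytic_on Om1 g -> Om1 t ->
  radial_reach g (paravector t 0 : X).
Proof.
move=> ag Ot; have [K [M [K0 nM]]] := real_analytic_derive1n_le ag Ot.
exists K, M; split => //.
  rewrite sqvec_paravector /sqnorm big1 ?mul0r // => j _.
  by rewrite mxE expr0n.
by rewrite -[_ ord0 ord0]/(repart _) repart_paravector.
Qed.

(** Membership depends on x_0 and |x|^2 only, hence the axial symmetry; on the axis |x|^2 = 0, so
    any Cauchy constant is admissible. *)
Lemma axial_neighbourhood_harmonic_domain : axial_neighbourhood Om1 harmonic_domain.
Proof.
split; [exact: open_harmonic_domain| | |by move=> x []].
- move=> x M [Ox xS] MM _.
  have sE : sqvec (paravector (repart x) (vecpart x *m M^T)) = sqvec x.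
    by rewrite sqvec_paravector sqnorm_orthogonal // sqnorm_vecpart.
  have tE : (paravector (repart x) (vecpart x *m M^T)) ord0 ord0 = x ord0 ord0.
    by rewrite -[LHS]/(repart _) repart_paravector.
  split; first by rewrite tE.
  by move=> S; rewrite /radial_reach /= sE tE; exact: xS.
- move=> t Ot; split; first by rewrite -[_ ord0 ord0]/(repart _) repart_paravector.
  by move=> S; split; apply: radial_reach_axis => //; exact: real_analytic_coord.
Qed.

Lemma real_analytic_harmonic_seq j : real_analytic_on Om1 (harmonic_seq A0 A1 j).
Proof.
apply: real_analytic_of_coord => S; rewrite /harmonic_seq.
set w := _^-1; set n := (2 * j./2)%N; set A := if odd j then A1 else A0.
have anA : real_analytic_on Om1 A by rewrite /A; case: ifP.
have an := real_analytic_derive1n n (real_analytic_coord S anA).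
move=> a Oa; have [c [r [r0 cr]]] := an a Oa.
have /nbhs_ballP [d /= d0 dO] := open_nbhs_nbhs (conj oOm1 Oa).
exists (fun k => w * c k), (Num.min r d); split; first by rewrite lt_min r0.
move=> t; rewrite lt_min => /andP[tr td].
have Ot : Om1 t by apply: dO; rewrite /ball /= distrC.
rewrite ffunE (derive1n_clifford _ _ oOm1 anA Ot).
have -> : series (fun k => (t - a) ^+ k *: (w * c k)) =
    fun N => w * series (fun k => (t - a) ^+ k *: c k) N.
  apply/funext => N; rewrite /series /= mulr_sumr; apply: eq_bigr => k _.
  by rewrite /GRing.scale /= mulrCA.
exact: cvgMr (cr t tr).
Qed.

Lemma even_coef_harmonic_seq S t : Om1 t -> even_coef (harmonic_seq A0 A1) S t =
  radial_jet m (fun t => A0 t S) 0 t.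
Proof.
move=> Ot; apply/funext => k; rewrite /even_coef harmonic_seq_even ffunE.
by rewrite (derive1n_clifford _ _ oOm1 an0 Ot) /radial_jet addn0.
Qed.

Lemma odd_coef_harmonic_seq S t : Om1 t -> odd_coef (harmonic_seq A0 A1) S t =
  radial_jet m.+2 (fun t => A1 t S) 0 t.
Proof.
move=> Ot; apply/funext => k; rewrite /odd_coef harmonic_seq_odd ffunE.
by rewrite (derive1n_clifford _ _ oOm1 an1 Ot) /radial_jet addn0.
Qed.

Let jet0 S : axial_jet harmonic_domain (radial_jet m (fun t => A0 t S)).
Proof.
apply: (axial_jet_radial m1 oOm1 (real_analytic_coord S an0)) => x [Ox xS].
by have [] := xS S.
Qed.

Let jet1 S : axial_jet harmonic_domain (radial_jet m.+2 (fun t => A1 t S)).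
Proof.
apply: (axial_jet_radial _ oOm1 (real_analytic_coord S an1)) => // x [Ox xS].
by have [] := xS S.
Qed.

Let f := clifford_sum (harmonic_seq A0 A1).

(** The l-th x_0-derivative of coordinate [S] of the sum; for l = 0 it agrees with the sum on the
    domain. *)
Let F l S x : R := axial_sum (radial_jet m (fun t => A0 t S) l) x +
  \sum_j gensign j S * (x ord0 (lift ord0 j) *
    axial_sum (radial_jet m.+2 (fun t => A1 t (symdiff [set j]%SET S)) l) x).

Let fE S x : harmonic_domain x -> f x S = F 0 S x.
Proof.
move=> [Ox _]; rewrite /f clifford_sum_coord /F /axial_sum even_coef_harmonic_seq //.
by congr (_ + _); apply: eq_bigr => j _; rewrite odd_coef_harmonic_seq.
Qed.

Let smoothF n S : smooth n harmonic_domain (F 0 S).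
Proof.
apply: smoothD; first exact: smooth_axial_sum.
apply: smooth_sum => j; apply: smoothM; first exact: smooth_cst.
by apply: smoothM; [exact: smooth_coord|exact: smooth_axial_sum].
Qed.

Let pderivF l S : pderiv harmonic_domain ord0 (F l S) (F l.+1 S).
Proof.
move=> x Ox.
have d1 := pderiv_axial_sum_re l (jet0 S) Ox.
pose G j (y : X) : R := gensign j S * (y ord0 (lift ord0 j) *
    axial_sum (radial_jet m.+2 (fun t => A1 t (symdiff [set j]%SET S)) l) y).
pose dG j : R := gensign j S * (x ord0 (lift ord0 j) *
    axial_sum (radial_jet m.+2 (fun t => A1 t (symdiff [set j]%SET S)) l.+1) x).
have d2 j : is_derive x (delta_mx 0 ord0) (G j) (dG j).
  have d3 := pderiv_axial_sum_re l (jet1 (symdiff [set j]%SET S)) Ox.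
  have d4 := is_deriveM (is_derive_coord (lift ord0 j) ord0 x) d3.
  apply: (is_derive_congr (is_deriveZ (gensign j S) d4)) => //.
  by rewrite /dG /= scaler0 addr0.
apply: (is_derive_congr (is_deriveD d1 (is_derive_sum d2))) => // y.
by rewrite fctE fct_sumE.
Qed.

Let lapF S : u_laplacian harmonic_domain (F 0 S) (fun x => - F 2 S x).
Proof.
have bd0 S' := axial_jet_bounded 0 (jet0 S').
have bd1 S' := axial_jet_bounded 0 (jet1 S').
have := u_laplacianD (u_laplacian_axial_sum (bd0 S))
  (u_laplacian_sum (index_enum 'I_m) (fun j => u_laplacianZ (gensign j S)
     (u_laplacian_coord_axial_sum j (bd1 (symdiff [set j]%SET S))))).
move=> [f1 [f2 [fd gE]]]; exists f1, f2; split => // x Ox.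
rewrite -gE // /F opprD -sumrN /axial_sum.
have neg p c q M : coef_bounded (radial_jet p c 2 (x ord0 ord0)) q M -> sqvec x < q ->
    psum (fun k => - radial_jet p c 2 (x ord0 ord0) k) (sqvec x) =
    - psum (radial_jet p c 2 (x ord0 ord0)) (sqvec x).
  move=> cM xq; have := @psum_lin R _ _ (- 1) 0 (sqvec x) q M M cM cM.
  rewrite norm_sqvec mul0r addr0 mulN1r => <- //; congr psum.
  by apply/funext => k; rewrite mulN1r mul0r addr0.
have [q [M [xq cM]]] := axial_jet_bounded 2 (jet0 S) Ox.
rewrite radial_diffs_jet // (neg _ _ _ _ cM xq); congr (_ + _).
apply: eq_bigr => j _; rewrite radial_diffs_jet //.
have [q' [M' [xq' cM']]] := axial_jet_bounded 2 (jet1 (symdiff [set j]%SET S)) Ox.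
by rewrite (neg _ _ _ _ cM' xq') !mulrN.
Qed.

Lemma harmonic_sum_harmonic_seq :
  harmonic_sum Om1 (harmonic_seq A0 A1) harmonic_domain f.
Proof.
have oO := open_harmonic_domain.
have bd : axial_sequence_bounded (harmonic_seq A0 A1) harmonic_domain.
  move=> S; split => x Ox.
    have [q [M [xq cM]]] := axial_jet_bounded 0 (jet0 S) Ox.
    by exists q, M; rewrite even_coef_harmonic_seq //; case: Ox.
  have [q [M [xq cM]]] := axial_jet_bounded 0 (jet1 S) Ox.
  by exists q, M; rewrite odd_coef_harmonic_seq //; case: Ox.
split; first exact: axial_neighbourhood_harmonic_domain.
  by move=> x Ox; exact: cvg_clifford_sum bd Ox.
have C2 : C2_on harmonic_domain f.
  apply: smooth_C2 => // S; apply: smooth_eq oO _ (smoothF 2 S) => x Ox.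
  by rewrite fE.
split => // x Ox; apply/ffunP => S.
have lapf : u_laplacian harmonic_domain (fun x => f x S) (fun x => - F 2 S x).
  by apply: u_laplacian_eq oO _ (lapF S) => y Oy; rewrite fE.
rewrite (laplacian_coord oO C2 lapf Ox) ffunE.
have d0 : pderiv harmonic_domain ord0 (fun x => f x S) (F 1 S).
  move=> y Oy; apply: near_eq_is_derive (pderivF 0 S Oy).
  by apply: near_open oO Oy _ => z Oz; rewrite fE.
by rewrite (partial2_coord oO C2 d0 (pderivF 1 S) Ox) subrr.
Qed.

Lemma harmonic_sequence_harmonic_seq :
  harmonic_sequence Om1 A0 A1 (harmonic_seq A0 A1).
Proof.
split.
- move=> t _; have := harmonic_seq_even A0 A1 0 t; rewrite muln0 => ->.
  by rewrite /radial_weight big_ord0 invr1 scale1r.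
- move=> t _; have := harmonic_seq_odd A0 A1 0 t; rewrite muln0 => ->.
  by rewrite /radial_weight big_ord0 invr1 scale1r.
- exact: real_analytic_harmonic_seq.
- by exists harmonic_domain, f; exact: harmonic_sum_harmonic_seq.
Qed.

End Existence.

(** * Uniqueness *)

Section Uniqueness.
Variables (R : realType) (m : nat).
Local Notation X := 'rV[R]_m.+1.
Local Notation Cl := (clifford R m).
Implicit Types (x : X) (S T : {set 'I_m}) (t r s : R) (B : nat -> R -> Cl).

Definition radial_kap (p k : nat) : R := 2 * k.+1%:R * (p + 2 * k)%:R.

(** Both k + 1 and (p + 2k)/(p + 2) are at most 2^k; a geometric bound suffices, since it only
    shrinks the radius in |x|^2. *)
Lemma radial_kap_le p k : `|radial_kap p k| <= (2 * (p + 2)%:R) * 4 ^+ k.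
Proof.
rewrite /radial_kap ger0_norm ?mulr_ge0 // -!mulrA ler_wpM2l //.
rewrite -natrX -!natrM ler_nat.
have h : (k.+1 <= 2 ^ k)%N by exact: ltn_expl.
apply: (@leq_trans (2 ^ k * ((p + 2) * 2 ^ k))).
  apply: leq_mul => //; apply: (@leq_trans ((p + 2) * k.+1)); last by rewrite leq_mul2l h orbT.
  by rewrite mulnS mulnDl; lia.
by rewrite mulnCA -expnMn.
Qed.

Lemma signed_recursion p (U : set R) (g : nat -> R -> R) (t0 r sig q : R) N :
  0 < r -> 0 < q -> 0 < sig -> (forall k, real_analytic_on U (g k)) ->
  (forall t, `|t - t0| < r -> U t) ->
  (forall t, `|t - t0| < r -> exists M, coef_bounded (fun k => (- 1) ^+ k * g k t) q M) ->
  psum_ode (radial_kap p) (fun k t => (- 1) ^+ k * g k t) t0 r sig ->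
  derive1n 2 (g N) t0 = radial_kap p N * g N.+1 t0.
Proof.
move=> r0 q0 sig0 ag rU bM ode.
pose b (l : nat) k t := (- 1) ^+ k * derive1n l (g k) t.
have db l k t : `|t - t0| < r -> is_derive t 1 (b l k) (b l.+1 k t).
  move=> /rU Ut; have d := real_analytic_is_derive l (ag k) Ut.
  by have := is_deriveZ ((- 1) ^+ k : R) d; exact.
have := @psum_ode_coef R (radial_kap p) (b 0%N) (b 1%N) (b 2%N) t0 r sig q
  (2 * (p + 2)%:R) N r0 q0 sig0 (radial_kap_le p) bM (db 0%N) (db 1%N) _ ode.
have sgn0 : (- 1) ^+ N != 0 :> R by rewrite expf_neq0 // oppr_eq0 oner_eq0.
rewrite /b /= exprS mulN1r mulNr mulrN opprK mulrCA => h.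
apply: (mulfI sgn0); apply: h => k t tr.
have d := db 2%N k t tr; apply: differentiable_continuous.
exact/derivable1_diffP.
Qed.

Variable i0 : 'I_m.

(** A plane spanned by the real axis and one vector direction suffices: by the axial form, the
    values at r and - r already separate E and O. *)
Definition plane_point t r : X :=
  t *: delta_mx 0 ord0 + r *: delta_mx 0 (lift ord0 i0).

Lemma plane_point_re t r : plane_point t r ord0 ord0 = t.
Proof. by rewrite !mxE /= mulr1 mulr0 addr0. Qed.

Lemma plane_point_vec t r j :
  plane_point t r ord0 (lift ord0 j) = r * (j == i0)%:R.
Proof. by rewrite !mxE /= mulr0 add0r (inj_eq lift_inj). Qed.

Lemma sqvec_plane_point t r : sqvec (plane_point t r) = r ^+ 2.
Proof.
rewrite /sqvec (bigD1 i0) //= big1 => [|j ji].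
  by rewrite plane_point_vec eqxx mulr1 addr0.
by rewrite plane_point_vec (negbTE ji) mulr0 expr0n.
Qed.

Lemma plane_point_paravector t : plane_point t 0 = paravector t 0.
Proof.
apply/rowP => i; case: (unliftP ord0 i) => [j ->|->].
  rewrite (_ : 0 = ord0) // plane_point_vec mul0r.
  by have /rowP /(_ j) := vecpart_paravector t (0 : 'rV[R]_m); rewrite !mxE.
by rewrite (_ : 0 = ord0) // plane_point_re -[RHS]/(repart _) repart_paravector.
Qed.

Lemma plane_point_near (Om : set X) t0 : open Om -> Om (paravector t0 0) ->
  exists2 d, 0 < d & forall t r, `|t - t0| < d -> `|r| < d -> Om (plane_point t r).
Proof.
move=> oO; rewrite -plane_point_paravector => Ot.
have /nbhs_ballP [d /= d0 dO] := open_nbhs_nbhs (conj oO Ot).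
exists d => // t r td rd; apply: dO; split => // i j; rewrite (ord1 i).
case: (unliftP ord0 j) => [k ->|->]; rewrite (_ : 0 = ord0) //.
  rewrite !plane_point_vec mul0r /ball /= sub0r normrN normrM.
  by case: (k == i0); rewrite ?normr1 ?mulr1 // normr0 mulr0.
by rewrite !plane_point_re /ball /= distrC.
Qed.

Lemma is_derive_plane_point (F : X -> R) t r (dF : R) :
  is_derive (plane_point t r) (delta_mx 0 ord0) F dF ->
  is_derive t 1 (fun t => F (plane_point t r)) dF.
Proof.
move=> /is_derive_lineP d; apply/is_derive_lineP; apply: (is_derive_congr d) => // h.
by rewrite /plane_point [h *: (1 : R)]mulr1 scalerDl addrA.
Qed.

Lemma clifford_sum_plane_point B S t r : clifford_sum B (plane_point t r) S =
  psum (even_coef B S t) (r ^+ 2) + gensign i0 S *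
    (r * psum (odd_coef B (symdiff [set i0]%SET S) t) (r ^+ 2)).
Proof.
rewrite clifford_sum_coord /axial_sum plane_point_re sqvec_plane_point.
congr (_ + _); rewrite (bigD1 i0) //= big1 => [|j ji].
  by rewrite plane_point_vec eqxx mulr1 addr0.
by rewrite plane_point_vec (negbTE ji) mulr0 mul0r mulr0.
Qed.

Lemma clifford_sum_lap_plane_point B S t r : clifford_sum_lap B S (plane_point t r) =
  psum (radial_diffs m (even_coef B S t)) (r ^+ 2) + gensign i0 S *
    (r * psum (radial_diffs m.+2 (odd_coef B (symdiff [set i0]%SET S) t)) (r ^+ 2)).
Proof.
rewrite /clifford_sum_lap /axial_sum plane_point_re sqvec_plane_point.
congr (_ + _); rewrite (bigD1 i0) //= big1 => [|j ji].
  by rewrite plane_point_vec eqxx mulr1 addr0.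
by rewrite plane_point_vec (negbTE ji) mulr0 mul0r mulr0.
Qed.

(** With r = sqrt s, the half-sum of f over r and - r isolates the even series, and the
    half-difference divided by r the odd one; both inherit their x_0-derivatives from f. *)
Lemma harmonic_sum_ode B (Om1 : set R) (Om : set X) (f : X -> Cl) S t0 :
  harmonic_sum Om1 B Om f -> Om1 t0 -> exists d, [/\ 0 < d,
    forall t, `|t - t0| < d -> Om1 t,
    forall t, `|t - t0| < d -> exists M, coef_bounded (even_coef B S t) (d ^+ 2) M /\
      coef_bounded (odd_coef B S t) (d ^+ 2) M,
    psum_ode (radial_kap m) (fun k t => even_coef B S t k) t0 d (d ^+ 2) &
    psum_ode (radial_kap m.+2) (fun k t => odd_coef B S t k) t0 d (d ^+ 2)].
Proof.
move=> hf Ot0; have m1 : (1 <= m)%N by case: m i0 => [[]|].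
have [bB fE] := harmonic_sum_clifford_sum m1 hf.
have [[oO _ inOm subOm] cf [C2 _]] := hf.
have [d d0 dO] := plane_point_near oO (inOm _ Ot0).
have d20 : 0 < d / 2 by rewrite divr_gt0.
have inO t r : `|t - t0| < d / 2 -> `|r| <= d / 2 -> Om (plane_point t r).
  by move=> td rd; apply: dO; lra.
have part0 T t r : Om (plane_point t r) ->
    is_derive t 1 (fun t => f (plane_point t r) T) (partial ord0 f (plane_point t r) T) /\
    is_derive t 1 (fun t => partial ord0 f (plane_point t r) T)
      (- clifford_sum_lap B T (plane_point t r)).
  move=> Op; have [c1 c2 _] := C2 _ Op ord0 ord0; split.
    apply: (is_derive_plane_point (F := fun x => f x T)).
    by have /is_derive_cliffordP := derivableP c1.
  rewrite -(harmonic_sum_partial0 T m1 hf Op).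
  apply: (is_derive_plane_point (F := fun x => partial ord0 f x T)).
  by have /is_derive_cliffordP := derivableP c2.
(* Half the size of the box, so that the points with r = d/2 still lie in [Om] and bound the
   coefficients at radius (d/2)^2. *)
exists (d / 2); split => //.
- move=> t td; have := subOm _ (inO t 0 td _); rewrite normr0 => /(_ (ltW d20)).
  by rewrite /repart plane_point_re.
- move=> t td; have nd : `|d / 2| <= d / 2 by rewrite ger0_norm // ltW.
  have Op := inO t (d / 2) td nd.
  have c : cvgn (series (fun j => clvec (vecpart (plane_point t (d / 2))) ^+ j *
      B j (repart (plane_point t (d / 2))))).
    by apply/cvg_ex; exists (f (plane_point t (d / 2))); exact: cf.
  have [|M /(_ S)] := cvg_clifford_bounded _ c.
    by rewrite sqvec_plane_point exprn_gt0.
  by rewrite sqvec_plane_point /repart plane_point_re; exists M.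
- move=> s /andP[s0 sd]; pose r := Num.sqrt s.
  have rs : r ^+ 2 = s by rewrite sqr_sqrtr // ltW.
  have rd : `|r| <= d / 2.
    rewrite ger0_norm ?sqrtr_ge0 // -(@ler_pXn2r _ 2%N) ?nnegrE ?sqrtr_ge0 ?(ltW d20) //.
    by rewrite rs ltW.
  have nrd : `|- r| <= d / 2 by rewrite normrN.
  exists (fun t => 2^-1 * (partial ord0 f (plane_point t r) S +
    partial ord0 f (plane_point t (- r)) S)) => t td.
  have [p1 q1] := part0 S t r (inO t r td rd).
  have [p2 q2] := part0 S t (- r) (inO t (- r) td nrd); split.
    apply: near_eq_is_derive (is_deriveZ 2^-1 (is_deriveD p1 p2)).
    apply: filterS (near_dist_lt td) => z zd.
    rewrite -[LHS]/(2^-1 * (f (plane_point z r) S + f (plane_point z (- r)) S)).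
    rewrite !fE; try exact: inO.
    by rewrite !clifford_sum_plane_point sqrrN rs; field.
  apply: (is_derive_congr (is_deriveZ 2^-1 (is_deriveD q1 q2))) => //.
  rewrite !clifford_sum_lap_plane_point sqrrN rs /GRing.scale /=.
  by rewrite -[psum (radial_diffs m _) s]/(psum
    (fun k => radial_kap m k * even_coef B S t k.+1) s); field.
- move=> s /andP[s0 sd]; pose r := Num.sqrt s.
  have rs : r ^+ 2 = s by rewrite sqr_sqrtr // ltW.
  have r0 : r != 0 by rewrite gt_eqF // sqrtr_gt0.
  have rd : `|r| <= d / 2.
    rewrite ger0_norm ?sqrtr_ge0 // -(@ler_pXn2r _ 2%N) ?nnegrE ?sqrtr_ge0 ?(ltW d20) //.
    by rewrite rs ltW.
  have nrd : `|- r| <= d / 2 by rewrite normrN.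
  (* Multiplication by the generator moves coordinates, so the odd series of coordinate [S] is read
     off coordinate [T] of f, up to the sign [kp]. *)
  pose T := symdiff [set i0]%SET S.
  have TS : symdiff [set i0]%SET T = S by rewrite symdiffK.
  pose kp := gensign i0 T : R; have kp2 : kp * kp = 1 by exact: gensign_sqr.
  exists (fun t => (kp / (2 * r)) * (partial ord0 f (plane_point t r) T -
    partial ord0 f (plane_point t (- r)) T)) => t td.
  have [p1 q1] := part0 T t r (inO t r td rd).
  have [p2 q2] := part0 T t (- r) (inO t (- r) td nrd).
  have alg (e o : R) : kp / (2 * r) * (e + kp * (r * o) - (e + kp * (- r * o))) = o.
    transitivity (kp * kp * o); last by rewrite kp2 mul1r.
    by field.
  split.
    apply: near_eq_is_derive (is_deriveZ (kp / (2 * r)) (is_deriveB p1 p2)).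
    apply: filterS (near_dist_lt td) => z zd.
    rewrite -[LHS]/(kp / (2 * r) * (f (plane_point z r) T - f (plane_point z (- r)) T)).
    rewrite !fE; try exact: inO.
    by rewrite !clifford_sum_plane_point TS sqrrN rs alg.
  apply: (is_derive_congr (is_deriveZ (kp / (2 * r)) (is_deriveB q1 q2))) => //.
  rewrite !clifford_sum_lap_plane_point TS sqrrN rs.
  rewrite -[psum (radial_diffs m.+2 _) s]/(psum
    (fun k => radial_kap m.+2 k * odd_coef B S t k.+1) s).
  by rewrite -opprD -[LHS]/(kp / (2 * r) * - _) mulrN alg.
Qed.

Lemma harmonic_sum_recursion B (Om1 : set R) (Om : set X) (f : X -> Cl) S t k :
  harmonic_sum Om1 B Om f -> (forall j, real_analytic_on Om1 (B j)) -> Om1 t ->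
  derive1n 2 (fun t => B (2 * k)%N t S) t = radial_kap m k * B (2 * k.+1)%N t S /\
  derive1n 2 (fun t => B (2 * k).+1 t S) t = radial_kap m.+2 k * B (2 * k.+1).+1 t S.
Proof.
move=> hf aB Ot; have [d [d0 dOm1 dM ode0 ode1]] := harmonic_sum_ode S hf Ot.
have d20 : 0 < d ^+ 2 by rewrite exprn_gt0.
split.
  apply: (@signed_recursion m Om1 (fun k t => B (2 * k)%N t S) t d (d ^+ 2) (d ^+ 2) k) => //.
  - by move=> j; exact: real_analytic_coord.
  - by move=> z /dM [M [h _]]; exists M.
apply: (@signed_recursion m.+2 Om1 (fun k t => B (2 * k).+1 t S) t d (d ^+ 2) (d ^+ 2) k) => //.
- by move=> j; exact: real_analytic_coord.
- by move=> z /dM [M [_ h]]; exists M.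
Qed.

(** For p > 0 the factor kappa_k is nonzero, so g_k determines g_(k+1), and the factors multiply up
    to [radial_weight]. *)
Lemma recursion_unique p (U : set R) (g : nat -> R -> R) (a : R -> R) : (0 < p)%N ->
  open U -> real_analytic_on U a -> (forall t, U t -> g 0%N t = a t) ->
  (forall k t, U t -> derive1n 2 (g k) t = radial_kap p k * g k.+1 t) ->
  forall k t, U t -> g k t = (radial_weight p k)%:R^-1 * derive1n (2 * k) a t.
Proof.
move=> p0 oU aa g0 rec; elim=> [|k IHk] t Ut.
  by rewrite /radial_weight big_ord0 invr1 mul1r muln0 g0.
set w := (radial_weight p k)%:R^-1 in IHk.
have d0 l s : U s -> is_derive s 1 (fun t => w * derive1n (2 * k + l) a t)
    (w * derive1n (2 * k + l).+1 a s).
  move=> Us; have d := real_analytic_is_derive (2 * k + l) aa Us.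
  by have := is_deriveZ w d; exact.
have d1 s : U s -> derive1 (g k) s = w * derive1n (2 * k + 1) a s.
  move=> Us; rewrite derive1E (near_eq_derive _ (near_open oU Us IHk)).
  by have := d0 0%N s Us; rewrite addn0 addn1 => d; rewrite derive_val.
have d2 : derive1n 2 (g k) t = w * derive1n (2 * k + 2) a t.
  rewrite -[LHS]/(derive1 (derive1 (g k)) t) derive1E (near_eq_derive _ (near_open oU Ut d1)).
  by have := d0 1%N t Ut; rewrite -addnS => d; rewrite derive_val.
have kap0 : radial_kap p k != 0.
  by rewrite /radial_kap !mulf_neq0 ?pnatr_eq0 // -lt0n addn_gt0 p0.
apply: (mulfI kap0); rewrite -rec // d2 mulnS addnC.
have -> : w = radial_kap p k * (radial_weight p k.+1)%:R^-1; last by rewrite mulrA.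
rewrite /w radial_weightS natrM invfM mulrCA /radial_kap.
rewrite (_ : ((2 * k + 2) * (2 * k + p))%:R = 2 * k.+1%:R * (p + 2 * k)%:R :> R).
  by rewrite mulfV ?mulr1.
by rewrite -!natrM; congr _%:R; rewrite (addnC p); congr (_ * _)%N; rewrite mulnS addnC.
Qed.

Lemma harmonic_sequence_unique (Om1 : set R) (A0 A1 : R -> Cl) B j t :
  open Om1 -> real_analytic_on Om1 A0 -> real_analytic_on Om1 A1 ->
  harmonic_sequence Om1 A0 A1 B -> Om1 t -> B j t = harmonic_seq A0 A1 j t.
Proof.
move=> oOm1 an0 an1 [B0 B1 aB [Om [f hf]]] Ot.
have m1 : (1 <= m)%N by case: m i0 => [[]|].
apply/ffunP => S; have rec k s Us := harmonic_sum_recursion S k hf aB (Us : Om1 s).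
have jE := odd_double_half j; rewrite -mul2n in jE.
case: (odd j) jE => jE; rewrite -jE ?add1n ?add0n.
  rewrite harmonic_seq_odd ffunE (derive1n_clifford _ _ oOm1 an1 Ot).
  apply: (@recursion_unique m.+2 Om1 (fun k t => B (2 * k).+1 t S)) => //.
  - exact: real_analytic_coord.
  - by move=> s Us; rewrite muln0 B1.
  - by move=> k s Us; have [_] := rec k s Us.
rewrite harmonic_seq_even ffunE (derive1n_clifford _ _ oOm1 an0 Ot).
apply: (@recursion_unique m Om1 (fun k t => B (2 * k)%N t S)) => //.
- exact: real_analytic_coord.
- by move=> s Us; rewrite muln0 B0.
- by move=> k s Us; have [] := rec k s Us.
Qed.

End Uniqueness.

(** * Bessel form and initial values *)

Section BesselForm.
Variables (R : realType) (m : nat).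
Local Notation X := 'rV[R]_m.+1.
Local Notation Cl := (clifford R m).
Implicit Types (x : X) (S : {set 'I_m}) (t r : R) (B : nat -> R -> Cl).

(** Each factor (2k+2)(2k+p) equals 4 (k+1) (p/2 + k), and the last term is absorbed by the
    functional equation of Gamma at p/2 + k. *)
Lemma radial_weight_Gamma p k : (0 < p)%N ->
  (radial_weight p k)%:R * Gamma (p%:R / 2) =
    2 ^+ (2 * k) * k`!%:R * Gamma (p%:R / 2 + k%:R) :> R.
Proof.
move=> p0; have pp : (0 : R) < p%:R by rewrite ltr0n.
elim: k => [|k IHk].
  by rewrite /radial_weight big_ord0 muln0 expr0 fact0 !mul1r addr0.
rewrite radial_weightS natrM mulrAC IHk -[k.+1%:R]natr1 addrA GammaS; last first.
  by rewrite ltr_wpDr // divr_gt0.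
by rewrite mulnS exprD factS !(natrM, natrD) -[k.+1%:R]natr1; field.
Qed.

(** The order nu = m/2 - 1 corresponds to p = m, the even part, and nu = m/2 to p = m + 2, the odd
    part. *)
Lemma bessel_op_termE p (nu r : R) (g : R -> Cl) t k : (0 < p)%N -> nu + 1 = p%:R / 2 ->
  bessel_op_term nu r g t k = (Gamma (p%:R / 2))^-1 *:
    (((- 1) ^+ k * (r ^+ 2) ^+ k) *: ((radial_weight p k)%:R^-1 *: derive1n (2 * k) g t)).
Proof.
move=> p0 nuE; rewrite /bessel_op_term addrAC nuE !scalerA; congr (_ *: _).
have g0 : Gamma (p%:R / 2) != 0 :> R by rewrite gt_eqF // Gamma_gt0 // divr_gt0 ?ltr0n.
have w0 : (radial_weight p k)%:R != 0 :> R by rewrite pnatr_eq0 -lt0n radial_weight_gt0.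
by rewrite -radial_weight_Gamma // -exprM; field; rewrite w0 g0.
Qed.

Lemma seriesZ_cvg (v : nat -> Cl) (a : R) (l : Cl) :
  series v @ \oo --> l -> series (fun k => a *: v k) @ \oo --> a *: l.
Proof.
move=> c; have -> : series (fun k => a *: v k) = fun n => a *: series v n.
  by apply/funext => n; rewrite /series /= scaler_sumr.
exact: cvgZr.
Qed.

Lemma clgen_sqr (j : 'I_m) : clgen j * clgen j = -1 :> Cl.
Proof.
have h := @clgen_rel R m j j; rewrite eqxx mulr1 -mulr2n in h.
have n2 : (2 : R) != 0 by rewrite pnatr_eq0.
by apply: (scalerI n2); rewrite !scaler_nat h mulNrn.
Qed.

Lemma paravector0_vec t j : (paravector t 0 : X) ord0 (lift ord0 j) = 0.
Proof. by have /rowP /(_ j) := vecpart_paravector t (0 : 'rV[R]_m); rewrite !mxE. Qed.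

Lemma axial_sum_paravector0 (C : R -> nat -> R) (Om : set X) t :
  axial_bounded Om C -> Om (paravector t 0) -> axial_sum C (paravector t 0 : X) = C t 0%N.
Proof.
move=> bC Ot; have [q [M [xq cM]]] := bC _ Ot.
have s0 : sqvec (paravector t 0 : X) = 0.
  by rewrite /sqvec big1 // => j _; rewrite paravector0_vec expr0n.
have tE : (paravector t 0 : X) ord0 ord0 = t by exact: repart_paravector.
rewrite s0 tE in xq cM; rewrite /axial_sum s0 tE (psum_split cM) ?normr0 //.
by rewrite mul0r addr0.
Qed.

Lemma clifford_sum_paravector0 B (Om : set X) t :
  axial_sequence_bounded B Om -> Om (paravector t 0) ->
  clifford_sum B (paravector t 0) = B 0%N t.
Proof.
move=> bB Ot; apply/ffunP => S; rewrite clifford_sum_coord.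
rewrite (axial_sum_paravector0 (bB S).1 Ot) big1 => [|j _].
  by rewrite addr0 /even_coef expr0 mul1r muln0.
by rewrite paravector0_vec mul0r mulr0.
Qed.

(** Derivatives of functions of |x|^2 carry a factor x_j and vanish on the axis; only the linear
    term x_j e_j B_1 contributes. *)
Lemma partial_clifford_sum B (Om : set X) (f : X -> Cl) t j : open Om ->
  axial_sequence_bounded B Om -> (forall x, Om x -> f x = clifford_sum B x) ->
  Om (paravector t 0) -> partial (lift ord0 j) f (paravector t 0) = clgen j * B 1%N t.
Proof.
move=> oO bB fE Ot; set x : X := paravector t 0 in Ot *.
suff d : is_derive x (delta_mx 0 (lift ord0 j)) f (clgen j * B 1%N t) by have [_ <-] := d.
apply/is_derive_cliffordP => S.
have d1 := pderiv_axial_sum_vec j (bB S).1 Ot.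
pose G i (y : X) : R := gensign i S * (y ord0 (lift ord0 i) *
    axial_sum (odd_coef B (symdiff [set i]%SET S)) y).
pose dG i : R := gensign i S * ((i == j)%:R *
    axial_sum (odd_coef B (symdiff [set i]%SET S)) x).
have d2 i : is_derive x (delta_mx 0 (lift ord0 j)) (G i) (dG i).
  have d3 := pderiv_axial_sum_vec j (bB (symdiff [set i]%SET S)).2 Ot.
  have d4 := is_deriveM (is_derive_coord (lift ord0 i) (lift ord0 j) x) d3.
  apply: (is_derive_congr (is_deriveZ (gensign i S) d4)) => //.
  rewrite paravector0_vec scale0r add0r (inj_eq lift_inj) /dG.
  by rewrite /GRing.scale /= [_ * (i == j)%:R]mulrC.
have d5 := is_deriveD d1 (is_derive_sum d2).
apply: near_eq_is_derive (is_derive_congr d5 (fun y => erefl) _); last first.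
  rewrite paravector0_vec mulr0 mul0r add0r clgen_coord (bigD1 j) //= big1 => [|i ij].
    rewrite addr0 /dG eqxx mul1r (axial_sum_paravector0 (bB _).2 Ot).
    by rewrite /odd_coef expr0 mul1r muln0.
  by rewrite /dG (negbTE ij) mul0r mulr0.
apply: near_open oO Ot _ => y Oy; rewrite fE // clifford_sum_coord.
by rewrite fctE fct_sumE.
Qed.

End BesselForm.

Theorem theorem3p1 (R : realType) (m : nat) (Om1 : set R)
    (A0 A1 : R -> clifford R m) :
  (1 <= m)%N -> open Om1 ->
  real_analytic_on Om1 A0 -> real_analytic_on Om1 A1 ->
  exists A : nat -> R -> clifford R m,
    [/\ harmonic_sequence Om1 A0 A1 A,
        forall B : nat -> R -> clifford R m, harmonic_sequence Om1 A0 A1 B ->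
          forall (j : nat) (t : R), Om1 t -> B j t = A j t &
        forall (Om : set 'rV[R]_m.+1) (f : 'rV[R]_m.+1 -> clifford R m),
          harmonic_sum Om1 A Om f ->
          [/\ forall x : 'rV[R]_m.+1, Om x ->
                let r := eucl_norm (vecpart x) in
                [/\ cvgn (series (bessel_op_term (m%:R / 2 - 1) r A0 (repart x))),
                    cvgn (series (bessel_op_term (m%:R / 2) r A1 (repart x))) &
                    f x = Gamma (m%:R / 2) *:
                      (bessel_op (m%:R / 2 - 1) r A0 (repart x) +
                       (m%:R / 2) *: (clvec (vecpart x) *
                                      bessel_op (m%:R / 2) r A1 (repart x)))],
              forall t : R, Om1 t -> f (paravector t 0) = A0 t &
              forall t : R, Om1 t ->
                - (m%:R^-1) *: dirac_op f (paravector t 0) = A1 t]].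
Proof.
move=> m1 oOm1 an0 an1; have seqA := harmonic_sequence_harmonic_seq m1 oOm1 an0 an1.
exists (harmonic_seq A0 A1); split => //.
  move=> B seqB j t Ot.
  (* The assumption m >= 1 supplies the vector direction on which the uniqueness argument rests. *)
  exact: (harmonic_sequence_unique (Ordinal m1) j oOm1 an0 an1 seqB Ot).
move=> Om f hf; have [bA fE] := harmonic_sum_clifford_sum m1 hf.
have [[oO _ inOm _] _ _] := hf; have [A0E A1E _ _] := seqA.
have hd := @norm_hausdorff R (clifford R m).
have g0 : Gamma (m%:R / 2) != 0 :> R.
  by rewrite gt_eqF // Gamma_gt0 // divr_gt0 // ltr0n.
have m0 : m%:R != 0 :> R by rewrite pnatr_eq0 -lt0n.
split.
- move=> x Ox r; have rE : r ^+ 2 = sqvec x by rewrite eucl_norm_sqr sqnorm_vecpart.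
  have c0 : series (bessel_op_term (m%:R / 2 - 1) r A0 (repart x)) @ \oo -->
      (Gamma (m%:R / 2))^-1 *: even_sum (harmonic_seq A0 A1) x.
    have -> : bessel_op_term (m%:R / 2 - 1) r A0 (repart x) = fun k =>
        (Gamma (m%:R / 2))^-1 *:
          (clvec (vecpart x) ^+ (2 * k) * harmonic_seq A0 A1 (2 * k)%N (repart x)).
      apply/funext => k; rewrite (bessel_op_termE _ _ _ _ m1) ?subrK // rE.
      by rewrite clvec_even_mul sqnorm_vecpart harmonic_seq_even.
    by apply: seriesZ_cvg; exact: cvg_even_sum bA Ox.
  have c1 : series (bessel_op_term (m%:R / 2) r A1 (repart x)) @ \oo -->
      (Gamma (m.+2%:R / 2))^-1 *: odd_sum (harmonic_seq A0 A1) x.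
    have -> : bessel_op_term (m%:R / 2) r A1 (repart x) = fun k =>
        (Gamma (m.+2%:R / 2))^-1 *:
          (((- 1) ^+ k * sqvec x ^+ k) *: harmonic_seq A0 A1 (2 * k).+1 (repart x)).
      apply/funext => k; rewrite (@bessel_op_termE _ _ m.+2) // ?rE ?harmonic_seq_odd //.
      by rewrite -addn2 natrD; field.
    by apply: seriesZ_cvg; exact: cvg_odd_sum bA Ox.
  split; [by apply/cvg_ex; eexists; exact: c0|by apply/cvg_ex; eexists; exact: c1|].
  rewrite /bessel_op (cvg_lim hd c0) (cvg_lim hd c1) fE // scalerDr scalerA.
  rewrite mulfV // scale1r /clifford_sum; congr (_ + _).
  (* This explains the prefactor m/2 of the second Bessel term: it cancels the quotient of the two
     Gamma normalisations. *)
  have gE : Gamma (m.+2%:R / 2) = m%:R / 2 * Gamma (m%:R / 2) :> R.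
    rewrite (_ : m.+2%:R / 2 = m%:R / 2 + 1); last by rewrite -addn2 natrD; field.
    by rewrite GammaS // divr_gt0 // ltr0n.
  rewrite gE -scalerAr scalerA scalerA -[LHS]scale1r; congr (_ *: _).
  by field; rewrite m0 g0.
- move=> t Ot; rewrite fE; last exact: inOm.
  by rewrite (clifford_sum_paravector0 bA) ?A0E //; exact: inOm.
- move=> t Ot; rewrite /dirac_op.
  (* Each of the m generators contributes e_j e_j A_1 = - A_1, whence the normalisation - 1/m. *)
  under eq_bigr do
    rewrite (partial_clifford_sum _ oO bA fE (inOm t Ot)) mulrA clgen_sqr mulN1r.
  rewrite sumr_const card_ord mulNrn -[harmonic_seq _ _ _ _ *+ _]scaler_nat.
  rewrite scalerN scaleNr opprK scalerA /=.
  by rewrite mulVf // scale1r A1E.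
Qed.
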